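(* Let $\mathcal{G}_1=(\mathcal{E}_1,\mathcal{V}_1,m_1)$ (with $\mathcal{V}_1$ infinite) and $\mathcal{G}_2=(\mathcal{E}_2,\mathcal{V}_2,m_2)$ be graphs with magnetic potentials $\theta_1,\theta_2$, and let $\mathcal{I}\subset\mathcal{V}_2$ be non-empty. Assume that $\mathcal{G}:=\mathcal{G}_1\times_{\mathcal{I}}\mathcal{G}_2$, with its product magnetic potential $\theta$, is a discrete cusp. Then \[\mathcal{D}\big(\Delta_{\mathcal{G},\theta}^{1/2}\big)=\mathcal{D}\big(m_1^{-1/2}(\cdot)\otimes\Delta_{\mathcal{G}_2,\theta_2}^{1/2}\big).\] Moreover: 1) $\Delta_{\mathcal{G},\theta}$ has compact resolvent if and only if $\mathrm{Hol}_{\theta_2}\neq0$. 2) If $\mathrm{Hol}_{\theta_2}\neq0$, then \[\mathcal{D}\big(\Delta_{\mathcal{G},\theta}^{1/2}\big)=\mathcal{D}\big(\deg_{\mathcal{G}}^{1/2}(\cdot)\big)\quad\text{and}\quad \lim_{n\to\infty}\frac{\lambda_n(\Delta_{\mathcal{G},\theta})}{\lambda_n\big(m_1^{-1}(\cdot)\otimes\Delta_{\mathcal{G}_2,\theta_2}\big)}=1.\] Furthermore, setting $M:=\sup_{x\in\mathcal{V}_1}\deg_{\mathcal{G}_1}(x)\times\max_{y\in\mathcal{V}_2}(1/m_2(y))<\infty$, one has for all $\lambda\ge0$ \[\mathcal{N}_{\lambda-2M}\big(m_1^{-1}(\cdot)\otimes\Delta_{\mathcal{G}_2,\theta_2}\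big)\le\mathcal{N}_\lambda(\Delta_{\mathcal{G},\theta})\le\mathcal{N}_\lambda\big(m_1^{-1}(\cdot)\otimes\Delta_{\mathcal{G}_2,\theta_2}\big).\]
   Context: A (weighted) graph is a triple $\mathcal{G}=(\mathcal{E},\mathcal{V},m)$ with $\mathcal{V}$ a countable set, $\mathcal{E}:\mathcal{V}\times\mathcal{V}\to[0,\infty)$ symmetric, and $m:\mathcal{V}\to(0,\infty)$. Write $x\sim y$ if $\mathcal{E}(x,y)>0$. All graphs are locally finite, connected, and without loops ($\mathcal{E}(x,x)=0$). $\ell^2(\mathcal{V},m)$ is the Hilbert space of $f:\mathcal{V}\to\mathbb{C}$ with $\sum_x m(x)|f(x)|^2<\infty$; $\mathcal{C}_c(\mathcal{V})$ denotes finitely supported functions. A magnetic potential is a map $\theta:\mathcal{V}\times\mathcal{V}\to\mathbb{R}/2\pi\mathbb{Z}$ with $\theta_{x,y}=-\theta_{y,x}$ and $\theta_{x,y}=0$ if $\mathcal{E}(x,y)=0$. The magnetic Laplacian $\Delta_{\mathcal{G},\theta}$ is the Friedrichs extension in $\ell^2(\mathcal{V},m)$ of $(\Delta_{\mathcal{G},\theta}f)(x)=\frac1{m(x)}\sum_{y}\mathcal{E}(x,y)(f(x)-e^{i\theta_{x,y}}f(y))$ on $\mathcal{C}_c(\mathcal{V})$; it is the non-negative self-adjoint operator associated with the closure of the form $Q_{\mathcal{G},\theta}(f)=\frac12\sum_{x,y}\mathcal{E}(x,y)|f(x)-e^{i\theta_{x,y}}f(y)|^2$ on $\mathcal{C}_c(\mathcal{V})$.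 The degree is $\deg_{\mathcal{G}}(x)=\frac1{m(x)}\sum_y\mathcal{E}(x,y)$; $\deg_{\mathcal{G}}(\cdot)$ is the multiplication operator, and $\mathcal{D}(\deg_{\mathcal{G}}^{1/2}(\cdot))=\{f\in\ell^2(\mathcal{V},m):\deg_{\mathcal{G}}^{1/2}f\in\ell^2(\mathcal{V},m)\}$. The holonomy of $\theta$ assigns to each cycle (closed walk) $(x_0,\dots,x_N=x_0)$ with $x_i\sim x_{i+1}$ the element $\theta_{x_0,x_1}+\dots+\theta_{x_{N-1},x_N}\in\mathbb{R}/2\pi\mathbb{Z}$; $\mathrm{Hol}_\theta=0$ means that this vanishes for every cycle, and $\mathrm{Hol}_\theta\ne0$ otherwise. Product through $\mathcal{I}$: given $\mathcal{G}_1,\mathcal{G}_2$, magnetic potentials $\theta_1,\theta_2$ and $\mathcal{I}\subset\mathcal{V}_2$, $\mathcal{G}_1\times_{\mathcal{I}}\mathcal{G}_2=(\mathcal{E},\mathcal{V},m)$ has $\mathcal{V}=\mathcal{V}_1\times\mathcal{V}_2$, $m(x,y)=m_1(x)m_2(y)$, $\mathcal{E}((x,y),(x',y'))=\mathcal{E}_1(x,x')\delta_{y,y'}1_{\mathcal{I}}(y)+\delta_{x,x'}\mathcal{E}_2(y,y')$, and $\theta((x,y),(x',y'))=\theta_1(x,x')\delta_{y,y'}+\delta_{x,x'}\theta_2(y,y')$ (values on non-edges play no role and are set to $0$). One identifies $\ell^2(\mathcal{V},m)\simeq\ell^2(\mathcal{V}_1,m_1)\otimes\ell^2(\mathcal{V}_2,m_2)$;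 $m_1^{-1}(\cdot)$ denotes multiplication by $1/m_1$ and tensor products of self-adjoint operators are the usual self-adjoint ones. $\mathcal{G}_1\times_{\mathcal{I}}\mathcal{G}_2$ is a discrete cusp if: (H1) $m_1(x)\to0$ as $|x|\to\infty$, where $|x|$ is the combinatorial graph distance in $\mathcal{G}_1$ from $x$ to a fixed vertex; (H2) $\mathcal{G}_2$ is finite; (H3) $\sup_{x\in\mathcal{V}_1}\deg_{\mathcal{G}_1}(x)<\infty$ (equivalently, $\Delta_{\mathcal{G}_1,\theta_1}$ is bounded). For a self-adjoint operator $H$ bounded from below, $\lambda_n(H)$ is its $n$-th eigenvalue in increasing order counted with multiplicity, and $\mathcal{N}_\lambda(H)=\dim\operatorname{ran}1_{]-\infty,\lambda]}(H)$. $\mathcal{D}(H)$ is the domain of $H$. *)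

(* Defs.v *)
From HB Require Import structures.
From mathcomp Require Import all_boot all_order all_algebra.
From mathcomp Require Import complex.
From mathcomp Require Import all_classical all_reals all_analysis.

Set Implicit Arguments.
Unset Strict Implicit.
Unset Printing Implicit Defensive.

Import Order.TTheory GRing.Theory Num.Theory.
Import numFieldNormedType.Exports.

Local Open Scope classical_set_scope.
Local Open Scope ring_scope.

Section L2.
Context {R : realType} {V : countType}.
Local Notation C := R[i].
Implicit Types (m : V -> R) (f g : V -> C) (u v : nat -> V -> C).

(* Unconditional sums; only meaningful for absolutely summable families. *)
Definition rsum (a : V -> R) : R :=
  fine (\esum_(x in [set: V]) (a^\+ x)%:E) -
  fine (\esum_(x in [set: V]) (a^\- x)%:E).

Definition csum (a : V -> C) : C :=
  (rsum (fun x => complex.Re (a x)) +i* rsum (fun x => complex.Im (a x)))%C.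

(* Squared norm, with value +oo outside of l^2(V, m). *)
Definition l2sq m f : \bar R :=
  \esum_(x in [set: V]) (m x * Normc.normc (f x) ^+ 2)%:E.

Definition l2 m : set (V -> C) := [set f | (l2sq m f < +oo)%E].

(* Antilinear in the first argument. *)
Definition dotp m f g : C :=
  csum (fun x => (m x)%:C%C * (conjc (f x) * g x)).

Definition l2_cvg m u f : Prop :=
  l2sq m (fun x => u n x - f x) @[n --> \oo] --> 0%E.

Definition finitely_supported : set (V -> C) :=
  [set f | finite_set [set x | f x != 0]].

Definition lin_free n (e : 'I_n -> V -> C) : Prop :=
  forall c : 'I_n -> C,
    (forall x, \sum_(i < n) c i * e i x = 0) -> forall i, c i = 0.

(* Dimension of a linear subspace, in {0, 1, 2, ..., +oo}. *)
Definition dim (W : set (V -> C)) : \bar R :=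
  ereal_sup [set (n%:R : R)%:E | n in
    [set n | exists e : 'I_n -> V -> C, (forall i, W (e i)) /\ lin_free e]].

End L2.

(** * Unbounded operators on l^2(V, m), represented by their graphs *)

Definition operator (R : realType) (V : countType) :=
  set ((V -> R[i]) * (V -> R[i])).

Section Operators.
Context {R : realType} {V : countType}.
Local Notation C := R[i].
Implicit Types (m : V -> R) (A B H S P K : operator R V).

Definition dom A : set (V -> C) := [set f | exists g, A (f, g)].

Definition ran A : set (V -> C) := [set g | exists f, A (f, g)].

Definition op_comp A B : operator R V :=
  [set p | exists g, B (p.1, g) /\ A (g, p.2)].

Definition id_op m : operator R V := [set p | l2 m p.1 /\ p.2 = p.1].

Definition mul_op m (phi : V -> R) : operator R V :=
  [set p | [/\ l2 m p.1, l2 m p.2 & forall x, p.2 x = (phi x)%:C%C * p.1 x]].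

Definition densely_defined m A : Prop :=
  forall f, l2 m f -> exists u, (forall n, dom A (u n)) /\ l2_cvg m u f.

Definition adjoint m A : operator R V :=
  [set p | [/\ l2 m p.1, l2 m p.2 &
    forall h k, A (h, k) -> dotp m p.1 k = dotp m p.2 h]].

Definition self_adjoint m A : Prop := densely_defined m A /\ adjoint m A = A.

Definition nonneg_op m A : Prop := forall f g, A (f, g) -> 0 <= dotp m f g.

Definition op_closure m A : operator R V :=
  [set p | [/\ l2 m p.1, l2 m p.2 & exists u a,
    [/\ forall n, A (u n, a n), l2_cvg m u p.1 & l2_cvg m a p.2]]].

(* The sequence u, with a n = A (u n), converges to f in l^2 and is Cauchy for
   the form h |-> <h, A h>; thus f is in the domain of the closure of this form
   if and only if such a sequence exists. *)
Definition form_approx m A (u a : nat -> V -> C) (f : V -> C) : Prop :=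
  [/\ forall n, A (u n, a n), l2_cvg m u f &
    forall e : R, 0 < e -> exists N : nat, forall i j, (N <= i)%N -> (N <= j)%N ->
      Normc.normc
        (dotp m (fun x => u i x - u j x) (fun x => a i x - a j x)) < e].

(* Friedrichs extension of a non-negative symmetric operator A: the operator
   associated with the closure q of the form <h, A f> on dom A, i.e. (f, g) is
   in its graph iff f is in the domain of q and q(h, f) = <h, g> for all h in
   the domain of q. Here q(h, f) is the limit of <v n, A (u n)> for any
   approximating sequences v of h and u of f. *)
Definition friedrichs m A : operator R V :=
  [set p | [/\ l2 m p.1, l2 m p.2,
    exists u a, form_approx m A u a p.1 &
    forall h v b u a, l2 m h ->
      form_approx m A v b h -> form_approx m A u a p.1 ->
      Normc.normc (dotp m (v n) (a n) - dotp m h p.2)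
        @[n --> \oo] --> (0 : R)]].

(* The non-negative self-adjoint square root, which exists and is unique when H
   is itself non-negative and self-adjoint. *)
Definition is_sqrt_op m H S : Prop :=
  [/\ self_adjoint m S, nonneg_op m S & op_comp S S = H].

Definition sqrt_op m H : operator R V := get [set S | is_sqrt_op m H S].

Definition orth_proj m P : Prop :=
  [/\ self_adjoint m P, dom P = l2 m & op_comp P P = P].

(* E is the projection-valued measure with H = \int x dE(x): for each f the
   scalar measure mu_f(A) = <f, E(A) f> determines the domain and the quadratic
   form of H. It exists and is unique when H is self-adjoint. *)
Definition is_spectral_measure m H (E : set R -> operator R V) : Prop :=
  [/\ forall A : set (measurableTypeR R), measurable A -> orth_proj m (E A),
      E setT = id_op m &
      forall f, l2 m f ->
        exists mu : {measure set (measurableTypeR R) -> \bar R},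
        [/\ forall (A : set (measurableTypeR R)) g, measurable A ->
              E A (f, g) -> mu A = (complex.Re (dotp m f g))%:E,
            dom H f <-> (\int[mu]_x (x ^+ 2)%:E < +oo)%E &
            forall g, H (f, g) ->
              dotp m f g = (fine (\int[mu]_x x%:E))%:C%C]].

Definition spectral_proj m H : set R -> operator R V :=
  get [set E | is_spectral_measure m H E].

Definition eig_count m H (lambda : R) : \bar R :=
  dim (ran (spectral_proj m H `]-oo, lambda])).

Definition eigenspace H (mu : R) : set (V -> C) :=
  [set f | H (f, fun x => mu%:C%C * f x)].

(* lambda lists the eigenvalues of H in increasing order, each repeated
   according to its multiplicity; such a sequence is unique if it exists. *)
Definition eigenvalue_seq H (lambda : nat -> R) : Prop :=
  {homo lambda : i j / (i <= j)%N >-> i <= j} /\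
  forall mu, dim (eigenspace H mu) = counting [set n | lambda n = mu].

(* The graph of (H - z)^-1. *)
Definition resolvent H (z : C) : operator R V :=
  [set p | H (p.2, fun x => p.1 x + z * p.2 x)].

Definition in_resolvent_set m H (z : C) : Prop :=
  (forall g, l2 m g -> exists! f, resolvent H z (g, f)) /\
  exists c : R, forall g f, resolvent H z (g, f) ->
    (l2sq m f <= c%:E * l2sq m g)%E.

Definition compact_op m K : Prop :=
  forall u v : nat -> V -> C,
    (exists c : R, forall n, (l2sq m (u n) <= c%:E)%E) ->
    (forall n, K (u n, v n)) ->
    exists (s : nat -> nat) (f : V -> C),
      [/\ {homo s : i j / (i < j)%N}, l2 m f & l2_cvg m (v \o s) f].

Definition compact_resolvent m H : Prop :=
  exists z, in_resolvent_set m H z /\ compact_op m (resolvent H z).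

End Operators.

(** * Tensor products, with l^2(V1, m1) (x) l^2(V2, m2) = l^2(V1 * V2, m1 m2) *)

Section Tensor.
Context {R : realType} {V1 V2 : countType}.

Definition tensor_fun (f : V1 -> R[i]) (g : V2 -> R[i]) : V1 * V2 -> R[i] :=
  fun z => f z.1 * g z.2.

(* A (x) B on the algebraic tensor product of dom A and dom B. *)
Definition alg_tensor_op (A : operator R V1) (B : operator R V2) :
    operator R (V1 * V2)%type :=
  [set p | exists (n : nat) (f a : 'I_n -> V1 -> R[i]) (g b : 'I_n -> V2 -> R[i]),
    [/\ forall i, A (f i, a i), forall i, B (g i, b i),
        forall z, p.1 z = \sum_(i < n) tensor_fun (f i) (g i) z &
        forall z, p.2 z = \sum_(i < n) tensor_fun (a i) (b i) z]].

Definition tensor_op (m1 : V1 -> R) (m2 : V2 -> R)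
    (A : operator R V1) (B : operator R V2) : operator R (V1 * V2)%type :=
  op_closure (fun z => m1 z.1 * m2 z.2) (alg_tensor_op A B).

End Tensor.

Record wgraph (R : realType) (V : countType) := WGraph {
  weight : V -> V -> R;
  meas : V -> R }.

Section Graphs.
Context {R : realType} {V : countType}.
Implicit Types (G : wgraph R V) (theta : V -> V -> R).

Definition adj G : rel V := fun x y => 0 < weight G x y.

Definition is_graph G : Prop :=
  [/\ (forall x y, weight G x y = weight G y x) /\
      (forall x y, 0 <= weight G x y),
      forall x, 0 < meas G x,
      forall x, weight G x x = 0,
      forall x, finite_set [set y | adj G x y] &
      forall x y, exists p, path (adj G) x p /\ last x p = y].

Definition deg G (x : V) : R :=
  (meas G x)^-1 * \sum_(y \in [set: V]) weight G x y.

Definition gdist G (x y : V) : R :=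
  inf [set (size p)%:R | p in [set p | path (adj G) x p /\ last x p = y]].

(* Elements of R/2piZ are represented by real numbers, modulo this relation. *)
Definition eq_mod2pi (a b : R) : Prop := exists k : int, a = b + k%:~R * (2 * pi).

Definition magnetic_potential G theta : Prop :=
  (forall x y, eq_mod2pi (theta x y) (- theta y x)) /\
  (forall x y, weight G x y = 0 -> eq_mod2pi (theta x y) 0).

Definition expi (t : R) : R[i] := (cos t +i* sin t)%C.

Definition formal_laplacian G theta (f : V -> R[i]) (x : V) : R[i] :=
  ((meas G x)^-1)%:C%C *
  \sum_(y \in [set: V]) (weight G x y)%:C%C * (f x - expi (theta x y) * f y).

Definition laplacian_cc G theta : operator R V :=
  [set p | finitely_supported p.1 /\ p.2 = formal_laplacian G theta p.1].

Definition magnetic_laplacian G theta : operator R V :=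
  friedrichs (meas G) (laplacian_cc G theta).

(* The sum of theta along the walk x :: p, a representative modulo 2 pi. *)
Definition holonomy theta (x : V) (p : seq V) : R :=
  \sum_(t <- pairmap theta x p) t.

Definition trivial_holonomy G theta : Prop :=
  forall x p, path (adj G) x p -> last x p = x ->
    eq_mod2pi (holonomy theta x p) 0.

End Graphs.

Section Product.
Context {R : realType} {V1 V2 : countType}.
Implicit Types (I : set V2).

Definition prod_graph (G1 : wgraph R V1) (G2 : wgraph R V2) I : wgraph R (V1 * V2)%type :=
  WGraph
    (fun z w => weight G1 z.1 w.1 * (z.2 == w.2)%:R * \1_I z.2 +
                (z.1 == w.1)%:R * weight G2 z.2 w.2)
    (fun z => meas G1 z.1 * meas G2 z.2).

Definition prod_potential (G1 : wgraph R V1) (G2 : wgraph R V2) I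
    (theta1 : V1 -> V1 -> R)
    (theta2 : V2 -> V2 -> R) (z w : V1 * V2) : R :=
  if adj (prod_graph G1 G2 I) z w then
    theta1 z.1 w.1 * (z.2 == w.2)%:R + (z.1 == w.1)%:R * theta2 z.2 w.2
  else 0.

Definition sup_deg (V : countType) (G : wgraph R V) : \bar R :=
  ereal_sup (range (fun x => (deg G x)%:E)).

(* o is the vertex of G1 from which distances are measured. *)
Definition discrete_cusp (o : V1) (G1 : wgraph R V1) (G2 : wgraph R V2) : Prop :=
  [/\ forall e : R, 0 < e ->
        exists r : R, forall x, r <= gdist G1 x o -> meas G1 x < e,
      finite_set [set: V2] &
      (sup_deg G1 < +oo)%E].

End Product.

(* Main.v *)
(* The Laplacian splits as L = D + K, where D acts fibrewise as
   m_1^{-1}(x) Delta_2 and the horizontal part K is bounded, 0 <= K <= 2M, since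
   deg_{G_1} is bounded and G_2 is finite. Functions supported over finitely many
   x are a core for D, hence for L, so that the Friedrichs extension is the
   maximal operator {(f, L f) | f, L f in l^2}. The form of D is |N f|^2 with
   N = m_1^{-1/2} Delta_2^{1/2}, and truncating over x shows that N f in l^2
   describes the form domains of both D and L.

   A null vector of Delta_2 is a parallel section, which exists exactly when the
   holonomy vanishes. If it does, the functions m_1(x)^{-1/2} delta_x (x) psi, with
   psi parallel, are orthogonal of constant norm with L f bounded, so that no
   resolvent is compact. Otherwise |h| <= c |Delta_2^{1/2} h| on l^2(V_2), so
   that |N f| controls |m_1^{-1/2} f|; as m_1 vanishes at infinity, the form
   domains embed compactly, and the resolvents of D and L diagonalize. The
   inequalities D <= L <= D + 2M on equal domains then give, by min-max,
   mu_n <= lambda_n <= mu_n + 2M and the counting inequalities. *)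

From HB Require Import structures.
From mathcomp Require Import all_boot all_order all_algebra.
From mathcomp Require Import complex finmap.
From mathcomp Require Import all_classical all_reals all_analysis.
From mathcomp Require Import measurable_realfun ring lra.
Require Import Defs.

Set Implicit Arguments.
Unset Strict Implicit.
Unset Printing Implicit Defensive.

Import Order.TTheory GRing.Theory Num.Theory.
Import numFieldNormedType.Exports.

Local Open Scope classical_set_scope.
Local Open Scope ring_scope.

(** * Complex Hilbert spaces *)

(** All spectral facts are drawn from one bounded object, the resolvent [T] with
    [H f g <-> f = T (f + g)], that is T = (1 + H)^-1. For H >= 0 it satisfies T^2 <= T; this is
    enough to build the square root of H by a convergent iteration and, when T is compact and the
    space infinite-dimensional, an eigenbasis. Unbounded operators are handled as relations on an
    abstract Hilbert space, with a separate passage to sets of pairs of functions.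

    [sqrt_op] and [spectral_proj] pick some object with the required properties. Existence is shown,
    and every later argument is made to hold for an arbitrary candidate: the domain of the root uses
    only that S is its own adjoint and S^2 = H, the counting function only the projections and the
    first two moments of the scalar measures. No uniqueness theorem is involved.

    The constant 2M: the horizontal degree at (x, y) is deg_{G_1}(x) 1_I(y) / m_2(y) <= M, and |a -
    b|^2 <= 2|a|^2 + 2|b|^2 doubles it in the form. *)

Record hilbert (R : realType) := Hilbert {
  hsort :> lmodType R[i];
  dot : hsort -> hsort -> R[i];
  dotDr : forall f g h, dot f (g + h) = dot f g + dot f h;
  dotZr : forall a f g, dot f (a *: g) = a * dot f g;
  dotC : forall f g, dot g f = conjc (dot f g);
  dot_ge0 : forall f, 0 <= complex.Re (dot f f);
  dot_eq0 : forall f, complex.Re (dot f f) = 0 -> f = 0;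
  dot_complete : forall u : nat -> hsort,
    (forall e : R, 0 < e -> exists N : nat, forall i j, (N <= i)%N -> (N <= j)%N ->
      complex.Re (dot (u i - u j) (u i - u j)) < e) ->
    exists l, complex.Re (dot (u n - l) (u n - l)) @[n --> \oo] --> (0 : R) }.

Arguments dot {_ _} _ _ : simpl never.

Section HilbertTheory.
Context {R : realType}.
Local Notation C := R[i].

(** The discriminant inequality, behind every Cauchy-Schwarz inequality below, for inner products as
    well as for forms. When c <= 0 the hypothesis forces b = c = 0, as a suitable t makes the
    polynomial negative otherwise. *)
Lemma sqr_le_of_quadratic_ge0 (a b c : R) :
  (forall t, 0 <= a + 2 * t * b + t ^+ 2 * c) -> b ^+ 2 <= a * c.
Proof.
move=> h.
have a0 : 0 <= a by have := h 0; rewrite expr0n /= !(mulr0, mul0r) !addr0.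
have [c0|c0] := ltP 0 c.
  have := h (- b / c).
  have -> : a + 2 * (- b / c) * b + (- b / c) ^+ 2 * c = (a * c - b ^+ 2) / c.
    by field; rewrite gt_eqF.
  by rewrite pmulr_lge0 ?invr_gt0 // subr_ge0.
have [bE|b0] := eqVneq b 0.
  rewrite bE expr0n /=.
  have [->|cn0] := eqVneq c 0; first by rewrite mulr0.
  have c0' : c < 0 by rewrite lt_neqAle cn0.
  have := h ((a + 1) / (- c) + 1); rewrite bE mulr0 addr0.
  set s := (a + 1) / (- c).
  have s0 : 0 < s by rewrite divr_gt0 // ?oppr_gt0 // ltr_wpDl.
  have sc : s * c = - (a + 1) by rewrite /s; field.
  have -> : (s + 1) ^+ 2 * c = s * (s * c) + 2 * (s * c) + c by ring.
  rewrite sc => h1; exfalso; have : 0 <= s * a by rewrite mulr_ge0 // ltW.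
  lra.
have b2 : 0 < b ^+ 2 by rewrite exprn_even_gt0.
(* This t turns the linear term into -2(a + 1), so that the polynomial would be at most -a - 2 <
   0. *)
have := h (- (a + 1) / b).
have -> : 2 * (- (a + 1) / b) * b = - 2 * (a + 1) by field.
move=> h1.
have : 0 <= (- (a + 1) / b) ^+ 2 by exact: sqr_ge0.
move: h1; set s := _ ^+ 2 => h1 s0.
nra.
Qed.

Lemma Re_mulr (z : C) (r : R) : complex.Re (r%:C%C * z) = r * complex.Re z.
Proof. by case: z => a b /=; rewrite mul0r subr0. Qed.

Lemma Im_mulr (z : C) (r : R) : complex.Im (r%:C%C * z) = r * complex.Im z.
Proof. by case: z => a b /=; rewrite mul0r addr0. Qed.

Lemma ReD (z w : C) : complex.Re (z + w) = complex.Re z + complex.Re w.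
Proof. by case: z w => a b [c d]. Qed.

Lemma ImD (z w : C) : complex.Im (z + w) = complex.Im z + complex.Im w.
Proof. by case: z w => a b [c d]. Qed.

Lemma ReN (z : C) : complex.Re (- z) = - complex.Re z.
Proof. by case: z. Qed.

Lemma ImN (z : C) : complex.Im (- z) = - complex.Im z.
Proof. by case: z. Qed.

Lemma ReM (z w : C) : complex.Re (z * w) =
  complex.Re z * complex.Re w - complex.Im z * complex.Im w.
Proof. by case: z w => a b [c d]. Qed.

Lemma ImM (z w : C) : complex.Im (z * w) =
  complex.Re z * complex.Im w + complex.Im z * complex.Re w.
Proof. by case: z w => a b [c d]. Qed.

Lemma Re_sum (I : Type) (r : seq I) (P : pred I) (F : I -> C) :
  complex.Re (\sum_(i <- r | P i) F i) = \sum_(i <- r | P i) complex.Re (F i).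
Proof. by apply: (big_morph (@complex.Re R)) => // x y; exact: ReD. Qed.

Lemma Im_sum (I : Type) (r : seq I) (P : pred I) (F : I -> C) :
  complex.Im (\sum_(i <- r | P i) F i) = \sum_(i <- r | P i) complex.Im (F i).
Proof. by apply: (big_morph (@complex.Im R)) => // x y; exact: ImD. Qed.

Lemma complexP (z w : C) : complex.Re z = complex.Re w ->
  complex.Im z = complex.Im w -> z = w.
Proof. by case: z w => a b [c d] /= -> ->. Qed.

Lemma Re_conjc (z : C) : complex.Re (conjc z) = complex.Re z.
Proof. by case: z. Qed.

Lemma Im_conjc (z : C) : complex.Im (conjc z) = - complex.Im z.
Proof. by case: z. Qed.

Lemma conjcD (z w : C) : conjc (z + w) = conjc z + conjc w.
Proof. exact: rmorphD. Qed.

Lemma conjcM (z w : C) : conjc (z * w) = conjc z * conjc w.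
Proof. exact: rmorphM. Qed.

Lemma conjcR (r : R) : conjc (r%:C%C) = r%:C%C.
Proof. by rewrite /= oppr0. Qed.

Definition sqnc (z : C) : R := complex.Re z ^+ 2 + complex.Im z ^+ 2.

Lemma normcE (z : C) : Normc.normc z = Num.sqrt (sqnc z).
Proof. by case: z. Qed.

Lemma sqnc_ge0 (z : C) : 0 <= sqnc z.
Proof. by rewrite addr_ge0 // sqr_ge0. Qed.

Lemma normc_sqr (z : C) : Normc.normc z ^+ 2 = sqnc z.
Proof. by rewrite normcE sqr_sqrtr // sqnc_ge0. Qed.

Lemma sqncM (z w : C) : sqnc (z * w) = sqnc z * sqnc w.
Proof. by case: z w => a b [c d]; rewrite /sqnc /=; ring. Qed.

Lemma sqnc_eq0 (z : C) : sqnc z = 0 -> z = 0.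
Proof.
case: z => a b /eqP; rewrite /sqnc /= paddr_eq0 ?sqr_ge0 // !sqrf_eq0.
by move=> /andP[/eqP -> /eqP ->].
Qed.

Lemma sqncR (r : R) : sqnc (r%:C%C) = r ^+ 2.
Proof. by rewrite /sqnc /= expr0n /= addr0. Qed.

Lemma sqncN (z : C) : sqnc (- z) = sqnc z.
Proof. by case: z => a b; rewrite /sqnc /= !sqrrN. Qed.

Lemma mul_conjc (z : C) : conjc z * z = (sqnc z)%:C%C.
Proof. by case: z => a b; apply: complexP => /=; rewrite /sqnc /=; ring. Qed.

Lemma sqncD_le (z w : C) : sqnc (z + w) <= 2 * sqnc z + 2 * sqnc w.
Proof.
case: z w => a b [c d]; rewrite /sqnc /=.
have := sqr_ge0 (a - c); have := sqr_ge0 (b - d); nra.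
Qed.

Context {E : hilbert R}.
Implicit Types (f g h : E) (u v : nat -> E).

Definition rd f g : R := complex.Re (dot f g).
Definition nsq f : R := rd f f.
Definition nrm f : R := Num.sqrt (nsq f).

(** The factors a = 1 and a = i recover the real and the imaginary part, so complex identities
    follow from real ones. *)
Lemma dot_eqRe f g (z : C) : (forall a : C, rd f (a *: g) = complex.Re (a * z)) ->
  dot f g = z.
Proof.
move=> h; apply: complexP.
  by have := h 1; rewrite scale1r mul1r.
have := h (0 +i* 1)%C; rewrite /rd dotZr.
by case: (dot f g) z {h} => a b [c d] /=; rewrite !mul0r !mul1r !sub0r => /oppr_inj.
Qed.

Lemma rdDr f g h : rd f (g + h) = rd f g + rd f h.
Proof. by rewrite /rd dotDr ReD. Qed.
Lemma rdC f g : rd f g = rd g f.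
Proof. by rewrite /rd dotC Re_conjc. Qed.
Lemma rdDl f g h : rd (f + g) h = rd f h + rd g h.
Proof. by rewrite rdC rdDr !(rdC h). Qed.
Lemma rdZr (r : R) f g : rd f (r%:C%C *: g) = r * rd f g.
Proof. by rewrite /rd dotZr Re_mulr. Qed.
Lemma rdZl (r : R) f g : rd (r%:C%C *: f) g = r * rd f g.
Proof. by rewrite rdC rdZr rdC. Qed.
Lemma dotDl f g h : dot (f + g) h = dot f h + dot g h.
Proof. by rewrite dotC dotDr conjcD -!dotC. Qed.
Lemma dotZl a f g : dot (a *: f) g = conjc a * dot f g.
Proof. by rewrite dotC dotZr conjcM -dotC. Qed.
Lemma dot0r f : dot f 0 = 0.
Proof. by rewrite -(scale0r (0 : E)) dotZr mul0r. Qed.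
Lemma dot0l f : dot 0 f = 0.
Proof. by rewrite dotC dot0r conjc0. Qed.
Lemma dotNr f g : dot f (- g) = - dot f g.
Proof. by rewrite -scaleN1r dotZr mulN1r. Qed.
Lemma dotNl f g : dot (- f) g = - dot f g.
Proof. by rewrite -scaleN1r dotZl rmorphN rmorph1 mulN1r. Qed.
Lemma dotBr f g h : dot f (g - h) = dot f g - dot f h.
Proof. by rewrite dotDr dotNr. Qed.
Lemma dotBl f g h : dot (f - g) h = dot f h - dot g h.
Proof. by rewrite dotDl dotNl. Qed.
Lemma rd0r f : rd f 0 = 0.
Proof. by rewrite /rd dot0r. Qed.
Lemma rd0l f : rd 0 f = 0.
Proof. by rewrite /rd dot0l. Qed.
Lemma rdNr f g : rd f (- g) = - rd f g.
Proof. by rewrite /rd dotNr ReN. Qed.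
Lemma rdNl f g : rd (- f) g = - rd f g.
Proof. by rewrite /rd dotNl ReN. Qed.
Lemma rdBr f g h : rd f (g - h) = rd f g - rd f h.
Proof. by rewrite rdDr rdNr. Qed.
Lemma dot_sumr (I : Type) (r : seq I) (P : pred I) (F : I -> E) f :
  dot f (\sum_(i <- r | P i) F i) = \sum_(i <- r | P i) dot f (F i).
Proof. by apply: (big_morph (dot f)) => [x y|]; [exact: dotDr|exact: dot0r]. Qed.
Lemma dot_suml (I : Type) (r : seq I) (P : pred I) (F : I -> E) f :
  dot (\sum_(i <- r | P i) F i) f = \sum_(i <- r | P i) dot (F i) f.
Proof.
apply: (big_morph (fun x => dot x f)) => [x y|]; [exact: dotDl|exact: dot0l].
Qed.

Lemma nsq_ge0 f : 0 <= nsq f. Proof. exact: dot_ge0. Qed.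
Lemma nsq_eq0 f : nsq f = 0 -> f = 0. Proof. exact: dot_eq0. Qed.
Lemma dotff f : dot f f = (nsq f)%:C%C.
Proof.
apply: complexP => //=; have := congr1 (@complex.Im _) (dotC f f).
rewrite Im_conjc; lra.
Qed.
Lemma nsq0 : nsq 0 = 0. Proof. exact: rd0r. Qed.
Lemma nsqD f g : nsq (f + g) = nsq f + 2 * rd f g + nsq g.
Proof. rewrite /nsq rdDl !rdDr (rdC g f); ring. Qed.
Lemma nsqN f : nsq (- f) = nsq f.
Proof. by rewrite /nsq rdNl rdNr opprK. Qed.
Lemma nsqB f g : nsq (f - g) = nsq f - 2 * rd f g + nsq g.
Proof. by rewrite nsqD nsqN rdNr mulrN. Qed.
Lemma nsqZ a f : nsq (a *: f) = sqnc a * nsq f.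
Proof.
by rewrite /nsq /rd dotZr dotZl mulrA (mulrC a) mul_conjc Re_mulr.
Qed.
Lemma nsqZr (r : R) f : nsq (r%:C%C *: f) = r ^+ 2 * nsq f.
Proof. by rewrite nsqZ sqncR. Qed.

Lemma rd_sqr_le f g : rd f g ^+ 2 <= nsq f * nsq g.
Proof.
apply: sqr_le_of_quadratic_ge0 => t.
have := nsq_ge0 (f + t%:C%C *: g); rewrite nsqD rdZr nsqZr.
by rewrite mulrA.
Qed.

Lemma nrm_ge0 f : 0 <= nrm f. Proof. exact: sqrtr_ge0. Qed.
Lemma nrm_sqr f : nrm f ^+ 2 = nsq f. Proof. by rewrite sqr_sqrtr ?nsq_ge0. Qed.
Lemma nrm0 : nrm 0 = 0. Proof. by rewrite /nrm nsq0 sqrtr0. Qed.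
Lemma nrm_eq0 f : nrm f = 0 -> f = 0.
Proof. by move=> h; apply: nsq_eq0; rewrite -nrm_sqr h expr0n. Qed.
Lemma nrmN f : nrm (- f) = nrm f. Proof. by rewrite /nrm nsqN. Qed.
Lemma nrmBC f g : nrm (f - g) = nrm (g - f). Proof. by rewrite -nrmN opprB. Qed.

Lemma le_nrm_sqr f (r : R) : 0 <= r -> nsq f <= r ^+ 2 -> nrm f <= r.
Proof.
move=> r0 h; rewrite -(ger0_norm r0) -sqrtr_sqr.
by rewrite ler_wsqrtr.
Qed.

Lemma rd_norm_le f g : `|rd f g| <= nrm f * nrm g.
Proof.
rewrite -(ger0_norm (mulr_ge0 (nrm_ge0 f) (nrm_ge0 g))) -ler_sqr ?nnegrE //.
by rewrite !real_normK ?num_real // exprMn !nrm_sqr rd_sqr_le.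
Qed.

Lemma rd_le f g : rd f g <= nrm f * nrm g.
Proof. exact: le_trans (ler_norm _) (rd_norm_le f g). Qed.

Lemma sqnc_dot_le f g : sqnc (dot f g) <= nsq f * nsq g.
Proof.
have [z0|z0] := eqVneq (sqnc (dot f g)) 0.
  by rewrite z0 mulr_ge0 // nsq_ge0.
have zp : 0 < sqnc (dot f g) by rewrite lt_neqAle eq_sym z0 sqnc_ge0.
(* Rotating f by its own pairing with g makes the pairing real, equal to |<f,g>|^2; one such factor
   then cancels from the real inequality. *)
have := rd_sqr_le (dot f g *: f) g.
rewrite nsqZ /rd dotZl mul_conjc /= expr2 -mulrA.
by rewrite ler_pM2l.
Qed.

Lemma normc_dot_le f g : Normc.normc (dot f g) <= nrm f * nrm g.
Proof. by rewrite normcE /nrm -sqrtrM ?nsq_ge0 // ler_wsqrtr // sqnc_dot_le. Qed.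

Lemma nrmD f g : nrm (f + g) <= nrm f + nrm g.
Proof.
apply: le_nrm_sqr; first by rewrite addr_ge0 ?nrm_ge0.
by rewrite nsqD sqrrD !nrm_sqr; have := rd_le f g; lra.
Qed.

Lemma nrmB f g : nrm (f - g) <= nrm f + nrm g.
Proof. by rewrite -(nrmN g) nrmD. Qed.

Lemma nrm_dist f g h : nrm (f - h) <= nrm (f - g) + nrm (g - h).
Proof. by rewrite (le_trans _ (nrmD _ _)) // addrA subrK. Qed.

Lemma nrmZ a f : nrm (a *: f) = Num.sqrt (sqnc a) * nrm f.
Proof. by rewrite /nrm nsqZ sqrtrM // sqnc_ge0. Qed.

Lemma nrmZr (r : R) f : 0 <= r -> nrm (r%:C%C *: f) = r * nrm f.
Proof. by move=> r0; rewrite nrmZ sqncR sqrtr_sqr ger0_norm. Qed.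

Lemma nrm_gt0 f : f <> 0 -> 0 < nrm f.
Proof. by move=> h; rewrite lt_neqAle nrm_ge0 andbT; apply/eqP => /esym/nrm_eq0. Qed.

Lemma nsq_gt0 f : f <> 0 -> 0 < nsq f.
Proof. by move=> h; rewrite lt_neqAle nsq_ge0 andbT; apply/eqP => /esym/nsq_eq0. Qed.

Definition hcvg u f := nrm (u n - f) @[n --> \oo] --> (0 : R).

Lemma hcvgP u f : hcvg u f <->
  forall e, 0 < e -> exists N : nat, forall n, (N <= n)%N -> nrm (u n - f) < e.
Proof.
split=> [/cvgrPdist_lt h e e0|h].
  have [N _ hN] := h _ e0; exists N => n Nn.
  by have := hN n Nn; rewrite /= sub0r normrN ger0_norm // nrm_ge0.
apply/cvgrPdist_lt => e e0; have [N hN] := h _ e0.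
exists N => // n /= Nn; rewrite sub0r normrN ger0_norm ?nrm_ge0 //.
exact: hN.
Qed.

Lemma hcvg_squeeze u f (r : nat -> R) : (forall n, nrm (u n - f) <= r n) ->
  r n @[n --> \oo] --> (0 : R) -> hcvg u f.
Proof.
move=> h r0; apply: (squeeze_cvgr _ (cvg_cst 0) r0).
by apply: nearW => n /=; rewrite nrm_ge0 h.
Qed.

Lemma hcvg_cst f : hcvg (fun=> f) f.
Proof. by rewrite /hcvg subrr nrm0; exact: cvg_cst. Qed.

Lemma hcvgD u v f g : hcvg u f -> hcvg v g -> hcvg (fun n => u n + v n) (f + g).
Proof.
move=> hu hv; apply: (@hcvg_squeeze _ _ (fun n => nrm (u n - f) + nrm (v n - g))).
  by move=> n; rewrite opprD addrACA nrmD.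
by rewrite -(addr0 0); apply: cvgD.
Qed.

Lemma hcvgZ a u f : hcvg u f -> hcvg (fun n => a *: u n) (a *: f).
Proof.
move=> hu; apply: (@hcvg_squeeze _ _ (fun n => Num.sqrt (sqnc a) * nrm (u n - f))).
  by move=> n; rewrite -scalerBr nrmZ.
by rewrite -(mulr0 (Num.sqrt (sqnc a))); apply: cvgMr.
Qed.

Lemma hcvgN u f : hcvg u f -> hcvg (fun n => - u n) (- f).
Proof.
move=> hu; rewrite -scaleN1r.
by under eq_fun do rewrite -scaleN1r; exact: hcvgZ.
Qed.

Lemma hcvgB u v f g : hcvg u f -> hcvg v g -> hcvg (fun n => u n - v n) (f - g).
Proof. by move=> hu hv; apply: hcvgD => //; exact: hcvgN. Qed.

Lemma hcvg_unique u f g : hcvg u f -> hcvg u g -> f = g.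
Proof.
move=> hf hg; have /hcvgP h := hcvgB hf hg.
apply/subr0_eq/nrm_eq0/eqP; rewrite eq_le nrm_ge0 andbT.
apply/ler_addgt0Pl => e e0; rewrite addr0.
have [N hN] := h e e0; have := hN N (leqnn N).
by rewrite subrr sub0r nrmN => /ltW.
Qed.

Lemma hcvg_sub u f (s : nat -> nat) : hcvg u f -> (forall n, (n <= s n)%N) ->
  hcvg (u \o s) f.
Proof.
move=> /hcvgP h hs; apply/hcvgP => e e0; have [N hN] := h e e0.
by exists N => n Nn /=; apply: hN; exact: leq_trans (hs n).
Qed.

Lemma hcvg_lip (T : E -> E) (c : R) u f : 0 <= c ->
  (forall g h, nrm (T g - T h) <= c * nrm (g - h)) ->
  hcvg u f -> hcvg (T \o u) (T f).
Proof.
move=> c0 hT hu; apply: (@hcvg_squeeze _ _ (fun n => c * nrm (u n - f))).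
  by move=> n; exact: hT.
by rewrite -(mulr0 c); apply: cvgMr.
Qed.

Lemma hcvg_nrm u f : hcvg u f -> nrm (u n) @[n --> \oo] --> nrm f.
Proof.
move=> /hcvgP h; apply/cvgrPdist_lt => e e0; have [N hN] := h e e0.
exists N => // n /= Nn; apply: le_lt_trans (hN n Nn).
rewrite ler_norml; apply/andP; split.
  by have := nrmD f (u n - f); rewrite addrC subrK; lra.
by have := nrmD (u n) (f - u n); rewrite addrC subrK nrmBC; lra.
Qed.

Lemma hcvg_nsq u f : hcvg u f -> nsq (u n) @[n --> \oo] --> nsq f.
Proof.
move=> h; rewrite -nrm_sqr; under eq_fun do rewrite -nrm_sqr.
by have := hcvg_nrm h => h'; apply: cvgM.
Qed.

Lemma rdE f g : rd f g = (nsq (f + g) - nsq f - nsq g) / 2.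
Proof. by rewrite nsqD; field. Qed.

Lemma hcvg_rd u v f g : hcvg u f -> hcvg v g ->
  rd (u n) (v n) @[n --> \oo] --> rd f g.
Proof.
move=> hu hv; rewrite rdE; under eq_fun do rewrite rdE.
apply: cvgM; last exact: cvg_cst.
apply: cvgB; last exact: hcvg_nsq.
apply: cvgB; last exact: hcvg_nsq.
by apply: hcvg_nsq; exact: hcvgD.
Qed.

Lemma Im_dot f g : complex.Im (dot f g) = - rd f ((0 +i* 1)%C *: g).
Proof. by rewrite /rd dotZr; case: (dot f g) => a b /=; lra. Qed.

(** Inner products are continuous, so an identity between them need only be checked along
    approximations. This is how symmetry passes from truncated or finitely supported functions to
    whole domains. *)
Lemma hcvg_dot_eq u v f g u' v' f' g' :
  hcvg u f -> hcvg v g -> hcvg u' f' -> hcvg v' g' ->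
  (forall n, dot (u n) (v n) = dot (u' n) (v' n)) -> dot f g = dot f' g'.
Proof.
move=> hu hv hu' hv' e; apply: complexP.
  have h := hcvg_rd hu hv; have h' := hcvg_rd hu' hv'.
  apply: (cvg_unique _ h); rewrite //=.
  by move: h'; under eq_fun do rewrite /rd -e.
rewrite !Im_dot; congr (- _).
have h := hcvg_rd hu (hcvgZ (0 +i* 1)%C hv).
have h' := hcvg_rd hu' (hcvgZ (0 +i* 1)%C hv').
apply: (cvg_unique _ h); rewrite //=.
by move: h'; under eq_fun do rewrite /rd dotZr -e -dotZr.
Qed.

Lemma cauchy_hcvg u :
  (forall e : R, 0 < e -> exists N : nat, forall i j, (N <= i)%N -> (N <= j)%N ->
     nrm (u i - u j) < e) -> exists f, hcvg u f.
Proof.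
move=> h; have [|f hf] := @dot_complete _ E u.
  move=> e e0; have se : 0 < Num.sqrt e by rewrite sqrtr_gt0.
  have [N hN] := h _ se; exists N => i j Ni Nj.
  rewrite -[X in X < _]/(nsq _) -nrm_sqr -(sqr_sqrtr (ltW e0)).
  by rewrite ltrXn2r // ?nnegrE ?nrm_ge0 ?sqrtr_ge0 //; exact: hN.
exists f; rewrite /hcvg /nrm /nsq /rd -[X in _ --> X](@sqrtr0 R).
by apply: (cvg_comp _ Num.sqrt hf); exact: sqrt_continuous.
Qed.

Lemma cauchy_of_bound u (r : nat -> R) : (forall i j, (i <= j)%N -> nrm (u i - u j) <= r i) ->
  r n @[n --> \oo] --> (0 : R) -> exists f, hcvg u f.
Proof.
move=> h /cvgrPdist_lt hr; apply: cauchy_hcvg => e e0.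
have e20 : 0 < e / 2 by rewrite divr_gt0.
have [N _ hN] := hr _ e20.
have hN' : r N < e / 2.
  by have := hN N (leqnn N); rewrite /= sub0r normrN; apply: le_lt_trans; exact: ler_norm.
exists N => i j Ni Nj; apply: le_lt_trans (nrm_dist _ (u N) _) _.
rewrite (nrmBC (u i)); have := h _ _ Ni; have := h _ _ Nj; lra.
Qed.

End HilbertTheory.

(** * Projection theorem, linear maps, surjectivity of 1 + H *)

Section BoundedOperators.
Context {R : realType} {E : hilbert R}.
Local Notation C := R[i].
Implicit Types (f g h k : E) (T A B X : E -> E).

Lemma dot_inj f g : (forall k, dot k f = dot k g) -> f = g.
Proof.
move=> h; apply/subr0_eq/nsq_eq0; rewrite /nsq /rd dotBr (h (f - g)) subrr.
by [].
Qed.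

Lemma dot0_of_rd0 f g : (forall a : C, rd f (a *: g) = 0) -> dot f g = 0.
Proof. by move=> h; apply: dot_eqRe => a; rewrite mulr0 h. Qed.

Lemma nsq_parallelogram f g :
  nsq (f - g) = 2 * nsq f + 2 * nsq g - 4 * nsq ((2^-1 : R)%:C%C *: (f + g)).
Proof. by rewrite nsqZr nsqB nsqD; field. Qed.

Lemma inf_approx (P : E -> Prop) (F : E -> R) : (exists f, P f) ->
  (forall f, P f -> 0 <= F f) ->
  exists d : R, (forall f, P f -> d <= F f) /\
    (forall e : R, 0 < e -> exists2 f, P f & F f < d + e).
Proof.
move=> [f0 Pf0] F0.
pose S := [set F f | f in P].
have hS : has_inf S.
  split; first by exists (F f0), f0.
  by exists 0 => _ [f Pf <-]; exact: F0.
exists (inf S); split=> [f Pf|e e0].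
  by apply: ge_inf; [case: hS|exists f].
have [_ [f Pf <-] h] := inf_adherent e0 hS.
by exists f.
Qed.

(** The projection theorem: a minimizing sequence for the distance from f to W is Cauchy by the
    parallelogram identity, and f minus its limit is orthogonal to W, hence zero. *)
Lemma closed_subspace_full (W : E -> Prop) :
  W 0 -> (forall f g, W f -> W g -> W (f + g)) ->
  (forall a f, W f -> W (a *: f)) ->
  (forall u f, (forall n, W (u n)) -> hcvg u f -> W f) ->
  (forall f, (forall w, W w -> dot f w = 0) -> f = 0) -> forall f, W f.
Proof.
move=> W0 WD WZ Wcl Worth f.
have [d [dle dad]] := inf_approx (ex_intro W 0 W0) (fun w _ => nsq_ge0 (f - w)).
have /choice [w hw] : forall n : nat, exists w, W w /\ nsq (f - w) < d + (n.+1%:R)^-1.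
  move=> n; have [w Ww hw] := dad (n.+1%:R)^-1 (ltac:(by rewrite invr_gt0)).
  by exists w.
have hcau i j : (i <= j)%N -> nrm (w i - w j) <= Num.sqrt (4 * (i.+1%:R)^-1).
  move=> ij; rewrite ler_wsqrtr //.
  have -> : w i - w j = (f - w j) - (f - w i) by rewrite opprB [RHS]addrC addrA subrK.
  rewrite nsq_parallelogram.
  have -> : (2^-1 : R)%:C%C *: (f - w j + (f - w i)) = f - (2^-1 : R)%:C%C *: (w j + w i).
    rewrite addrACA -opprD scalerBr; congr (_ - _); rewrite scalerDr -scalerDl.
    suff -> : (2^-1 : R)%:C%C + (2^-1 : R)%:C%C = 1 :> C by rewrite scale1r.
    by apply: complexP => /=; field.
  have := dle _ (WZ (2^-1 : R)%:C%C _ (WD _ _ (hw j).1 (hw i).1)).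
  have := (hw i).2; have := (hw j).2.
  have : (j.+1%:R)^-1 <= (i.+1%:R)^-1 :> R by rewrite lef_pV2 ?posrE // ler_nat.
  by set xi : R := i.+1%:R^-1; set xj : R := j.+1%:R^-1; clearbody xi xj; lra.
have hlim : Num.sqrt (4 * (n.+1%:R)^-1) @[n --> \oo] --> (0 : R).
  have h4 : 4 * (n.+1%:R)^-1 @[n --> \oo] --> (4 * 0 : R).
    by apply: cvgMr; exact: cvg_harmonic.
  rewrite -[X in _ --> X](@sqrtr0 R) -(mulr0 4).
  by apply: (cvg_comp _ Num.sqrt h4); exact: sqrt_continuous.
have [p hp] := cauchy_of_bound hcau hlim.
have Wp : W p by apply: Wcl hp => n; exact: (hw n).1.
suff -> : f = p by [].
apply/subr0_eq/Worth => v Wv; apply: dot0_of_rd0 => a.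
have pd : nsq (f - p) <= d.
  have hc : nsq (f - w n) @[n --> \oo] --> nsq (f - p).
    by apply: hcvg_nsq; apply: hcvgB hp; exact: hcvg_cst.
  have hd : d + (n.+1%:R)^-1 @[n --> \oo] --> d + 0.
    by apply: cvgD; [exact: cvg_cst|exact: cvg_harmonic].
  rewrite -[d]addr0; apply: ler_cvg_to hc hd _.
  by apply: nearW => n; exact: ltW (hw n).2.
(* Moving p by t a v inside W cannot decrease the distance. This gives a nonnegative polynomial in t
   without constant term, whose linear coefficient must vanish. *)
apply/eqP; rewrite -sqrf_eq0 eq_le sqr_ge0 andbT.
rewrite -[X in _ <= X](mul0r (nsq (a *: v))); apply: sqr_le_of_quadratic_ge0 => t.
have := dle _ (WD _ _ Wp (WZ (- t%:C%C) _ (WZ a _ Wv))).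
rewrite scaleNr opprD opprK addrA [nsq (_ + _)]nsqD rdZr nsqZr.
by move: pd; lra.
Qed.

Definition is_linear T := forall a f g, T (a *: f + g) = a *: T f + T g.
Definition symmetric_op T := forall f g, dot (T f) g = dot f (T g).

Lemma linD T : is_linear T -> forall f g, T (f + g) = T f + T g.
Proof. by move=> h f g; rewrite -[f]scale1r h !scale1r. Qed.
Lemma lin0 T : is_linear T -> T 0 = 0.
Proof. by move=> h; apply: (addIr (T 0)); rewrite -linD // !add0r. Qed.
Lemma linZ T : is_linear T -> forall a f, T (a *: f) = a *: T f.
Proof. by move=> h a f; rewrite -[a *: f]addr0 h (lin0 h) addr0. Qed.
Lemma linN T : is_linear T -> forall f, T (- f) = - T f.
Proof. by move=> h f; rewrite -scaleN1r linZ // scaleN1r. Qed.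
Lemma linB T : is_linear T -> forall f g, T (f - g) = T f - T g.
Proof. by move=> h f g; rewrite linD // linN. Qed.
Lemma lin_sum T (I : Type) (r : seq I) (P : pred I) (F : I -> E) : is_linear T ->
  T (\sum_(i <- r | P i) F i) = \sum_(i <- r | P i) T (F i).
Proof. by move=> h; apply: (big_morph T) => [x y|]; [exact: linD|exact: lin0]. Qed.

(** Moving T to the other side of the inner product turns linearity of T into linearity of [dot].
    Symmetric maps defined everywhere therefore never need a separate linearity assumption. *)
Lemma symmetric_linear T : symmetric_op T -> is_linear T.
Proof.
by move=> h a f g; apply: dot_inj => k; rewrite -h !dotDr !dotZr !h.
Qed.

Lemma hcvg_lin T (c : R) : is_linear T -> 0 <= c ->
  (forall f, nrm (T f) <= c * nrm f) ->
  forall u f, hcvg u f -> hcvg (T \o u) (T f).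
Proof. by move=> hl c0 hT u f; apply: (hcvg_lip c0) => g h; rewrite -linB. Qed.

Section Resolvent.
Variable H : E -> E -> Prop.
Hypothesis H0 : H 0 0.
Hypothesis HD : forall f g f' g', H f g -> H f' g' -> H (f + f') (g + g').
Hypothesis HZ : forall a f g, H f g -> H (a *: f) (a *: g).
Hypothesis Hcl : forall u v f g, (forall n, H (u n) (v n)) ->
  hcvg u f -> hcvg v g -> H f g.
Hypothesis Hge0 : forall f g, H f g -> 0 <= rd f g.
Hypothesis Horth : forall k, (forall f g, H f g -> dot k (f + g) = 0) -> k = 0.

(** Positivity gives |f|^2 + |g|^2 <= |f + g|^2 on the graph, so a convergent sequence f + g forces
    both components to converge and the range of 1 + H is closed. [Horth] says that its orthogonal
    complement is trivial. *)
Lemma resolvent_onto k : exists f g, H f g /\ f + g = k.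
Proof.
apply: (@closed_subspace_full (fun k => exists f g, H f g /\ f + g = k)).
- by exists 0, 0; rewrite addr0.
- move=> _ _ [f [g [h <-]]] [f' [g' [h' <-]]]; exists (f + f'), (g + g').
  by split; [exact: HD|rewrite addrACA].
- move=> a _ [f [g [h <-]]]; exists (a *: f), (a *: g).
  by split; [exact: HZ|rewrite scalerDr].
- move=> u l /choice [f /choice [g hfg]] hu.
  have key i j : nsq (f i - f j) + nsq (g i - g j) <= nsq (u i - u j).
    rewrite -(hfg i).2 -(hfg j).2 opprD addrACA [leRHS]nsqD.
    have : H (f i - f j) (g i - g j).
      rewrite -[- f j]scaleN1r -[- g j]scaleN1r; apply: HD; first exact: (hfg i).1.
      by apply: HZ; exact: (hfg j).1.
    by move=> /Hge0; lra.
  have hcau e : 0 < e -> exists N : nat, forall i j, (N <= i)%N -> (N <= j)%N ->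
      nrm (u i - u j) < e.
    move=> e0; have e20 : 0 < e / 2 by rewrite divr_gt0.
    have /hcvgP /(_ _ e20) [N hN] := hu; exists N => i j Ni Nj.
    apply: le_lt_trans (nrm_dist _ l _) _; rewrite (nrmBC l).
    by have := hN _ Ni; have := hN _ Nj; lra.
  have [lf hlf] : exists lf, hcvg f lf.
    apply: cauchy_hcvg => e /hcau [N hN]; exists N => i j Ni Nj.
    apply: le_lt_trans (hN _ _ Ni Nj); rewrite ler_wsqrtr //.
    by have := key i j; have := nsq_ge0 (g i - g j); lra.
  have [lg hlg] : exists lg, hcvg g lg.
    apply: cauchy_hcvg => e /hcau [N hN]; exists N => i j Ni Nj.
    apply: le_lt_trans (hN _ _ Ni Nj); rewrite ler_wsqrtr //.
    by have := key i j; have := nsq_ge0 (f i - f j); lra.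
  exists lf, lg; split; first by apply: Hcl hlf hlg => n; exact: (hfg n).1.
  apply: (@hcvg_unique _ _ (fun n => f n + g n)); first exact: hcvgD.
  by under eq_fun do rewrite (hfg _).2.
- move=> f hf; apply: Horth => g g' hg; apply: hf; exists g, g'; split=> //.
Qed.

End Resolvent.

(** * The square root of 1 - T by iteration *)

Section SquareRoot.
Variable T : E -> E.
Hypothesis Tsym : symmetric_op T.
Hypothesis Tle : forall f, nrm (T f) <= nrm f.
Let Tlin := symmetric_linear Tsym.

(* A is a polynomial in T with nonnegative coefficients, whose value at 1 is a. *)
Inductive npoly : (E -> E) -> R -> Prop :=
| npoly0 : npoly (fun=> 0) 0
| npolyX : npoly T 1
| npolyD A B a b : npoly A a -> npoly B b -> npoly (fun f => A f + B f) (a + b)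
| npolyM A B a b : npoly A a -> npoly B b -> npoly (fun f => A (B f)) (a * b)
| npolyZ A a (t : R) : 0 <= t -> npoly A a -> npoly (fun f => t%:C%C *: A f) (t * a).

Lemma npoly_linear A a : npoly A a -> is_linear A.
Proof.
elim=> [|//|{}A B {}a b _ hA _ hB|{}A B {}a b _ hA _ hB|{}A {}a t _ _ hA] c f g.
- by rewrite scaler0 addr0.
- by rewrite hA hB scalerDr addrACA.
- by rewrite hB hA.
- by rewrite hA scalerDr !scalerA mulrC.
Qed.

Lemma npoly_ge0 A a : npoly A a -> 0 <= a.
Proof.
elim=> //= [A' B a' b _ hA _ hB|A' B a' b _ hA _ hB|A' a' t t0 _ hA].
- exact: addr_ge0.
- exact: mulr_ge0.
- exact: mulr_ge0.
Qed.

Lemma npoly_bound A a : npoly A a -> forall f, nrm (A f) <= a * nrm f.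
Proof.
elim=> [f|f|{}A B {}a b _ hA _ hB f|{}A B {}a b nA hA _ hB f|{}A {}a t t0 _ hA f].
- by rewrite nrm0 mul0r.
- by rewrite mul1r.
- by rewrite mulrDl (le_trans (nrmD _ _)) // lerD.
- by rewrite (le_trans (hA _)) // -mulrA ler_wpM2l // (npoly_ge0 nA).
- by rewrite nrmZr // -mulrA ler_wpM2l.
Qed.

Lemma npoly_comm X A a : is_linear X -> (forall f, X (T f) = T (X f)) ->
  npoly A a -> forall f, X (A f) = A (X f).
Proof.
move=> hX hXT.
elim=> [f|//|{}A B {}a b _ hA _ hB f|{}A B {}a b _ hA _ hB f|{}A {}a t _ _ hA f].
- exact: lin0.
- by rewrite linD // hA hB.
- by rewrite hA hB.
- by rewrite linZ // hA.
Qed.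

Lemma npoly_comm2 A a B b : npoly A a -> npoly B b -> forall f, A (B f) = B (A f).
Proof.
move=> hA hB; apply: (npoly_comm (npoly_linear hA)) hB.
by move=> f; rewrite (npoly_comm Tlin _ hA).
Qed.

Lemma npoly_symmetric A a : npoly A a -> symmetric_op A.
Proof.
elim=> [f g|//|{}A B {}a b _ hA _ hB f g|{}A B {}a b nA hA nB hB f g|{}A {}a t _ _ hA f g].
- by rewrite dot0l dot0r.
- by rewrite dotDl dotDr hA hB.
- by rewrite hA hB (npoly_comm2 nB nA).
- by rewrite dotZl dotZr hA conjcR.
Qed.

(* The iteration Y := (T + Y^2) / 2, whose fixed point Y solves (1 - Y)^2 = 1 - T. *)
Fixpoint sqiter (n : nat) : E -> E :=
  if n is n'.+1 then fun f => (2^-1 : R)%:C%C *: (T f + sqiter n' (sqiter n' f))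
  else fun=> 0.

Fixpoint sqiter1 (n : nat) : R :=
  if n is n'.+1 then 2^-1 * (1 + sqiter1 n' * sqiter1 n') else 0.

Lemma npoly_sqiter n : npoly (sqiter n) (sqiter1 n).
Proof.
elim: n => [|n IH]; first exact: npoly0.
by apply: npolyZ; [rewrite invr_ge0|apply: npolyD; [exact: npolyX|exact: npolyM]].
Qed.

(** Polynomials in T commute, so Y_{n+2} - Y_{n+1} = (Y_{n+1} - Y_n)(Y_{n+1} + Y_n) / 2, and by
    induction each increment has nonnegative coefficients. Its norm is then at most its value at 1,
    which reduces convergence to that of a bounded monotone real sequence. *)
Lemma sqiter_diffS n : exists D, npoly D (sqiter1 n.+1 - sqiter1 n) /\
  forall f, sqiter n.+1 f = sqiter n f + D f.
Proof.
elim: n => [|n [D [hD eD]]].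
  exists (fun f => (2^-1 : R)%:C%C *: T f); split=> [|f].
    rewrite /= mulr0 addr0 subr0; apply: npolyZ; first by rewrite invr_ge0.
    exact: npolyX.
  by rewrite /= addr0 add0r.
exists (fun f => (2^-1 : R)%:C%C *: D (sqiter n f + sqiter n.+1 f)); split.
  have -> : sqiter1 n.+2 - sqiter1 n.+1 =
      2^-1 * ((sqiter1 n.+1 - sqiter1 n) * (sqiter1 n + sqiter1 n.+1)).
    have -> : sqiter1 n.+2 = 2^-1 * (1 + sqiter1 n.+1 * sqiter1 n.+1) by [].
    have -> : sqiter1 n.+1 = 2^-1 * (1 + sqiter1 n * sqiter1 n) by [].
    by field.
  apply: npolyZ; first by rewrite invr_ge0.
  apply: (npolyM hD); apply: npolyD; exact: npoly_sqiter.
move=> f.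
have -> : sqiter n.+2 f = (2^-1 : R)%:C%C *: (T f + sqiter n.+1 (sqiter n.+1 f)) by [].
rewrite (eD (sqiter n.+1 f)) {1}(eD f) (linD (npoly_linear (npoly_sqiter n))).
rewrite -(npoly_comm2 hD (npoly_sqiter n)) (linD (npoly_linear hD)).
by rewrite -scalerDr -!addrA.
Qed.

Lemma sqiter_diff n p : exists D, npoly D (sqiter1 (n + p) - sqiter1 n) /\
  forall f, sqiter (n + p) f = sqiter n f + D f.
Proof.
elim: p => [|p [D [hD eD]]].
  exists (fun=> 0); rewrite addn0 subrr; split; first exact: npoly0.
  by move=> f; rewrite addr0.
have [D' [hD' eD']] := sqiter_diffS (n + p).
exists (fun f => D f + D' f); rewrite addnS; split.
  have -> : sqiter1 (n + p).+1 - sqiter1 n =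
    (sqiter1 (n + p) - sqiter1 n) + (sqiter1 (n + p).+1 - sqiter1 (n + p)) by ring.
  exact: npolyD.
by move=> f; rewrite eD' eD addrA.
Qed.

Lemma sqiter1_ge0 n : 0 <= sqiter1 n.
Proof. exact: npoly_ge0 (npoly_sqiter n). Qed.

Lemma sqiter1_le1 n : sqiter1 n <= 1.
Proof.
elim: n => [|n IH] /=; first exact: ler01.
have : sqiter1 n * sqiter1 n <= 1 * 1 by rewrite ler_pM ?sqiter1_ge0.
lra.
Qed.

Lemma sqiter_le n f : nrm (sqiter n f) <= nrm f.
Proof.
apply: le_trans (npoly_bound (npoly_sqiter n) f) _.
by rewrite ler_piMl ?nrm_ge0 // sqiter1_le1.
Qed.

Lemma sqiter_cvg f : exists g, hcvg (sqiter^~ f) g.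
Proof.
have hc : sqiter1 n @[n --> \oo] --> sup (range sqiter1).
  apply: nondecreasing_cvgn.
    apply/nondecreasing_seqP => n; have [D [hD _]] := sqiter_diffS n.
    by rewrite -subr_ge0 (npoly_ge0 hD).
  by exists 1 => _ [n _ <-]; exact: sqiter1_le1.
set l := sup _ in hc.
apply: (@cauchy_of_bound _ _ _ (fun n => (l - sqiter1 n) * nrm f)).
  move=> i j /subnKC <-; have [D [hD ->]] := sqiter_diff i (j - i).
  rewrite opprD addrA subrr sub0r nrmN (le_trans (npoly_bound hD _)) //.
  rewrite ler_wpM2r ?nrm_ge0 // lerB //.
  apply: ub_le_sup; last by exists (i + (j - i))%N.
  by exists 1 => _ [n _ <-]; exact: sqiter1_le1.
rewrite -(mul0r (nrm f)) -(subrr l); apply: cvgM; last exact: cvg_cst.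
by apply: cvgB => //; exact: cvg_cst.
Qed.

(** B = 1 - Y for the limit Y of the iteration; positivity and |f - B f| <= |f| come from |Y f| <=
    |f|. The final clause, commutation with all bounded maps that commute with T, is what allows
    square roots of different operators to be combined. *)
Lemma sqrt_one_sub_ex : exists B,
  [/\ symmetric_op B, forall f, 0 <= rd f (B f), forall f, nrm (f - B f) <= nrm f,
    forall f, B (B f) = f - T f &
    forall X c, is_linear X -> 0 <= c -> (forall f, nrm (X f) <= c * nrm f) ->
      (forall f, X (T f) = T (X f)) -> forall f, X (B f) = B (X f)].
Proof.
have [Y hY] := choice sqiter_cvg.
have Ysym : symmetric_op Y.
  move=> f g; apply: (hcvg_dot_eq (hY f) (hcvg_cst g) (hcvg_cst f) (hY g)) => n.
  exact: npoly_symmetric (npoly_sqiter n) _ _.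
have Ylin := symmetric_linear Ysym.
have Yle f : nrm (Y f) <= nrm f.
  apply: (ler_cvg_to (hcvg_nrm (hY f)) (cvg_cst (nrm f))).
  by apply: nearW => n; exact: sqiter_le.
have Ycomm X c : is_linear X -> 0 <= c -> (forall f, nrm (X f) <= c * nrm f) ->
    (forall f, X (T f) = T (X f)) -> forall f, X (Y f) = Y (X f).
  move=> Xl c0 Xb XT f; apply: (hcvg_unique (hcvg_lin Xl c0 Xb (hY f))).
  rewrite (_ : X \o _ = sqiter^~ (X f)); first exact: hY.
  by apply/funext => n /=; exact: (npoly_comm Xl XT (npoly_sqiter n)).
have Yeq f : Y f = (2^-1 : R)%:C%C *: (T f + Y (Y f)).
  have h2 : hcvg (fun n => sqiter n (sqiter n f)) (Y (Y f)).
    apply: (@hcvg_squeeze _ _ _ _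
      (fun n => nrm (sqiter n f - Y f) + nrm (sqiter n (Y f) - Y (Y f)))).
      move=> n; apply: le_trans (nrm_dist _ (sqiter n (Y f)) _) _.
      rewrite lerD2r -(linB (npoly_linear (npoly_sqiter n))).
      exact: sqiter_le.
    by rewrite -(addr0 0); apply: cvgD; exact: hY.
  have h3 := hcvgZ (2^-1 : R)%:C%C (hcvgD (hcvg_cst (T f)) h2).
  apply: (hcvg_unique (u := fun n => sqiter n.+1 f)) h3.
  by apply: (@hcvg_sub _ _ (sqiter^~ f) _ S) => //; exact: hY.
exists (fun f => f - Y f); split.
- by move=> f g; rewrite dotBl dotBr Ysym.
- move=> f; rewrite rdBr subr_ge0 (le_trans (rd_le _ _)) // -[X in _ <= X](nrm_sqr f).
  by rewrite expr2 ler_wpM2l // nrm_ge0.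
- by move=> f; rewrite opprB addrC subrK.
- move=> f; rewrite (linB Ylin) opprB addrA.
  have e : Y f + Y f = T f + Y (Y f).
    rewrite {1 2}Yeq -scalerDl -[RHS]scale1r; congr (_ *: _).
    by apply: complexP => /=; field.
  have -> : T f = Y f + Y f - Y (Y f) by rewrite e addrK.
  by rewrite opprB opprD !addrA; congr (_ - _); rewrite addrAC.
- by move=> X c Xl c0 Xb XT f; rewrite linB // (Ycomm X c).
Qed.

End SquareRoot.
End BoundedOperators.

(** * Square roots and diagonalization of bounded operators *)

Section PositiveSelfAdjoint.
Context {R : realType} {E : hilbert R}.
Local Notation C := R[i].
Implicit Types (f g h k : E).
Variable T : E -> E.
Hypothesis Tsym : symmetric_op T.
(** For symmetric T this is T^2 <= T, equivalently 0 <= T <= 1: the property that characterizes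
    resolvents (1 + H)^-1 of nonnegative H once T is injective. *)
Hypothesis Tpos : forall f, nsq (T f) <= rd f (T f).
Hypothesis Tinj : forall f, T f = 0 -> f = 0.
Let Tlin := symmetric_linear Tsym.

Lemma firm_le f : nrm (T f) <= nrm f.
Proof.
have [/eqP|h] := eqVneq (nrm (T f)) 0; first by move=> /eqP ->; exact: nrm_ge0.
have h' : 0 < nrm (T f) by rewrite lt_neqAle eq_sym h nrm_ge0.
rewrite -(ler_pM2l h') -expr2 nrm_sqr mulrC.
exact: le_trans (Tpos f) (rd_le _ _).
Qed.

Lemma firm_sub_le f : nrm (f - T f) <= nrm f.
Proof.
by rewrite ler_wsqrtr // nsqB; have := Tpos f; have := nsq_ge0 (T f); lra.
Qed.

(* With A^2 = T and B^2 = 1 - T, the graph {(A g, B g)} is the square root of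
   T^-1 - 1. *)
Lemma sqrt_resolvent_ex : exists S : E -> E -> Prop,
  [/\ forall f g, S f g <-> (forall h k, S h k -> dot f k = dot g h),
      forall f g, S f g -> 0 <= rd f g &
      forall f g, (exists h, S f h /\ S h g) <-> f = T (f + g)].
Proof.
have [B [Bsym Bge0 _ BB Bcomm]] := sqrt_one_sub_ex Tsym firm_le.
pose T' f := f - T f.
have T'sym : symmetric_op T' by move=> f g; rewrite dotBl dotBr Tsym.
have [A [Asym Age0 Ale AA Acomm]] := sqrt_one_sub_ex T'sym firm_sub_le.
have {}AA f : A (A f) = T f by rewrite AA /T' opprB addrC subrK.
have Alin := symmetric_linear Asym; have Blin := symmetric_linear Bsym.
have Ab f : nrm (A f) <= 1 * nrm f.
  rewrite mul1r; apply: le_nrm_sqr; first exact: nrm_ge0.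
  rewrite /nsq /rd Asym AA nrm_sqr; apply: le_trans (rd_le _ _) _.
  by rewrite -nrm_sqr expr2 ler_wpM2l ?nrm_ge0 // firm_le.
have Bb f : nrm (B f) <= 1 * nrm f.
  rewrite mul1r; apply: le_nrm_sqr; first exact: nrm_ge0.
  rewrite /nsq /rd Bsym BB nrm_sqr; apply: le_trans (rd_le _ _) _.
  by rewrite -nrm_sqr expr2 ler_wpM2l ?nrm_ge0 // firm_sub_le.
have AT f : A (T f) = T (A f) by rewrite -!AA.
have AB f : A (B f) = B (A f) by apply: (Bcomm A 1) => //; exact: ler01.
have BT' f : B (T' f) = T' (B f) by rewrite /T' linB // -!AA -!AB.
(* A root D of A is wanted only for the positivity of the graph: as B commutes with D, <A h, B h> =
   <D h, B D h> >= 0. *)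
pose A' f := f - A f.
have A'sym : symmetric_op A' by move=> f g; rewrite dotBl dotBr Asym.
have [D [Dsym _ _ DD Dcomm]] := sqrt_one_sub_ex A'sym Ale.
have {}DD f : D (D f) = A f by rewrite DD /A' opprB addrC subrK.
have BD f : B (D f) = D (B f).
  by apply: (Dcomm B 1) => // f'; rewrite /A' linB // AB.
have sumsq f : A (A f) + B (B f) = f by rewrite AA BB addrC subrK.
exists (fun f g => exists h, f = A h /\ g = B h); split.
- move=> f g; split=> [[h [-> ->]] _ _ [h' [-> ->]]|hS].
    by rewrite Asym Bsym AB.
  have e : B f = A g.
    apply: dot_inj => k; rewrite dotC [RHS]dotC; congr (conjc _).
    by rewrite Bsym Asym; apply: hS; exists k.
  (* From B f = A g and A^2 + B^2 = 1 one gets A (A f + B g) = A^2 f + B^2 f = f, and likewise B (A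
     f + B g) = g. *)
  exists (A f + B g); rewrite !linD //.
  by rewrite AB -e sumsq -AB e sumsq.
- by move=> _ _ [h [-> ->]]; rewrite /rd -DD Dsym -BD; exact: Bge0.
- move=> f g; split.
    move=> [_ [[h [-> ->]] [h' [e ->]]]].
    by rewrite -AA (linD Alin) AB -e sumsq.
  (* With k = f + g one has f = A^2 k and g = B^2 k, so A B k is the intermediate vector. *)
  move=> e; set k := f + g in e.
  have gE : g = B (B k) by rewrite BB -e /k addrAC subrr add0r.
  exists (B (A k)); split; first by exists (A k); rewrite AA.
  by exists (B k); rewrite AB gE.
Qed.

Section Compact.
Hypothesis Tcomp : forall u : nat -> E, (exists c, forall n, nrm (u n) <= c) ->
  exists (s : nat -> nat) f, {homo s : i j / (i < j)%N} /\ hcvg (T \o (u \o s)) f.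
(** Infinite dimension, in the form that keeps the inductive choice of eigenvectors from
    stopping. *)
Hypothesis Einf : forall l : seq E, exists2 f, f <> 0 & forall x, x \in l -> dot x f = 0.

Lemma form_sqr_le f g : rd f (T g) ^+ 2 <= rd f (T f) * rd g (T g).
Proof.
apply: sqr_le_of_quadratic_ge0 => t.
have := le_trans (nsq_ge0 _) (Tpos (f + t%:C%C *: g)).
rewrite (linD Tlin) (linZ Tlin) rdDl !rdDr !rdZl !rdZr.
have -> : rd g (T f) = rd f (T g) by rewrite rdC {1}/rd Tsym.
by rewrite expr2; lra.
Qed.

Lemma homo_leq_id (s : nat -> nat) : {homo s : i j / (i < j)%N} -> forall n, (n <= s n)%N.
Proof.
move=> h; elim=> // n IH; apply: leq_ltn_trans IH _; exact: h.
Qed.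

(** The complement of the eigenvectors in [l] is invariant under T. Let s be the supremum of <f, T
    f> over its unit sphere. On a maximizing sequence |T v - s v|^2 <= s (s - <v, T v>) tends to 0,
    while T v converges along a subsequence by compactness; as s > 0, v converges too, to an
    eigenvector for s. *)
Lemma max_eigenvector (l : seq E) :
  (forall x, x \in l -> exists s : R, T x = s%:C%C *: x) ->
  exists e (s : R), [/\ nsq e = 1, forall x, x \in l -> dot x e = 0,
    T e = s%:C%C *: e, 0 < s &
    forall f, (forall x, x \in l -> dot x f = 0) -> rd f (T f) <= s * nsq f].
Proof.
move=> leig.
pose W f := forall x, x \in l -> dot x f = 0.
have WT f : W f -> W (T f).
  by move=> Wf x xl; have [s es] := leig x xl; rewrite -Tsym es dotZl Wf // mulr0.
have WZ a f : W f -> W (a *: f).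
  by move=> Wf x xl; rewrite dotZr Wf // mulr0.
have normalize f : f <> 0 -> nsq (((nrm f)^-1)%:C%C *: f) = 1.
  move=> /nrm_gt0 f0; rewrite nsqZr -nrm_sqr -exprMn mulVf ?gt_eqF //.
  by rewrite expr1n.
have Tle1 f : rd f (T f) <= nsq f.
  apply: le_trans (rd_le _ _) _; rewrite -nrm_sqr expr2.
  by rewrite ler_wpM2l ?nrm_ge0 // firm_le.
have [f0 f0n Wf0] := Einf l.
have [|f [_ h]|d [dle dad]] := @inf_approx _ E (fun f => W f /\ nsq f = 1) (fun f => 1 - rd f (T f)).
  by exists (((nrm f0)^-1)%:C%C *: f0); split; [exact: WZ|exact: normalize].
  by rewrite subr_ge0 -h.
(* The infimum d is that of 1 - <f, T f>, nonnegative on the unit sphere, so s is the supremum of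
   the Rayleigh quotient. *)
pose s := 1 - d.
have bound f : W f -> rd f (T f) <= s * nsq f.
  move=> Wf; have [->|/eqP fn0] := eqVneq f 0; first by rewrite rd0l nsq0 mulr0.
  have f0' := nrm_gt0 fn0.
  have := dle _ (conj (WZ ((nrm f)^-1)%:C%C _ Wf) (normalize _ fn0)).
  rewrite linZ // rdZl rdZr mulrA -expr2 => h.
  have : (nrm f)^-1 ^+ 2 * rd f (T f) <= s by rewrite /s; lra.
  by rewrite exprVn nrm_sqr mulrC ler_pdivrMr // nsq_gt0.
have s0 : 0 < s.
  have h1 : 0 < nsq (T f0) by apply: nsq_gt0 => /Tinj.
  have h2 := lt_le_trans h1 (le_trans (Tpos f0) (bound _ Wf0)).
  by move: h2; rewrite pmulr_lgt0 // nsq_gt0.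
(* Cauchy-Schwarz for the form at T f and f gives |T f|^4 <= <T f, T T f> <f, T f> <= s |T f|^2 <f,
   T f>. *)
have TT f : W f -> nsq (T f) <= s * rd f (T f).
  move=> Wf; have [->|tn0] := eqVneq (nsq (T f)) 0.
    by rewrite mulr_ge0 ?(ltW s0) // (le_trans (nsq_ge0 _) (Tpos f)).
  have t0 : 0 < nsq (T f) by rewrite lt_neqAle eq_sym tn0 nsq_ge0.
  have := form_sqr_le (T f) f.
  rewrite -/(nsq _) expr2 => h.
  have := le_trans h (ler_wpM2r (le_trans (nsq_ge0 _) (Tpos f)) (bound _ (WT _ Wf))).
  by rewrite -!mulrA (mulrC _ (rd _ _)) mulrCA ler_pM2l // mulrC.
have /choice [u hu] : forall n : nat, exists f, (W f /\ nsq f = 1) /\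
    1 - rd f (T f) < d + (n.+1%:R)^-1.
  by move=> n; have [|f Pf hf] := dad (n.+1%:R)^-1; [rewrite invr_gt0|exists f].
have [|sg [g [sgh hg]]] := Tcomp (u := u).
  by exists 1 => n; rewrite /nrm (hu n).1.2 sqrtr1.
pose v := u \o sg.
have hv : hcvg (fun n => s%:C%C *: v n) g.
  have h0 : hcvg (fun n => T (v n) - s%:C%C *: v n) 0.
    apply: (@hcvg_squeeze _ _ _ _ (fun n => Num.sqrt (s * (n.+1%:R)^-1))).
      move=> n; rewrite subr0 ler_wsqrtr // nsqB rdZr nsqZr.
      have [[Wv nv] hvn] := hu (sg n); rewrite -/(v n) in Wv nv hvn.
      change (u (sg n)) with (v n) in *.
      rewrite nv mulr1 (rdC _ (v n)).
      have h1 := TT _ Wv.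
      have h2 : (sg n).+1%:R^-1 <= n.+1%:R^-1 :> R.
        by rewrite lef_pV2 ?posrE // ler_nat ltnS homo_leq_id.
      have h3 : s * (s - rd (v n) (T (v n))) <= s * n.+1%:R^-1.
        rewrite ler_wpM2l ?(ltW s0) //; apply: le_trans h2; rewrite /s; apply/ltW.
        by move: hvn; set xi : R := _^-1; clearbody xi; lra.
      by move: h3; set xi : R := _^-1; clearbody xi; move: h1; nra.
    have h4 : s * (n.+1%:R)^-1 @[n --> \oo] --> (s * 0 : R).
      by apply: cvgMr; exact: cvg_harmonic.
    rewrite -[X in _ --> X](@sqrtr0 R) -(mulr0 s).
    by apply: (cvg_comp _ Num.sqrt h4); exact: sqrt_continuous.
  have := hcvgB hg h0; rewrite subr0.
  by under eq_fun do rewrite /= opprB addrC subrK.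
pose e := (s^-1)%:C%C *: g.
have he : hcvg v e.
  have := hcvgZ (s^-1)%:C%C hv; congr hcvg; apply/funext => n.
  rewrite scalerA -[RHS]scale1r; congr (_ *: _).
  by apply: complexP => /=; [rewrite !mul0r subr0 mulVf ?gt_eqF|rewrite mulr0 mul0r addr0].
have gE : g = s%:C%C *: e.
  rewrite scalerA -[LHS]scale1r; congr (_ *: _).
  by apply: complexP => /=; [rewrite !mul0r subr0 mulfV ?gt_eqF|rewrite mulr0 mul0r addr0].
exists e, s; split=> //.
- have h1 := hcvg_nsq he; apply: (cvg_unique _ h1) => //=.
  by under eq_fun do rewrite (hu _).1.2; exact: cvg_cst.
- move=> x xl; rewrite -[RHS](dot0r x); apply: (hcvg_dot_eq (hcvg_cst x) he (hcvg_cst x) (hcvg_cst 0)) => n.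
  by rewrite dot0r (hu _).1.1.
- rewrite -gE; apply: (hcvg_unique (u := T \o v)) hg.
  by apply: (hcvg_lin Tlin (ler01 : (0 : R) <= 1)) he => f; rewrite mul1r firm_le.
Qed.

(** The list [L n] holds the first n eigenvectors, each taken maximal on the complement of the
    previous ones. If the eigenvalues stayed above d > 0, the images T (e n) would be at mutual
    distance at least d, against compactness. A vector f orthogonal to all of them has <f, T f> <=
    s_n |f|^2 for all n, so T f = 0 and f = 0. *)
Lemma compact_eigenbasis : exists (e : nat -> E) (s : nat -> R),
  [/\ forall i j, dot (e i) (e j) = (i == j)%:R,
      forall n, T (e n) = (s n)%:C%C *: e n /\ 0 < s n <= 1,
      forall n, s n.+1 <= s n,
      s n @[n --> \oo] --> (0 : R) &
      forall f, (forall n, dot (e n) f = 0) -> f = 0].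
Proof.
have /choice [nx hnx] : forall l : seq E, exists p : E * R,
    (forall x, x \in l -> exists s : R, T x = s%:C%C *: x) ->
    [/\ nsq p.1 = 1, forall x, x \in l -> dot x p.1 = 0,
      T p.1 = p.2%:C%C *: p.1, 0 < p.2 &
      forall f, (forall x, x \in l -> dot x f = 0) -> rd f (T f) <= p.2 * nsq f].
  move=> l; have [/max_eigenvector [e [s h]]|nl] :=
    pselect (forall x, x \in l -> exists s : R, T x = s%:C%C *: x).
    by exists (e, s).
  by exists (0, 0).
pose L := fix L n := if n is n'.+1 then (nx (L n')).1 :: L n' else [::].
pose e n := (nx (L n)).1; pose s n := (nx (L n)).2.
have LE n x : reflect (exists2 i, (i < n)%N & x = e i) (x \in L n).
  apply: (iffP idP).
    elim: n => // n IH; rewrite /= inE => /orP[/eqP ->|/IH [i ni ->]].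
      by exists n.
    by exists i => //; rewrite ltnS ltnW.
  move=> [i + ->]; elim: n => // n IH; rewrite ltnS leq_eqVlt inE => /orP[/eqP ->|/IH ->].
    by rewrite eqxx.
  by rewrite orbT.
have hL n : forall x, x \in L n -> exists s : R, T x = s%:C%C *: x.
  elim: n => // n IH x; rewrite /= inE => /orP[/eqP ->|/IH //].
  by have [_ _ h _ _] := hnx _ IH; exists (s n).
have orth i j : (i < j)%N -> dot (e i) (e j) = 0.
  by move=> ij; have [_ h _ _ _] := hnx _ (hL j); apply: h; apply/LE; exists i.
have sdec n : s n.+1 <= s n.
  have [_ _ _ _ h] := hnx _ (hL n); have [h1 h2 h3 _ _] := hnx _ (hL n.+1).
  have := h (e n.+1); rewrite h3 rdZr -/(nsq _) h1 !mulr1; apply => x xl.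
  by apply: h2; rewrite inE xl orbT.
have s0 n : 0 < s n by have [_ _ _ h _] := hnx _ (hL n).
have e1 n : nsq (e n) = 1 by have [h _ _ _ _] := hnx _ (hL n).
have eT n : T (e n) = (s n)%:C%C *: e n by have [_ _ h _ _] := hnx _ (hL n).
have sni : nonincreasing_seq s by apply/nonincreasing_seqP.
have slim : s n @[n --> \oo] --> (0 : R).
  have hc : s n @[n --> \oo] --> inf (range s).
    apply: nonincreasing_cvgn => //; exists 0 => _ [n _ <-]; exact: ltW.
  suff <- : inf (range s) = 0 by [].
  set d := inf _ in hc *.
  have dle n : d <= s n.
    by apply: ge_inf; [exists 0 => _ [m _ <-]; exact: ltW|exists n].
  have d0 : 0 <= d.
    by apply: lb_le_inf; [exists (s 0%N), 0%N|move=> _ [m _ <-]; exact: ltW].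
  apply/eqP; rewrite eq_le d0 andbT leNgt; apply/negP => dp.
  have [|sg [g [sgh /hcvgP hg]]] := Tcomp (u := e).
    by exists 1 => n; rewrite /nrm e1 sqrtr1.
  have d20 : 0 < d / 2 by rewrite divr_gt0.
  have [N hN] := hg _ d20.
  have h1 := hN N (leqnn N); have h2 := hN N.+1 (leqnSn N).
  have h3 : nrm (T (e (sg N)) - T (e (sg N.+1))) < d.
    apply: le_lt_trans (nrm_dist _ g _) _; rewrite (nrmBC g).
    by move: h1 h2 => /=; lra.
  have : d ^+ 2 < d ^+ 2; last by rewrite ltxx.
  apply: le_lt_trans (_ : nsq (T (e (sg N)) - T (e (sg N.+1))) < _).
    rewrite !eT nsqB !nsqZr !e1 !mulr1 rdZl rdZr {1}/rd orth ?sgh //= !mulr0 subr0.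
    have : d ^+ 2 <= s (sg N) ^+ 2 by rewrite lerXn2r ?nnegrE ?(ltW (s0 _)).
    by have := sqr_ge0 (s (sg N.+1)); lra.
  by rewrite -nrm_sqr ltrXn2r // ?nnegrE ?nrm_ge0.
exists e, s; split=> //.
- move=> i j; have [ij|ji|->] := ltngtP i j.
  + by rewrite orth.
  + by rewrite dotC orth // conjc0.
  + by rewrite dotff e1.
- move=> n; split; first exact: eT.
  rewrite s0 /=; have := Tpos (e n); rewrite eT rdZr nsqZr -/(nsq _) e1 !mulr1 expr2.
  by rewrite -[X in _ <= X]mulr1 ler_pM2l.
- move=> f hf; apply: Tinj; apply: nsq_eq0; apply/eqP; rewrite eq_le nsq_ge0 andbT.
  apply: le_trans (Tpos f) _.
  have h n : rd f (T f) <= s n * nsq f.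
    by have [_ _ _ _ h] := hnx _ (hL n); apply: h => x /LE [i _ ->].
  have hs : s n * nsq f @[n --> \oo] --> 0 * nsq f by apply: cvgM => //; exact: cvg_cst.
  rewrite -[X in _ <= X](mul0r (nsq f)); apply: ler_cvg_to (cvg_cst (rd f (T f))) hs _.
  by apply: nearW => n; exact: h.
Qed.

End Compact.
End PositiveSelfAdjoint.

Section RealSeries.
Context {R : realType}.

Lemma eseries_EFin (a : nat -> R) (s : R) :
  \sum_(0 <= i < n) a i @[n --> \oo] --> s ->
  \big[+%E/0%E]_(0 <= n <oo) (a n)%:E = s%:E.
Proof.
move=> h; apply/cvg_lim => //.
have -> : (fun n => \big[+%E/0%E]_(0 <= i < n) (a i)%:E) =
    (fun n => (\sum_(0 <= i < n) a i)%:E).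
  by apply/funext => n; rewrite sumEFin.
by apply: cvg_EFin => //; apply: nearW.
Qed.

Lemma eseries_partial_le (a : nat -> R) : (forall n, 0 <= a n) ->
  (\big[+%E/0%E]_(0 <= n <oo) (a n)%:E < +oo)%E ->
  forall N, \sum_(0 <= i < N) a i <= fine (\big[+%E/0%E]_(0 <= n <oo) (a n)%:E).
Proof.
move=> a0 hfin N.
have s0 : (0 <= \big[+%E/0%E]_(0 <= n <oo) (a n)%:E)%E.
  by apply: nneseries_ge0 => n _ _; rewrite lee_fin.
rewrite -lee_fin fineK; last by rewrite ge0_fin_numE.
rewrite -sumEFin; apply: nneseries_lim_ge => n _ _; by rewrite lee_fin.
Qed.

End RealSeries.

(** * Orthonormal bases, Parseval's identity and diagonal operators *)

Section OrthonormalBasis.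
Context {R : realType} {E : hilbert R}.
Local Notation C := R[i].
Implicit Types (f g h k : E) (a b : nat -> C).
Variable e : nat -> E.
Hypothesis e_on : forall i j, dot (e i) (e j) = (i == j)%:R.
Hypothesis e_complete : forall f, (forall n, dot (e n) f = 0) -> f = 0.

Definition ps a N : E := \sum_(0 <= i < N) a i *: e i.

Lemma dot_ps a N f : dot (ps a N) f = \sum_(0 <= i < N) conjc (a i) * dot (e i) f.
Proof. by rewrite dot_suml; apply: eq_bigr => i _; rewrite dotZl. Qed.

Lemma coef_ps a N n : dot (e n) (ps a N) = if (n < N)%N then a n else 0.
Proof.
rewrite dot_sumr (eq_bigr (fun i => if i == n then a n else 0)); last first.
  move=> i _; rewrite dotZr e_on eq_sym.
  by case: eqP => [->|_]; rewrite ?mulr1 ?mulr0.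
rewrite -big_mkcond /=.
case: ltnP => nN.
  by rewrite big_nat1_eq nN.
by rewrite big_nat1_eq /= ltnNge nN.
Qed.

Lemma eq_coef f g : (forall n, dot (e n) f = dot (e n) g) -> f = g.
Proof.
by move=> h; apply/subr0_eq/e_complete => n; rewrite dotBr h subrr.
Qed.

Lemma rd_ps a N f : rd (ps a N) f =
  \sum_(0 <= i < N) complex.Re (conjc (a i) * dot (e i) f).
Proof. by rewrite /rd dot_ps Re_sum. Qed.

Lemma rd_ps_ps a N M : (N <= M)%N ->
  rd (ps a N) (ps a M) = \sum_(0 <= i < N) sqnc (a i).
Proof.
move=> NM; rewrite rd_ps big_nat [RHS]big_nat; apply: eq_bigr => i /andP[_ iN].
by rewrite coef_ps (leq_trans iN NM) mul_conjc.
Qed.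

Lemma nsq_ps a N : nsq (ps a N) = \sum_(0 <= i < N) sqnc (a i).
Proof. by rewrite /nsq rd_ps_ps. Qed.

(** The Riesz-Fischer theorem: the squared distance between two partial sums is the difference of
    the scalar sums, which are monotone and bounded. *)
Lemma synth a (M : R) : (forall N, \sum_(0 <= i < N) sqnc (a i) <= M) ->
  exists g, hcvg (ps a) g /\ forall n, dot (e n) g = a n.
Proof.
move=> hM; pose S N := \sum_(0 <= i < N) sqnc (a i).
have Snd : nondecreasing_seq S.
  apply/nondecreasing_seqP => n.
  by rewrite /S big_nat_recr //= lerDl sqnc_ge0.
have hub : has_ubound (range S) by exists M => _ [n _ <-]; exact: hM.
have hS : S n @[n --> \oo] --> sup (range S) by exact: nondecreasing_cvgn.
set l := sup _ in hS.
have [||g hg] := @cauchy_of_bound _ _ (ps a) (fun n => Num.sqrt (l - S n)).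
- move=> i j ij; apply: ler_wsqrtr.
  have -> : nsq (ps a i - ps a j) = S j - S i.
    by rewrite nsqB rd_ps_ps // !nsq_ps -/(S i) -/(S j); ring.
  by rewrite lerB //; apply: ub_le_sup => //; exists j.
- have h4 : l - S n @[n --> \oo] --> l - l by apply: cvgB => //; exact: cvg_cst.
  rewrite -[X in _ --> X](@sqrtr0 R) -(subrr l).
  by apply: (cvg_comp _ Num.sqrt h4); exact: sqrt_continuous.
exists g; split=> // n.
(* After a shift by n + 1 every partial sum already has n-th coefficient [a n]. *)
have h : hcvg (fun N => ps a (N + n.+1)) g.
  by apply: (@hcvg_sub _ _ (ps a) g (addn^~ n.+1)) => // m; exact: leq_addr.
have one : dot (e n) (e n) = 1 by rewrite e_on eqxx.
rewrite -[RHS](_ : dot (e n) (a n *: e n) = _); last by rewrite dotZr one mulr1.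
apply: (hcvg_dot_eq (hcvg_cst (e n)) h (hcvg_cst (e n)) (hcvg_cst (a n *: e n))) => N.
by rewrite coef_ps addnS ltnS leq_addl dotZr one mulr1.
Qed.

Lemma bessel f N : \sum_(0 <= i < N) sqnc (dot (e i) f) <= nsq f.
Proof.
have := nsq_ge0 (f - ps (fun i => dot (e i) f) N).
rewrite nsqB nsq_ps rdC rd_ps.
under [X in _ - 2 * X]eq_bigr do rewrite mul_conjc /=.
lra.
Qed.

Lemma expansion f : hcvg (ps (fun i => dot (e i) f)) f.
Proof.
have [g [hg eg]] := synth (bessel f).
by rewrite -[in X in hcvg _ X](eq_coef eg).
Qed.

Lemma parseval_rd f g :
  \sum_(0 <= i < N) complex.Re (conjc (dot (e i) f) * dot (e i) g) @[N --> \oo] --> rd f g.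
Proof.
under eq_fun do rewrite -rd_ps.
by apply: hcvg_rd (expansion f) _; exact: hcvg_cst.
Qed.

Lemma parseval f : \sum_(0 <= i < N) sqnc (dot (e i) f) @[N --> \oo] --> nsq f.
Proof.
have := @parseval_rd f f.
by under eq_fun do under eq_bigr do rewrite mul_conjc.
Qed.

Section Diagonal.
Variable lam : nat -> R.
Hypothesis lam_ge0 : forall n, 0 <= lam n.

(** The maximal domain is implicit: f belongs to it exactly when some vector g has the prescribed
    coefficients. *)
Definition diag_op f g := forall n, dot (e n) g = (lam n)%:C%C * dot (e n) f.

Lemma spectral_projections_ex : exists P : set R -> E -> E,
  forall A f n, dot (e n) (P A f) = (\1_A (lam n))%:C%C * dot (e n) f.
Proof.
suff /choice [P hP] : forall Af : set R * E, exists g, forall n,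
    dot (e n) g = (\1_(Af.1) (lam n))%:C%C * dot (e n) Af.2.
  by exists (fun A f => P (A, f)) => A f n; exact: hP.
move=> [A f] /=.
have [|g [_ hg]] := @synth (fun n => (\1_A (lam n))%:C%C * dot (e n) f) (nsq f).
  move=> N; apply: le_trans (bessel f N); apply: ler_sum => i _.
  rewrite sqncM sqncR indicE; case: (_ \in _); rewrite ?expr1n ?mul1r //.
  by rewrite expr0n mul0r sqnc_ge0.
by exists g.
Qed.

Variable P : set R -> E -> E.
Hypothesis P_coef : forall A f n, dot (e n) (P A f) = (\1_A (lam n))%:C%C * dot (e n) f.

Lemma P_symmetric A : symmetric_op (P A).
Proof.
move=> f g; apply: (hcvg_dot_eq (expansion (P A f)) (hcvg_cst g)
  (expansion f) (hcvg_cst (P A g))) => N.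
rewrite !dot_ps; apply: eq_bigr => i _.
by rewrite !P_coef conjcM conjcR -mulrA mulrCA.
Qed.

Lemma P_idem A f : P A (P A f) = P A f.
Proof.
apply: eq_coef => n; rewrite !P_coef mulrA; congr (_ * _).
by rewrite indicE; case: (_ \in _); apply: complexP => /=; ring.
Qed.

Lemma P_setT f : P setT f = f.
Proof. by apply: eq_coef => n; rewrite P_coef indicE in_setT mul1r. Qed.

Let T := measurableTypeR R.

(** The scalar spectral measure of f, with mass |<e_n, f>|^2 at [lam n]. Written as a series of
    scaled Dirac measures, it inherits its measure structure and its integrals become series. *)
Definition spectral_mu f : set T -> \bar R :=
  mseries (fun n => mscale (NngNum (sqnc_ge0 (dot (e n) f))) (dirac (lam n : T))) 0.

HB.instance Definition _ f := Measure.on (spectral_mu f).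

Lemma spectral_muE f (A : set T) : spectral_mu f A = (rd f (P A f))%:E.
Proof.
transitivity (\big[+%E/0%E]_(0 <= n <oo) (sqnc (dot (e n) f) * \1_A (lam n))%:E).
  by apply: eq_eseriesr => n _; rewrite EFinM.
apply: eseries_EFin; have := @parseval_rd f (P A f).
under eq_fun do under eq_bigr do
  rewrite P_coef mulrCA mul_conjc Re_mulr /= mulrC.
by [].
Qed.

Lemma integral_spectral_mu f (h : T -> \bar R) : measurable_fun setT h ->
  (forall x, (0 <= h x)%E) ->
  (\int[spectral_mu f]_x h x = \big[+%E/0%E]_(0 <= n <oo) ((sqnc (dot (e n) f))%:E * h (lam n)))%E.
Proof.
move=> mh h0; rewrite ge0_integral_measure_series //.
apply: eq_eseriesr => n _; rewrite ge0_integral_mscale // integral_dirac //.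
by rewrite diracT mul1e.
Qed.

Lemma coef_diag f g N : diag_op f g ->
  \sum_(0 <= i < N) sqnc (dot (e i) f) * lam i ^+ 2 = \sum_(0 <= i < N) sqnc (dot (e i) g).
Proof. by move=> h; apply: eq_bigr => i _; rewrite h sqncM sqncR mulrC. Qed.

Lemma measurable_EFin_exp n : measurable_fun setT (fun x : T => (x ^+ n)%:E).
Proof. by apply/measurable_EFinP; exact: exprn_measurable. Qed.

(** The second moment is the sum of lam_n^2 |<e_n, f>|^2: it equals |g|^2 by Parseval if g exists,
    and if it is finite [synth] constructs g. *)
Lemma dom_diag_op f : (exists g, diag_op f g) <->
  (\int[spectral_mu f]_x (x ^+ 2)%:E < +oo)%E.
Proof.
rewrite integral_spectral_mu; last 2 first.
- exact: measurable_EFin_exp.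
- by move=> x; rewrite lee_fin sqr_ge0.
under eq_eseriesr do rewrite -EFinM.
split=> [[g hg]|h].
  rewrite (@eseries_EFin _ _ (nsq g)) ?ltry //.
  by under eq_fun do rewrite (coef_diag _ hg); exact: parseval.
have h0 n : 0 <= sqnc (dot (e n) f) * lam n ^+ 2 by rewrite mulr_ge0 ?sqnc_ge0 ?sqr_ge0.
have [|g [_ hg]] := @synth (fun n => (lam n)%:C%C * dot (e n) f)
  (fine (\big[+%E/0%R]_(0 <= i <oo) (sqnc (dot (e i) f) * lam i ^+ 2)%:E)); last by exists g.
move=> N; apply: le_trans (eseries_partial_le h0 h N).
by apply: ler_sum => i _; rewrite sqncM sqncR mulrC.
Qed.

Lemma diag_rd f g : diag_op f g ->
  \sum_(0 <= i < N) sqnc (dot (e i) f) * lam i @[N --> \oo] --> rd f g.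
Proof.
move=> h; have := @parseval_rd f g.
by under eq_fun do under eq_bigr do rewrite h mulrCA mul_conjc Re_mulr /= mulrC.
Qed.

Lemma integral_id_diag f g : diag_op f g ->
  (\int[spectral_mu f]_x x%:E)%E = (rd f g)%:E.
Proof.
move=> hfg; have mid : measurable_fun setT (EFin : T -> \bar R).
  by apply/measurable_EFinP; exact: measurable_id.
rewrite integralE !integral_spectral_mu //.
- under eq_eseriesr do rewrite funeposE (max_idPl _) ?lee_fin // -EFinM.
  rewrite (eseries_EFin (diag_rd hfg)).
  rewrite eseries0 ?sube0 // => n _ _.
  by rewrite funenegE (max_idPr _) ?mule0 // leeNl oppe0 lee_fin.
- exact: measurable_funeneg.
- exact: measurable_funepos.
Qed.

Lemma diag_rayleigh f g n : {homo lam : i j / (i <= j)%N >-> i <= j} ->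
  diag_op f g -> (forall i, (i < n)%N -> dot (e i) f = 0) -> lam n * nsq f <= rd f g.
Proof.
move=> lam_homo hfg h0.
have h1 : lam n * (\sum_(0 <= i < N) sqnc (dot (e i) f)) @[N --> \oo] --> lam n * nsq f.
  by apply: cvgMr; exact: parseval.
apply: ler_cvg_to h1 (diag_rd hfg) _; apply: nearW => N.
rewrite mulr_sumr; apply: ler_sum => i _; rewrite mulrC.
have [ni|/h0 ->] := leqP n i; first by rewrite ler_wpM2l ?sqnc_ge0 // lam_homo.
by rewrite /sqnc /= expr0n /= addr0 !mul0r.
Qed.

End Diagonal.
End OrthonormalBasis.

(** * Weighted l^2 spaces *)

Section FiniteSums.
Context {R : realType} {V : choiceType}.
Implicit Types (a b p q : V -> R) (X Y : {fset V}).

Lemma esum_fset_le a X : (forall x, 0 <= a x) ->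
  ((\sum_(x <- X) a x)%:E <= \esum_(x in [set: V]) (a x)%:E)%E.
Proof.
move=> a0; rewrite -sumEFin; apply: ereal_sup_ubound; exists [set` X]; first by split.
by rewrite fsbig_finite //= set_fsetK.
Qed.

Lemma esum_leP a (M : R) : (forall X, \sum_(x <- X) a x <= M) ->
  (\esum_(x in [set: V]) (a x)%:E <= M%:E)%E.
Proof.
move=> h; apply: ub_ereal_sup => _ [A [finA _] <-].
by rewrite fsbig_finite // sumEFin lee_fin.
Qed.

Lemma esum_fin_approx a (s : R) : (forall x, 0 <= a x) ->
  \esum_(x in [set: V]) (a x)%:E = s%:E ->
  forall e : R, 0 < e -> exists X, s - e < \sum_(x <- X) a x.
Proof.
move=> a0 hs e e0; apply: contrapT => h.
have : (s%:E <= (s - e)%:E)%E.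
  rewrite -hs; apply: esum_leP => X; rewrite leNgt; apply/negP => h'.
  by apply: h; exists X.
by rewrite lee_fin lerBrDr gerDl leNgt e0.
Qed.

Lemma big_fset_subset_le a X Y : (forall x, 0 <= a x) -> (X `<=` Y)%fset ->
  \sum_(x <- X) a x <= \sum_(x <- Y) a x.
Proof.
move=> a0 XY; rewrite [leRHS](big_fsetID _ (mem X)) /=.
have -> : [fset x | x in Y & x \in X]%fset = X.
  by apply/fsetP => x; rewrite !inE /=; apply/andP/idP => [[]//|xX]; split=> //; exact: (fsubsetP XY).
by rewrite lerDl sumr_ge0.
Qed.

(** Convergence along the directed set of finite subsets. Its limit is unique and additive, so sums
    defined through positive and negative parts can be computed without splitting them. *)
Definition has_sum a (s : R) := forall e : R, 0 < e -> exists X, forall Y, (X `<=` Y)%fset ->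
  `|\sum_(x <- Y) a x - s| < e.

Lemma has_sum_unique a s t : has_sum a s -> has_sum a t -> s = t.
Proof.
move=> hs ht; apply/eqP; rewrite -subr_eq0 -normr_eq0 eq_le normr_ge0 andbT.
apply/ler_addgt0Pl => e e0; rewrite addr0.
have e2 : 0 < e / 2 by rewrite divr_gt0.
have [X hX] := hs _ e2; have [Y hY] := ht _ e2.
have := hX _ (fsubsetUl X Y); have := hY _ (fsubsetUr X Y).
set S := \sum_(x <- _) _ => h1 h2.
have -> : s - t = (S - t) - (S - s) by ring.
by apply: le_trans (ler_normB _ _) _; apply/ltW; rewrite (splitr e) ltrD.
Qed.

Lemma has_sumD a b s t : has_sum a s -> has_sum b t -> has_sum (fun x => a x + b x) (s + t).
Proof.
move=> hs ht e e0; have e2 : 0 < e / 2 by rewrite divr_gt0.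
have [X hX] := hs _ e2; have [Y hY] := ht _ e2.
exists (X `|` Y)%fset => Z XYZ; rewrite big_split /= opprD addrACA.
apply: le_lt_trans (ler_normD _ _) _; rewrite (splitr e) ltrD //.
  by apply: hX; apply: fsubset_trans XYZ; exact: fsubsetUl.
by apply: hY; apply: fsubset_trans XYZ; exact: fsubsetUr.
Qed.

Lemma has_sumZ (r : R) a s : has_sum a s -> has_sum (fun x => r * a x) (r * s).
Proof.
move=> hs e e0.
have r0 : 0 < `|r| + 1 by rewrite ltr_wpDl.
have [X hX] := hs _ (divr_gt0 e0 r0).
exists X => Y XY; rewrite -mulr_sumr -mulrBr normrM.
have := hX _ XY; rewrite ltr_pdivlMr // => h.
by apply: le_lt_trans h; rewrite mulrC ler_wpM2l // lerDl.
Qed.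

Lemma has_sum_ge0 a s : (forall x, 0 <= a x) ->
  \esum_(x in [set: V]) (a x)%:E = s%:E -> has_sum a s.
Proof.
move=> a0 hs e e0; have [X hX] := esum_fin_approx a0 hs e0; exists X => Y XY.
have h1 := big_fset_subset_le a0 XY.
have : ((\sum_(x <- Y) a x)%:E <= s%:E)%E by rewrite -hs; exact: esum_fset_le.
rewrite lee_fin => h2; rewrite ler0_norm ?subr_le0 //.
lra.
Qed.

Lemma eq_has_sum a b s : a =1 b -> has_sum a s -> has_sum b s.
Proof. by move=> /funext ->. Qed.

Lemma has_sum_finite a X : (forall x, x \notin X -> a x = 0) ->
  has_sum a (\sum_(x <- X) a x).
Proof.
move=> a0 e e0; exists X => Y XY.
rewrite (_ : \sum_(x <- Y) a x = \sum_(x <- X) a x) ?subrr ?normr0 //.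
rewrite (big_fsetID _ (mem X)) /=.
have -> : [fset x | x in Y & x \in X]%fset = X.
  by apply/fsetP => x; rewrite !inE /=; apply/andP/idP => [[]//|xX]; split=> //; exact: (fsubsetP XY).
rewrite -[RHS]addr0; congr (_ + _); rewrite big_seq big1 // => x.
by rewrite !inE /= => /andP[_ /a0].
Qed.

End FiniteSums.

Section RealSums.
Context {R : realType} {V : countType}.
Implicit Types (a b : V -> R).

Definition summ a := (\esum_(x in [set: V]) (`|a x|)%:E < +oo)%E.

Lemma summP a : (exists M : R, forall X : {fset V}, \sum_(x <- X) `|a x| <= M) -> summ a.
Proof. by move=> [M hM]; apply: le_lt_trans (esum_leP hM) _; exact: ltry. Qed.

Lemma esum_fine a : (forall x, 0 <= a x) -> (\esum_(x in [set: V]) (a x)%:E < +oo)%E ->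
  \esum_(x in [set: V]) (a x)%:E = (fine (\esum_(x in [set: V]) (a x)%:E))%:E.
Proof.
move=> a0 h; rewrite fineK // ge0_fin_numE //.
by apply: esum_ge0 => x _; rewrite lee_fin.
Qed.

Lemma has_sum_rsum a : summ a -> has_sum a (rsum a).
Proof.
move=> ha; rewrite /rsum.
have fin (f : V -> R) : (forall x, 0 <= f x <= `|a x|) ->
    has_sum f (fine (\esum_(x in [set: V]) (f x)%:E)).
  move=> hf; have f0 x : 0 <= f x by have /andP[] := hf x.
  apply: has_sum_ge0 => //; apply: esum_fine => //.
  apply: le_lt_trans ha; apply: le_esum => x _.
  by rewrite lee_fin; have /andP[] := hf x.
have hp : has_sum (a^\+) (fine (\esum_(x in [set: V]) (a^\+ x)%:E)).
  apply: fin => x; rewrite /funrpos le_max lexx orbT /=.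
  by rewrite ge_max normr_ge0 andbT ler_norm.
have hn : has_sum (a^\-) (fine (\esum_(x in [set: V]) (a^\- x)%:E)).
  apply: fin => x; rewrite /funrneg le_max lexx orbT /=.
  by rewrite ge_max normr_ge0 andbT -normrN ler_norm.
have := has_sumD hp (has_sumZ (-1) hn); rewrite mulN1r; apply: eq_has_sum => x.
rewrite mulN1r /funrpos /funrneg.
by case: (leP (a x) 0) => h; [rewrite max_l; lra|rewrite max_r; lra].
Qed.

Lemma rsum_eq a s : summ a -> has_sum a s -> rsum a = s.
Proof. by move=> ha hs; exact: has_sum_unique (has_sum_rsum ha) hs. Qed.

Lemma summD a b : summ a -> summ b -> summ (fun x => a x + b x).
Proof.
move=> ha hb; apply: (@le_lt_trans _ _ (\esum_(x in [set: V]) ((`|a x|)%:E + (`|b x|)%:E)))%E.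
  by apply: le_esum => x _; rewrite -EFinD lee_fin ler_normD.
by rewrite esumD // ?lte_add_pinfty // => x _; rewrite lee_fin.
Qed.

Lemma summ_le a b : (forall x, `|a x| <= b x) -> summ b -> summ a.
Proof.
move=> h; apply: le_lt_trans; apply: le_esum => x _; rewrite lee_fin.
by apply: le_trans (h x) _; exact: ler_norm.
Qed.

Lemma summZ (r : R) a : summ a -> summ (fun x => r * a x).
Proof.
move=> ha; apply: summP.
have h := esum_fine (fun x => normr_ge0 (a x)) ha; set s := fine _ in h.
exists (`|r| * s) => X; under eq_bigr do rewrite normrM.
rewrite -mulr_sumr ler_wpM2l // -lee_fin -h.
exact: (esum_fset_le _ (fun x => normr_ge0 (a x))).
Qed.

Lemma rsumD a b : summ a -> summ b -> rsum (fun x => a x + b x) = rsum a + rsum b.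
Proof.
move=> ha hb; apply: rsum_eq; first exact: summD.
by apply: has_sumD; exact: has_sum_rsum.
Qed.

Lemma rsumZ (r : R) a : summ a -> rsum (fun x => r * a x) = r * rsum a.
Proof.
move=> ha; apply: rsum_eq; first exact: summZ.
by apply: has_sumZ; exact: has_sum_rsum.
Qed.

Lemma rsum_ge0_esum a : (forall x, 0 <= a x) -> summ a ->
  (rsum a)%:E = \esum_(x in [set: V]) (a x)%:E.
Proof.
move=> a0 ha.
have h : (\esum_(x in [set: V]) (a x)%:E < +oo)%E.
  by apply: le_lt_trans ha; apply: le_esum => x _; rewrite lee_fin ler_norm.
rewrite [RHS]esum_fine //; congr (_%:E); apply: rsum_eq => //.
by apply: has_sum_ge0 => //; exact: esum_fine.
Qed.

End RealSums.

Section Ell2.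
Context {R : realType} {V : countType}.
Local Notation C := R[i].
Variable m : V -> R.
Hypothesis m_gt0 : forall x, 0 < m x.
Implicit Types (f g h : V -> C) (X Y : {fset V}).

Definition en f (x : V) : R := m x * sqnc (f x).

Lemma en_ge0 f x : 0 <= en f x.
Proof. by rewrite mulr_ge0 ?sqnc_ge0 ?ltW. Qed.

Lemma l2sqE f : l2sq m f = \esum_(x in [set: V]) (en f x)%:E.
Proof. by apply: eq_esum => x _; rewrite normc_sqr. Qed.

Lemma l2_summ f : l2 m f <-> summ (en f).
Proof.
rewrite /l2 /= l2sqE /summ.
by rewrite (_ : (fun x => _) = (fun x => (`|en f x|)%:E)) //; apply/funext => x; rewrite ger0_norm ?en_ge0.
Qed.

Lemma l2_bound f (M : R) : (forall X, \sum_(x <- X) en f x <= M) -> l2 m f.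
Proof. by move=> h; rewrite /l2 /= l2sqE; apply: le_lt_trans (esum_leP h) _; exact: ltry. Qed.

Lemma l2sq_le f (M : R) : (forall X, \sum_(x <- X) en f x <= M) -> (l2sq m f <= M%:E)%E.
Proof. by move=> h; rewrite l2sqE; exact: esum_leP. Qed.

Lemma enD f g x : en (fun x => f x + g x) x <= 2 * en f x + 2 * en g x.
Proof.
rewrite /en; have := ler_wpM2l (ltW (m_gt0 x)) (sqncD_le (f x) (g x)); lra.
Qed.

Lemma l2D f g : l2 m f -> l2 m g -> l2 m (fun x => f x + g x).
Proof.
move=> /l2_summ hf /l2_summ hg; apply/l2_summ.
apply: (summ_le _ (summD (summZ 2 hf) (summZ 2 hg))) => x.
by rewrite ger0_norm ?en_ge0 // enD.
Qed.

Lemma l2Z (a : C) f : l2 m f -> l2 m (fun x => a * f x).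
Proof.
move=> /l2_summ hf; apply/l2_summ; apply: (summ_le _ (summZ (sqnc a) hf)) => x.
by rewrite ger0_norm ?en_ge0 // /en sqncM mulrCA.
Qed.

Lemma l2_0 : l2 m (fun=> 0).
Proof.
apply: (@l2_bound _ 0) => X; rewrite big1 // => x _.
by rewrite /en /sqnc /= expr0n /= addr0 mulr0.
Qed.

(** The positivity proof is a parameter so that the module structure declared on the predicate, and
    the type cut out by it, can carry that proof. *)
Definition ell2_pred (_ : forall x, 0 < m x) : {pred V -> C} := fun f => `[< l2 m f >].

End Ell2.

Section Ell2Type.
Context {R : realType} {V : countType}.
Local Notation C := R[i].
Variable m : V -> R.
Variable m_gt0 : forall x, 0 < m x.

Lemma ell2_pred_submod : submod_closed (ell2_pred m_gt0).
Proof.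
split; first by apply/asboolP; exact: l2_0.
move=> a f g /asboolP hf /asboolP hg; apply/asboolP.
by apply: (l2D m_gt0 (l2Z m_gt0 a hf) hg).
Qed.

HB.instance Definition _ :=
  GRing.isSubmodClosed.Build C (V -> C) (ell2_pred m_gt0) ell2_pred_submod.

Record ell2 := Ell2 { ell2_val :> V -> C; ell2_in : ell2_val \in ell2_pred m_gt0 }.

HB.instance Definition _ := [isSub for ell2_val].
HB.instance Definition _ := [Choice of ell2 by <:].
HB.instance Definition _ := [SubChoice_isSubLmodule of ell2 by <:].

End Ell2Type.

Lemma cauchy_cvg_real (R : realType) (a : nat -> R) (c : R) : 0 < c ->
  (forall e : R, 0 < e -> exists N : nat, forall i j, (N <= i)%N -> (N <= j)%N ->
     c * (a i - a j) ^+ 2 < e) -> a n @[n --> \oo] --> lim (a n @[n --> \oo]).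
Proof.
move=> c0 h; apply/cauchy_cvgP/cauchyP => e e0.
have [|N hN] := h (c * e ^+ 2); first by rewrite mulr_gt0 // exprn_gt0.
exists (a N); exists N => // n /= Nn; rewrite /ball /=.
have := hN N n (leqnn N) Nn; rewrite ltr_pM2l // => h'.
rewrite -ltr_sqr; [|exact: normr_ge0|exact: ltW].
by rewrite real_normK ?num_real.
Qed.

Section Ell2Hilbert.
Context {R : realType} {V : countType}.
Local Notation C := R[i].
Variable m : V -> R.
Variable m_gt0 : forall x, 0 < m x.
Local Notation E0 := (ell2 m_gt0).
Implicit Types (f g h : V -> C) (X Y : {fset V}).

Lemma ell2P (f : E0) : l2 m f.
Proof. by apply/asboolP; exact: ell2_in. Qed.

Definition mkell2 f (h : l2 m f) : E0 := @Ell2 _ _ _ m_gt0 f (asboolT h).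

Lemma ell2_eqP (f g : E0) : (forall x, f x = g x) -> f = g.
Proof. by move=> h; apply: val_inj; apply/funext. Qed.

Lemma ell2Z (a : C) (f : E0) x : (a *: f) x = a * f x. Proof. by []. Qed.
Definition dterm f g (x : V) : C := (m x)%:C%C * (conjc (f x) * g x).

Lemma Re_conjM_le (z w : C) : `|complex.Re (conjc z * w)| <= sqnc z + sqnc w.
Proof.
case: z w => a b [c d]; rewrite /sqnc /= ler_norml.
have := sqr_ge0 (a - c); have := sqr_ge0 (a + c).
by have := sqr_ge0 (b - d); have := sqr_ge0 (b + d); nra.
Qed.

Lemma Im_conjM_le (z w : C) : `|complex.Im (conjc z * w)| <= sqnc z + sqnc w.
Proof.
case: z w => a b [c d]; rewrite /sqnc /= ler_norml.
have := sqr_ge0 (a - d); have := sqr_ge0 (a + d).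
by have := sqr_ge0 (b - c); have := sqr_ge0 (b + c); nra.
Qed.

Lemma summ_Re f g : l2 m f -> l2 m g -> summ (fun x => complex.Re (dterm f g x)).
Proof.
move=> /(l2_summ m_gt0) hf /(l2_summ m_gt0) hg.
apply: (summ_le _ (summD hf hg)) => x.
rewrite /dterm Re_mulr normrM gtr0_norm // /en -mulrDr ler_pM2l //.
exact: Re_conjM_le.
Qed.

Lemma summ_Im f g : l2 m f -> l2 m g -> summ (fun x => complex.Im (dterm f g x)).
Proof.
move=> /(l2_summ m_gt0) hf /(l2_summ m_gt0) hg.
apply: (summ_le _ (summD hf hg)) => x.
rewrite /dterm Im_mulr normrM gtr0_norm // /en -mulrDr ler_pM2l //.
exact: Im_conjM_le.
Qed.

Definition edot (f g : E0) : C := dotp m f g.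
Arguments edot : simpl never.

Lemma edotDr (f g h : E0) : edot f (g + h) = edot f g + edot f h.
Proof.
apply: complexP; rewrite ?ReD ?ImD /=.
- rewrite -rsumD; [|exact: summ_Re (ell2P f) (ell2P g)|exact: summ_Re (ell2P f) (ell2P h)].
  by congr rsum; apply/funext => x; rewrite /dterm -ReD -mulrDr -mulrDr.
- rewrite -rsumD; [|exact: summ_Im (ell2P f) (ell2P g)|exact: summ_Im (ell2P f) (ell2P h)].
  by congr rsum; apply/funext => x; rewrite /dterm -ImD -mulrDr -mulrDr.
Qed.

Lemma edotZr a (f g : E0) : edot f (a *: g) = a * edot f g.
Proof.
have hR := summ_Re (ell2P f) (ell2P g); have hI := summ_Im (ell2P f) (ell2P g).
have e x : dterm f (a *: g) x = a * dterm f g x by rewrite /dterm ell2Z; ring.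
apply: complexP; rewrite ?ReM ?ImM.
- rewrite -[complex.Re (edot f _)]/(rsum (fun x => complex.Re (dterm f (a *: g) x))).
  under [X in rsum X]eq_fun do rewrite e ReM -mulNr.
  rewrite rsumD; [|exact: summZ|exact: summZ].
  by rewrite !rsumZ // mulNr.
- rewrite -[complex.Im (edot f _)]/(rsum (fun x => complex.Im (dterm f (a *: g) x))).
  under [X in rsum X]eq_fun do rewrite e ImM.
  rewrite rsumD; [|exact: summZ|exact: summZ].
  by rewrite !rsumZ.
Qed.

Lemma edotC (f g : E0) : edot g f = conjc (edot f g).
Proof.
have hI := summ_Im (ell2P f) (ell2P g).
apply: complexP; rewrite ?Re_conjc ?Im_conjc /=.
- congr rsum; apply/funext => x.
  by case: (f x) (g x) => a b [c d] /=; ring.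
- rewrite -mulN1r -rsumZ //.
  congr rsum; apply/funext => x; rewrite /dterm.
  by case: (f x) (g x) => a b [c d] /=; ring.
Qed.

Lemma Re_edot (f : E0) : complex.Re (edot f f) = rsum (en m f).
Proof.
by congr rsum; apply/funext => x; rewrite Re_mulr mul_conjc.
Qed.

Lemma edot_l2sq (f : E0) : (complex.Re (edot f f))%:E = l2sq m f.
Proof.
rewrite Re_edot l2sqE; apply: rsum_ge0_esum; first exact: en_ge0.
exact: (proj1 (l2_summ m_gt0 f) (ell2P f)).
Qed.

Lemma edot_ge0 (f : E0) : 0 <= complex.Re (edot f f).
Proof.
by rewrite -lee_fin edot_l2sq l2sqE; apply: esum_ge0 => x _; rewrite lee_fin en_ge0.
Qed.

Lemma en_le_edot (f : E0) X : \sum_(x <- X) en m f x <= complex.Re (edot f f).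
Proof. by rewrite -lee_fin edot_l2sq l2sqE; apply: esum_fset_le; exact: en_ge0. Qed.

Lemma edot_le (f : E0) (M : R) : (forall X, \sum_(x <- X) en m f x <= M) ->
  complex.Re (edot f f) <= M.
Proof. by move=> h; rewrite -lee_fin edot_l2sq; exact: l2sq_le. Qed.

Lemma en_pt_le (f : E0) x : m x * sqnc (f x) <= complex.Re (edot f f).
Proof. by have := en_le_edot f [fset x]%fset; rewrite big_seq_fset1. Qed.

Lemma edot_eq0 (f : E0) : complex.Re (edot f f) = 0 -> f = 0.
Proof.
move=> h; apply: ell2_eqP => x; apply: sqnc_eq0.
have := en_pt_le f x; rewrite h pmulr_rle0 // => h'.
by apply/eqP; rewrite eq_le h' sqnc_ge0.
Qed.

(** The filter is arbitrary because the limits are taken along the integers for completeness and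
    along an ultrafilter for compactness. *)
Lemma cvg_en_sum (F : set_system nat) (FF : Filter F) (v : nat -> V -> C) g X :
  (forall x, complex.Re (v j x) @[j --> F] --> complex.Re (g x)) ->
  (forall x, complex.Im (v j x) @[j --> F] --> complex.Im (g x)) ->
  \sum_(x <- X) en m (v j) x @[j --> F] --> \sum_(x <- X) en m g x.
Proof.
move=> hR hI; elim: (X : seq V) => [|x s IH].
  by rewrite big_nil; under eq_fun do rewrite big_nil; exact: cvg_cst.
rewrite big_cons; under eq_fun do rewrite big_cons.
apply: cvgD => //; apply: cvgM; first exact: cvg_cst.
by apply: cvgD; apply: cvgM.
Qed.

(** The candidate is the pointwise limit. The Cauchy estimate restricted to a finite set X passes to
    the limit in the second index with a threshold independent of X, which gives both membership in
    l^2 and norm convergence. *)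
Lemma edot_complete (u : nat -> E0) :
  (forall e : R, 0 < e -> exists N : nat, forall i j, (N <= i)%N -> (N <= j)%N ->
      complex.Re (edot (u i - u j) (u i - u j)) < e) ->
  exists l, complex.Re (edot (u n - l) (u n - l)) @[n --> \oo] --> (0 : R).
Proof.
move=> hu.
have pt x (phi : C -> R) : (forall z w, (phi z - phi w) ^+ 2 <= sqnc (z - w)) ->
    phi (u n x) @[n --> \oo] --> lim (phi (u n x) @[n --> \oo]).
  move=> hphi; apply: (@cauchy_cvg_real _ _ (m x) (m_gt0 x)) => e e0.
  have [N hN] := hu e e0; exists N => i j Ni Nj.
  apply: le_lt_trans (hN i j Ni Nj); apply: le_trans (en_pt_le _ x).
  by rewrite ler_pM2l // hphi.
pose f x := (lim (complex.Re (u n x) @[n --> \oo]) +i* lim (complex.Im (u n x) @[n --> \oo]))%C.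
have fR x : complex.Re (u n x) @[n --> \oo] --> complex.Re (f x).
  by apply: (pt x (@complex.Re R)) => z w; rewrite -ReN -ReD /sqnc lerDl sqr_ge0.
have fI x : complex.Im (u n x) @[n --> \oo] --> complex.Im (f x).
  by apply: (pt x (@complex.Im R)) => z w; rewrite -ImN -ImD /sqnc lerDr sqr_ge0.
have key e : 0 < e -> exists N : nat, forall i X, (N <= i)%N ->
    \sum_(x <- X) en m (fun x => u i x - f x) x <= e.
  move=> e0; have [N hN] := hu e e0; exists N => i X Ni.
  have hc : \sum_(x <- X) en m (fun x => u i x - u j x) x @[j --> \oo] -->
      \sum_(x <- X) en m (fun x => u i x - f x) x.
    apply: cvg_en_sum => x.
      rewrite ReD ReN; under eq_fun do rewrite ReD ReN.
      by apply: cvgB => //; exact: cvg_cst.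
    rewrite ImD ImN; under eq_fun do rewrite ImD ImN.
    by apply: cvgB => //; exact: cvg_cst.
  apply: (ler_cvg_to hc (cvg_cst e)); exists N => // j /= Nj.
  exact: le_trans (en_le_edot (u i - u j) X) (ltW (hN i j Ni Nj)).
have hf : l2 m f.
  have [N hN] := key 1 ltr01.
  have h1 : l2 m (fun x => u N x - f x) by apply: (@l2_bound _ _ _ _ 1) => X; exact: hN.
  have := l2D m_gt0 (ell2P (u N)) (l2Z m_gt0 (-1) h1).
  by congr (l2 m); apply/funext => x; rewrite mulN1r opprB addrC subrK.
exists (mkell2 hf).
pose d n := complex.Re (edot (u n - mkell2 hf) (u n - mkell2 hf)).
suff : d n @[n --> \oo] --> (0 : R) by [].
apply/cvgrPdist_le => e e0; have [N hN] := key e e0; exists N => // n Nn.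
have d0 : 0 <= d n by exact: edot_ge0.
rewrite -/(d n) sub0r normrN (ger0_norm d0).
by apply: edot_le => X; exact: hN.
Qed.

Definition l2h : hilbert R :=
  Hilbert edotDr edotZr edotC edot_ge0 edot_eq0 edot_complete.

Lemma dotpE (f g : l2h) : dotp m f g = dot f g. Proof. by []. Qed.

Lemma l2sq_nsq (f : l2h) : l2sq m f = (nsq f)%:E.
Proof. by rewrite -edot_l2sq. Qed.

Lemma l2_cvgE (u : nat -> l2h) (f : l2h) : l2_cvg m u f <-> hcvg u f.
Proof.
rewrite /l2_cvg.
have -> : (fun n => l2sq m (fun x => u n x - f x)) = (fun n => (nsq (u n - f))%:E).
  by apply/funext => n; rewrite -l2sq_nsq.
split.
  move=> /fine_cvgP[_] /= h; rewrite /hcvg /nrm -[X in _ --> X](@sqrtr0 R).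
  by apply: (cvg_comp _ Num.sqrt h); exact: sqrt_continuous.
move=> h; apply: cvg_EFin; first exact: nearW.
have -> : fine \o (fun n => (nsq (u n - f))%:E) = (fun n => nrm (u n - f) ^+ 2).
  by apply/funext => n /=; rewrite nrm_sqr.
by rewrite -(mulr0 (0 : R)); apply: cvgM.
Qed.

End Ell2Hilbert.

Section Ell2Tools.
Context {R : realType} {V : countType}.
Local Notation C := R[i].
Variable m : V -> R.
Variable m_gt0 : forall x, 0 < m x.
Local Notation E := (l2h m_gt0).
Implicit Types (X Y : {fset V}) (A : pred V).

Lemma l2vP (f : E) : l2 m f. Proof. exact: ell2P. Qed.

Lemma mk_l2 (f : V -> C) : l2 m f -> exists g : E, g = f :> (V -> C).
Proof. by move=> h; exists (mkell2 m_gt0 h). Qed.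

Lemma l2_eqP (f g : E) : (forall x, f x = g x) -> f = g.
Proof. exact: ell2_eqP. Qed.

Lemma l2hD (f g : E) x : (f + g) x = f x + g x. Proof. by []. Qed.
Lemma l2hZ (a : C) (f : E) x : (a *: f) x = a * f x. Proof. by []. Qed.
Lemma l2hN (f : E) x : (- f) x = - f x. Proof. by []. Qed.
Lemma l2h0 x : (0 : E) x = 0. Proof. by []. Qed.
Lemma l2h_sum (I : Type) (r : seq I) (P : pred I) (F : I -> E) x :
  (\sum_(i <- r | P i) F i) x = \sum_(i <- r | P i) F i x.
Proof. by apply: (big_morph (fun f : E => f x)). Qed.

Lemma en_le_nsq (f : E) X : \sum_(x <- X) en m f x <= nsq f.
Proof. exact: en_le_edot. Qed.

Lemma nsq_le_en (f : E) (M : R) : (forall X, \sum_(x <- X) en m f x <= M) -> nsq f <= M.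
Proof. exact: edot_le. Qed.

Lemma en_pt_le_nsq (f : E) x : m x * sqnc (f x) <= nsq f.
Proof. exact: en_pt_le. Qed.

Definition finsupp (f : V -> C) := exists X, forall x, x \notin X -> f x = 0.

Lemma l2_finite (f : V -> C) X : (forall x, x \notin X -> f x = 0) -> l2 m f.
Proof.
move=> h; apply: (@l2_bound _ _ m f (\sum_(x <- X) en m f x)) => Y.
apply: le_trans (_ : \sum_(x <- (X `|` Y)%fset) en m f x <= _).
  by apply: big_fset_subset_le; [exact: en_ge0|exact: fsubsetUr].
rewrite (big_fsetID _ (mem X)) /= [leRHS]big_seq.
have -> : [fset x | x in (X `|` Y)%fset & x \in X]%fset = X.
  by apply/fsetP => x; rewrite !inE /=; case: (x \in X); rewrite ?andbF.
rewrite -big_seq gerDl big_seq big1 // => x.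
rewrite !inE /= => /andP[_ /h xX].
by rewrite /en xX /sqnc /= expr0n /= addr0 mulr0.
Qed.

Lemma sqnc0 : sqnc (0 : C) = 0.
Proof. by rewrite /sqnc /= expr0n /= addr0. Qed.

Lemma hcvg_pt (u : nat -> E) (f : E) x : hcvg u f -> sqnc (u n x - f x) @[n --> \oo] --> (0 : R).
Proof.
move=> h; have h2 : (m x)^-1 * nsq (u n - f) @[n --> \oo] --> (m x)^-1 * nsq (f - f).
  by apply: cvgMr; exact: (hcvg_nsq (hcvgB h (hcvg_cst f))).
rewrite subrr nsq0 mulr0 in h2.
apply: squeeze_cvgr (cvg_cst 0) h2; apply: nearW => n.
rewrite sqnc_ge0 /= -ler_pdivrMl ?invr_gt0 // invrK.
exact: (en_pt_le_nsq (u n - f) x).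
Qed.

Lemma hcvg_pt_eq (u : nat -> E) (f : E) (g : V -> C) :
  hcvg u f -> (forall x, exists N, forall n, (N <= n)%N -> u n x = g x) ->
  f = g :> (V -> C).
Proof.
move=> h hg; apply/funext => x; apply/eqP; rewrite -subr_eq0; apply/eqP/sqnc_eq0.
have [N hN] := hg x.
have hc : sqnc (u n x - f x) @[n --> \oo] --> sqnc (f x - g x).
  apply: cvg_near_cst; exists N => // n Nn.
  by rewrite hN // -sqncN opprB.
exact: (cvg_unique _ hc (hcvg_pt x h)).
Qed.

Lemma dotRe_has_sum (f g : E) : has_sum (fun x => complex.Re (dterm m f g x)) (rd f g).
Proof. by apply: has_sum_rsum; exact: summ_Re (ell2P f) (ell2P g). Qed.

Lemma dotIm_has_sum (f g : E) :
  has_sum (fun x => complex.Im (dterm m f g x)) (complex.Im (dot f g)).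
Proof. by apply: has_sum_rsum; exact: summ_Im (ell2P f) (ell2P g). Qed.

Lemma eq_dot (f g f' g' : E) : (forall x, conjc (f x) * g x = conjc (f' x) * g' x) ->
  dot f g = dot f' g'.
Proof.
move=> h; have e : dterm m f g = dterm m f' g' by apply/funext => x; rewrite /dterm h.
apply: complexP.
  by apply: has_sum_unique (dotRe_has_sum f g) _; rewrite e; exact: dotRe_has_sum.
by apply: has_sum_unique (dotIm_has_sum f g) _; rewrite e; exact: dotIm_has_sum.
Qed.

Lemma dot_finsupp (f g : E) X : (forall x, x \notin X -> conjc (f x) * g x = 0) ->
  dot f g = \sum_(x <- X) (m x)%:C%C * (conjc (f x) * g x).
Proof.
move=> h; have h' x : x \notin X -> dterm m f g x = 0.
  by move=> /h e; rewrite /dterm e mulr0.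
apply: complexP.
  rewrite Re_sum; apply: has_sum_unique (dotRe_has_sum f g) _.
  by apply: has_sum_finite => x /h' ->.
rewrite Im_sum; apply: has_sum_unique (dotIm_has_sum f g) _.
by apply: has_sum_finite => x /h' ->.
Qed.

Lemma nsq_finsupp (f : E) X : (forall x, x \notin X -> f x = 0) ->
  nsq f = \sum_(x <- X) en m f x.
Proof.
move=> h; rewrite /nsq /rd (@dot_finsupp _ _ X); last by move=> x /h ->; rewrite mulr0.
by rewrite Re_sum; apply: eq_bigr => x _; rewrite Re_mulr mul_conjc.
Qed.

Definition finf (f : V -> C) X (h : forall x, x \notin X -> f x = 0) : E :=
  mkell2 m_gt0 (l2_finite h).

Fact delta_supp (y x : V) : x \notin [fset y]%fset -> (x == y)%:R = 0 :> C.
Proof. by rewrite inE => /negPf ->. Qed.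

Definition delta (y : V) : E := finf (@delta_supp y).

Lemma deltaE y x : delta y x = (x == y)%:R. Proof. by []. Qed.

Lemma dot_delta y (f : E) : dot (delta y) f = (m y)%:C%C * f y.
Proof.
rewrite (@dot_finsupp _ _ [fset y]%fset).
  by rewrite big_seq_fset1 deltaE eqxx conjc1 mul1r.
by move=> x; rewrite inE deltaE => /negPf ->; rewrite conjc0 mul0r.
Qed.

Lemma l2_le (f g : V -> C) (c : R) : (forall x, sqnc (f x) <= c * sqnc (g x)) ->
  l2 m g -> l2 m f.
Proof.
move=> h /(l2_summ m_gt0) hg; apply/(l2_summ m_gt0).
apply: (summ_le _ (summZ c hg)) => x.
by rewrite ger0_norm ?en_ge0 // /en mulrCA ler_pM2l.
Qed.

Fact trunc_l2 A (f : E) : l2 m (fun x => if A x then f x else 0).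
Proof.
apply: (@l2_le _ f 1) (l2vP f) => x; rewrite mul1r.
by case: ifP => // _; rewrite sqnc0 sqnc_ge0.
Qed.

Definition trunc A (f : E) : E := mkell2 m_gt0 (trunc_l2 A f).

Lemma truncE A (f : E) x : trunc A f x = if A x then f x else 0.
Proof. by []. Qed.

Lemma trunc_symmetric A : symmetric_op (trunc A).
Proof.
move=> f g; apply: eq_dot => x; rewrite !truncE.
by case: ifP; rewrite ?conjc0 ?mul0r ?mulr0.
Qed.

Lemma trunc_idem A f : trunc A (trunc A f) = trunc A f.
Proof. by apply: l2_eqP => x; rewrite !truncE; case: (A x). Qed.

Lemma nsq_trunc_split A f : nsq f = nsq (trunc A f) + nsq (f - trunc A f).
Proof.
rewrite nsqB; have -> : rd f (trunc A f) = nsq (trunc A f).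
  by rewrite /nsq /rd trunc_symmetric trunc_idem.
ring.
Qed.

Lemma nsq_trunc_le A f : nsq (trunc A f) <= nsq f.
Proof. by rewrite (nsq_trunc_split A f) lerDl nsq_ge0. Qed.

Definition exhausting (A : nat -> pred V) :=
  forall x, exists N : nat, forall n, (N <= n)%N -> A n x.

Lemma exhausting_fset (A : nat -> pred V) X : exhausting A ->
  exists N : nat, forall n, (N <= n)%N -> forall x, x \in X -> A n x.
Proof.
move=> hA; have [N hN] := choice hA.
exists (\max_(x <- X) N x)%N => n hn x xX; apply: hN; apply: leq_trans hn.
by rewrite (big_fsetD1 _ xX) /= leq_maxl.
Qed.

Lemma trunc_cvg (A : nat -> pred V) f : exhausting A -> hcvg (fun n => trunc (A n) f) f.
Proof.
move=> hA; apply/hcvgP => e e0.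
have e20 : 0 < e ^+ 2 by rewrite exprn_gt0.
have [|X hX] := @esum_fin_approx R V (en m f) (nsq f) (en_ge0 m_gt0 f) _ _ e20.
  by rewrite -l2sq_nsq l2sqE.
have [N hN] := exhausting_fset X hA; exists N => n Nn.
have h1 : \sum_(x <- X) en m f x <= nsq (trunc (A n) f).
  apply: le_trans (en_le_nsq _ X); rewrite big_seq [leRHS]big_seq.
  by apply: ler_sum => x xX; rewrite /en truncE hN.
rewrite nrmBC -ltr_sqr; [|exact: nrm_ge0|exact: ltW].
rewrite nrm_sqr; have := nsq_trunc_split (A n) f; lra.
Qed.

(** Monotone convergence: each finite set of points is eventually contained in the truncation
    region, so its energy is bounded by M. *)
Lemma l2_of_trunc (A : nat -> pred V) (f : V -> C) (M : R) : exhausting A ->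
  (forall n (g : E), (forall x, g x = if A n x then f x else 0) -> nsq g <= M) ->
  (forall n, l2 m (fun x => if A n x then f x else 0)) ->
  l2 m f.
Proof.
move=> hA hM hl; apply: (@l2_bound _ _ m f M) => X.
have [N hN] := exhausting_fset X hA.
apply: le_trans (hM N (mkell2 m_gt0 (hl N)) (fun=> erefl)).
apply: le_trans (en_le_nsq _ X); rewrite big_seq [leRHS]big_seq.
by apply: ler_sum => x xX; rewrite /en /= (hN N (leqnn N) x xX).
Qed.

End Ell2Tools.

(** * Compactness of multiplication by a function vanishing at infinity *)

Section Compactness.
Context {R : realType}.

Lemma ultra_bounded_cvg (U : set_system nat) (u : nat -> R) (b : R) : UltraFilter U ->
  (forall n, `|u n| <= b) -> exists l : R, u n @[n --> U] --> l.
Proof.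
move=> hU hb; have PU : ProperFilter U := @ultra_proper _ _ hU.
have [|l [_ hl]] := @segment_compact R (- b) b (u n @[n --> U]) _.
  have : U (u @^-1` `[(- b), b]%classic).
    by apply: filterE => n; rewrite /= in_itv /=; have := hb n; rewrite ler_norml.
  by [].
exists l => A hA; have [//|hC] := in_ultra_setVsetC (u @^-1` A) hU.
by have [z [zC zA]] := hl (~` A) A hC hA.
Qed.

Lemma extract_subsequence (P : nat -> nat -> Prop) :
  (forall k N, exists2 n, (N <= n)%N & P k n) ->
  exists s : nat -> nat, {homo s : i j / (i < j)%N} /\ forall k, P k (s k).
Proof.
move=> h; have /choice [c hc] : forall kN : nat * nat, exists n, (kN.2 <= n)%N /\ P kN.1 n.
  by move=> [k N]; have [n] := h k N; exists n.
pose s := fix s k := if k is k'.+1 then c (k, (s k').+1) else c (0%N, 0%N).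
exists s; split; last by case=> [|k]; [exact: (hc (0%N, 0%N)).2|exact: (hc (k.+1, (s k).+1)).2].
apply: homo_ltn; first by move=> x y z; exact: ltn_trans.
by move=> k; exact: (hc (k.+1, (s k).+1)).1.
Qed.

Context {V : countType}.
Local Notation C := R[i].
Variable m : V -> R.
Variable m_gt0 : forall x, 0 < m x.
Local Notation E := (l2h m_gt0).

Lemma sqnc_le_component (z : C) (c : R) : sqnc z <= c ->
  `|complex.Re z| <= c + 1 /\ `|complex.Im z| <= c + 1.
Proof.
case: z => a b; rewrite /sqnc /= !ler_norml => h.
by split; have := sqr_ge0 a; have := sqr_ge0 b; have := sqr_ge0 (a - 1);
  have := sqr_ge0 (a + 1); have := sqr_ge0 (b - 1); have := sqr_ge0 (b + 1);
  rewrite !expr2 in h *; move=> *; apply/andP; split; lra.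
Qed.

(* Along an ultrafilter the sequence w converges pointwise, and the decay of phi
   upgrades this to norm convergence of phi w. *)
Lemma decaying_multiplier_compact (phi : V -> R) (w v : nat -> E) (c : R) :
  (forall e : R, 0 < e -> exists X : {fset V}, forall x, x \notin X -> phi x ^+ 2 <= e) ->
  (forall n, nsq (w n) <= c) -> (forall n x, v n x = (phi x)%:C%C * w n x) ->
  exists (s : nat -> nat) (f : E), {homo s : i j / (i < j)%N} /\ hcvg (v \o s) f.
Proof.
move=> hphi hw hv.
have [U [hU hooU]] := ultraFilterLemma (eventually_filter).
have PU : ProperFilter U := @ultra_proper _ _ hU.
have bound x n : `|complex.Re (w n x)| <= c / m x + 1 /\ `|complex.Im (w n x)| <= c / m x + 1.
  apply: sqnc_le_component; rewrite ler_pdivlMr // mulrC.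
  exact: le_trans (en_pt_le_nsq (w n) x) (hw n).
have /choice [lR hR] : forall x, exists l : R, complex.Re (w n x) @[n --> U] --> l.
  by move=> x; apply: ultra_bounded_cvg => n; exact: (bound x n).1.
have /choice [lI hI] : forall x, exists l : R, complex.Im (w n x) @[n --> U] --> l.
  by move=> x; apply: ultra_bounded_cvg => n; exact: (bound x n).2.
pose l x : C := (lR x +i* lI x)%C.
have sumc (X : {fset V}) : \sum_(x <- X) en m (fun x => w n x) x @[n --> U] --> \sum_(x <- X) en m l x.
  by apply: cvg_en_sum => x; [exact: hR|exact: hI].
have lle (X : {fset V}) : \sum_(x <- X) en m l x <= c.
  apply: (ler_cvg_to (sumc X) (cvg_cst c)); apply: nearW => n.
  exact: le_trans (en_le_nsq (w n) X) (hw n).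
have [wl ewl] := mk_l2 m_gt0 (l2_bound lle).
have hwl : nsq wl <= c by apply: nsq_le_en => X; rewrite ewl; exact: lle.
have c0 : 0 <= c by exact: le_trans (nsq_ge0 _) hwl.
have [X1 hX1] := hphi 1 ltr01.
(* A global bound for phi^2, which is at most 1 off X1 and at most the finite sum on X1. *)
pose B := 1 + \sum_(x <- X1) phi x ^+ 2.
have phiB x : phi x ^+ 2 <= B.
  have s0 (Y : {fset V}) : 0 <= \sum_(x <- Y) phi x ^+ 2 by apply: sumr_ge0 => *; exact: sqr_ge0.
  have [xX|/hX1] := boolP (x \in X1); last by move: (s0 X1); rewrite /B; lra.
  rewrite /B (big_fsetD1 x xX) /=; have := s0 (X1 `\ x)%fset; lra.
have [f ef] : exists f : E, f = (fun x => (phi x)%:C%C * wl x) :> (V -> C).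
  apply: (mk_l2 m_gt0); apply: (@l2_le _ _ m m_gt0 _ wl B); last exact: l2vP.
  by move=> x; rewrite sqncM sqncR ler_wpM2r // sqnc_ge0.
have diff n x : (v n - f) x = (phi x)%:C%C * (w n - wl) x.
  have -> : (v n - f) x = v n x - f x by [].
  have -> : (w n - wl) x = w n x - wl x by [].
  by rewrite hv ef mulrBr.
have enE n x : en m (v n - f) x = phi x ^+ 2 * en m (w n - wl) x.
  by rewrite /en diff sqncM sqncR mulrCA.
have key (d : R) : 0 < d -> \forall n \near U, nsq (v n - f) < d.
  (* Off X the multiplier contributes at most e |w_n - wl|^2 <= 4 c e <= d / 2; the added 1 keeps
     the denominator positive when c = 0. On X the convergence is that of finitely many
     coordinates. *)
  move=> d0; have e0 : 0 < d / 2 / (4 * c + 1) by rewrite !divr_gt0 //; lra.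
  have [X hX] := hphi _ e0; set e := d / 2 / _ in e0 hX.
  have hlim : \sum_(x <- X) en m (fun x => w n x - wl x) x @[n --> U] --> (0 : R).
    have z0 : \sum_(x <- X) en m (fun x => wl x - wl x) x = 0.
      by rewrite big1 // => x _; rewrite /en subrr sqnc0 mulr0.
    rewrite -[X in _ --> X]z0.
    apply: cvg_en_sum => x.
      rewrite ReD ReN; under eq_fun do rewrite ReD ReN.
      by apply: cvgB; [rewrite ewl; exact: hR|exact: cvg_cst].
    rewrite ImD ImN; under eq_fun do rewrite ImD ImN.
    by apply: cvgB; [rewrite ewl; exact: hI|exact: cvg_cst].
  have B0 : 0 < B.
    by rewrite /B ltr_pwDl // sumr_ge0 // => *; exact: sqr_ge0.
  have /cvgrPdist_lt /(_ (d / 2 / B)) := hlim.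
  have dB : 0 < d / 2 / B by rewrite !divr_gt0.
  move=> /(_ dB); apply: filterS => n hn.
  have {}hn : \sum_(x <- X) en m (fun x => w n x - wl x) x < d / 2 / B.
    apply: le_lt_trans hn; rewrite sub0r normrN; exact: ler_norm.
  rewrite ltr_pdivlMr // in hn.
  have hnn : nsq (w n - wl) <= 4 * c.
    rewrite nsqB; have := hw n; have := rd_norm_le (w n) wl.
    have hh : nrm (w n) * nrm wl <= c.
      rewrite -(sqr_sqrtr c0) expr2; apply: ler_pM; rewrite ?nrm_ge0 //; exact: ler_wsqrtr.
    rewrite ler_norml => /andP[]; lra.
  apply: (@le_lt_trans _ _ (B * (\sum_(x <- X) en m (fun x => w n x - wl x) x) + e * (4 * c))).
    apply: nsq_le_en => Y.
    rewrite (big_fsetID _ (mem X)) /=; apply: lerD.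
      apply: le_trans (_ : \sum_(x <- X) en m (v n - f) x <= _).
        apply: big_fset_subset_le; first exact: en_ge0.
        by apply/fsubsetP => x; rewrite !inE => /andP[].
      rewrite mulr_sumr; apply: ler_sum => x _.
      by rewrite enE ler_wpM2r ?en_ge0 //; exact: phiB.
    apply: le_trans (ler_wpM2l (ltW e0) hnn).
    apply: le_trans (ler_wpM2l (ltW e0) (en_le_nsq (w n - wl) Y)).
    rewrite mulr_sumr; apply: le_trans (_ : \sum_(x <- [fset x | x in Y & x \notin X]%fset) e * en m (w n - wl) x <= _).
      rewrite big_seq [leRHS]big_seq; apply: ler_sum => x xin.
      have xX : x \notin X by move: xin; rewrite !inE /= => /andP[].
      by rewrite enE ler_wpM2r ?en_ge0 //; exact: hX.
    apply: big_fset_subset_le; first by move=> x; rewrite mulr_ge0 ?en_ge0 // ltW.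
    by apply/fsubsetP => x; rewrite !inE => /andP[].
  have he : e * (4 * c) <= d / 2.
    have -> : d / 2 = e * (4 * c + 1) by rewrite /e; field; rewrite gt_eqF //; lra.
    by rewrite ler_wpM2l ?(ltW e0) //; lra.
  by move: hn he; rewrite mulrC; lra.
(* Every set of the ultrafilter meets every tail of the integers, so the limit along it is reached
   by an ordinary subsequence. *)
have [|s [sh hs]] := @extract_subsequence (fun k n => nsq (v n - f) < (k.+1%:R)^-1).
  move=> k N.
  have h1 : \forall n \near U, nsq (v n - f) < (k.+1%:R)^-1 by apply: key; rewrite invr_gt0.
  have h2 : \forall n \near U, (N <= n)%N by apply: hooU; exists N.
  by have [n [p q]] := filter_ex (filterI h1 h2); exists n.
exists s, f; split=> //.
apply: (@hcvg_squeeze _ _ _ _ (fun k => Num.sqrt ((k.+1%:R)^-1))).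
  by move=> k; apply: ler_wsqrtr; exact: ltW (hs k).
have h4 := @cvg_harmonic R.
rewrite -[X in _ --> X](@sqrtr0 R).
by apply: (cvg_comp _ Num.sqrt h4); exact: sqrt_continuous.
Qed.

End Compactness.

(** * Magnetic Laplacians *)

Section UnitCircle.
Context {R : realType}.
Local Notation C := R[i].

Lemma expiD (a b : R) : expi (a + b) = expi a * expi b.
Proof.
by rewrite /expi cosD sinD; apply: complexP => /=; ring.
Qed.

Lemma expiN (a : R) : expi (- a) = conjc (expi a).
Proof. by rewrite /expi cosN sinN. Qed.

Lemma expi0 : expi 0 = 1 :> C.
Proof. by rewrite /expi cos0 sin0. Qed.

Lemma sqnc_expi (a : R) : sqnc (expi a) = 1.
Proof. by rewrite /sqnc /= cos2Dsin2. Qed.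

Lemma expi_2pi (k : int) : expi (k%:~R * (2 * pi)) = 1 :> C.
Proof.
have h n : expi (n%:R * (2 * pi)) = 1 :> C.
  elim: n => [|n IH]; first by rewrite mul0r expi0.
  rewrite -addn1 natrD mulrDl expiD IH !mul1r /expi.
  by rewrite mulr_natl cos2pi sin2pi.
case: k => n; first exact: h.
by rewrite NegzE mulrNz mulNr expiN h conjc1.
Qed.

Lemma eq_mod2pi_expi (a b : R) : eq_mod2pi a b -> expi a = expi b.
Proof. by move=> [k ->]; rewrite expiD expi_2pi mulr1. Qed.

(** Reduce a modulo 2 pi to r in [0, 2 pi). Then cos r = 1 - 2 sin(r/2)^2, and sin(r/2) > 0 unless r
    = 0. *)
Lemma expi_eq1 (a : R) : expi a = 1 :> C -> eq_mod2pi a 0.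
Proof.
move=> h; pose k := Num.floor (a / (2 * pi)).
have pi0 : 0 < 2 * pi :> R by rewrite mulr_gt0 // pi_gt0.
exists k; rewrite add0r; apply/eqP; rewrite -subr_eq0.
set r := a - _; have r0 : 0 <= r.
  by rewrite /r subr_ge0 -ler_pdivlMr // floor_le_tmp.
have r2 : r < 2 * pi.
  rewrite /r ltrBlDr -[X in _ < X + _]mul1r -mulrDl -ltr_pdivrMr // addrC.
  by have := floorD1_gt (a / (2 * pi)); rewrite intrD.
have hr : expi r = 1 :> C.
  by rewrite /r expiD -mulNr -intrN expi_2pi mulr1.
apply/negP => /negP rn0; have rp : 0 < r by rewrite lt_neqAle eq_sym rn0.
have s0 : 0 < sin (r / 2) by apply: sin_gt0_pi; rewrite divr_gt0 //= ltr_pdivrMr // mulrC.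
have := congr1 (@complex.Re R) hr; rewrite /= => c1.
have : cos r = 1 - 2 * sin (r / 2) ^+ 2.
  have -> : r = r / 2 + r / 2 by field.
  rewrite cosD -!expr2; have := cos2Dsin2 (r / 2).
  by rewrite (_ : (r / 2 + r / 2) / 2 = r / 2); [lra|field].
by rewrite c1; have := exprn_gt0 2 s0; lra.
Qed.

End UnitCircle.

Section WeightedGraph.
Context {R : realType} {V : countType}.
Local Notation C := R[i].
Variables (G : wgraph R V) (theta : V -> V -> R).

(* What remains of is_graph and magnetic_potential once connectedness and the
   absence of loops are dropped; positivity of the measure is kept separate, as
   graphs with different weights will share one Hilbert space. *)
Record locally_finite_magnetic : Prop := {
  lfm_sym : forall x y, weight G x y = weight G y x;
  lfm_ge0 : forall x y, 0 <= weight G x y;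
  lfm_fin : forall x, finite_set [set y | adj G x y];
  lfm_theta : forall x y, adj G x y -> eq_mod2pi (theta x y) (- theta y x) }.

Hypothesis hG : locally_finite_magnetic.
Local Notation m := (meas G).
Variable m_gt0 : forall x, 0 < meas G x.
Local Notation E := (l2h m_gt0).
Local Notation L := (formal_laplacian G theta).
Local Notation w := (weight G).
Local Notation ex := (fun x y => expi (theta x y)).
Implicit Types (X Y Z : {fset V}) (f g : V -> C).

Definition nb (x : V) : {fset V} := fset_set [set y | adj G x y].

Lemma in_nb x y : (y \in nb x) = adj G x y.
Proof. rewrite /nb in_fset_set; last exact: lfm_fin.
by apply/idP/idP; rewrite inE. Qed.

Lemma adj_sym x y : adj G x y = adj G y x.
Proof. by rewrite /adj (lfm_sym hG). Qed.

Lemma w_nadj x y : ~~ adj G x y -> w x y = 0.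
Proof.
by rewrite /adj -leNgt => h; apply/eqP; rewrite eq_le h (lfm_ge0 hG).
Qed.

(** The hermitian symmetry of the magnetic weights. The factor [w x y] is kept since the potential
    is only known to be antisymmetric on edges. *)
Lemma w_ex_sym x y : (w x y)%:C%C * conjc (ex x y) = (w x y)%:C%C * ex y x.
Proof.
have [/(lfm_theta hG)/eq_mod2pi_expi -> |/w_nadj ->] := boolP (adj G x y).
  by rewrite expiN conjcK.
by rewrite !mul0r.
Qed.

Lemma formal_laplacianE f x Z :
  (forall y, y \notin Z -> (w x y)%:C%C * (f x - ex x y * f y) = 0) ->
  L f x = ((m x)^-1)%:C%C * \sum_(y <- Z) (w x y)%:C%C * (f x - ex x y * f y).
Proof.
move=> hZ; rewrite /formal_laplacian; congr (_ * _).
rewrite -(fsbig_widen [set` Z]) //; last by move=> y [_ /negP]; exact: hZ.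
by rewrite fsbig_finite //= set_fsetK.
Qed.

Lemma formal_laplacian_nb f x :
  L f x = ((m x)^-1)%:C%C * \sum_(y <- nb x) (w x y)%:C%C * (f x - ex x y * f y).
Proof.
by apply: formal_laplacianE => y; rewrite in_nb => /w_nadj ->; rewrite mul0r.
Qed.

Lemma eq_laplacian_near f g x : f x = g x -> (forall y, adj G x y -> f y = g y) ->
  L f x = L g x.
Proof.
move=> fg h; rewrite !formal_laplacian_nb fg; congr (_ * _).
rewrite big_seq [RHS]big_seq; apply: eq_bigr => y; rewrite in_nb => /h ->.
by [].
Qed.

(** If f is supported in X, then L f is supported here, and so is every edge touching X: one finite
    index set serves for all double sums. *)
Definition thicken X : {fset V} := (X `|` \bigcup_(x <- X) nb x)%fset.

Lemma thicken_sub X x : x \in X -> x \in thicken X.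
Proof. by move=> h; rewrite inE h. Qed.

Lemma thicken_nb X x y : x \in X -> adj G x y -> y \in thicken X.
Proof.
move=> h a; rewrite inE; apply/orP; right; apply/bigfcupP; exists x; rewrite ?h //.
by rewrite in_nb.
Qed.

Section FiniteSupport.
Variables (f : V -> C) (X : {fset V}).
Hypothesis fX : forall x, x \notin X -> f x = 0.
Let Z := thicken X.

Lemma laplacian_supp x : x \notin Z -> L f x = 0.
Proof.
move=> xZ; rewrite formal_laplacian_nb big_seq big1 ?mulr0 // => y; rewrite in_nb => a.
rewrite fX; last by apply: contra xZ; exact: thicken_sub.
rewrite fX ?mulr0 ?subr0 ?mulr0 //.
by apply: contra xZ => yX; apply: (thicken_nb yX); rewrite adj_sym.
Qed.

Lemma laplacian_fsE x : (m x)%:C%C * L f x =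
  \sum_(y <- Z) (w x y)%:C%C * (f x - ex x y * f y).
Proof.
have [xX|xX] := boolP (x \in X).
  rewrite (@formal_laplacianE _ _ Z) => [|y yZ].
    by rewrite mulrA -rmorphM /= mulfV ?gt_eqF // mul1r.
  rewrite w_nadj ?mul0r //; apply: contra yZ; exact: thicken_nb.
rewrite (@formal_laplacianE _ _ Z) => [|y yZ].
  by rewrite mulrA -rmorphM /= mulfV ?gt_eqF // mul1r.
rewrite (fX xX) fX ?mulr0 ?subr0 ?mulr0 //.
by apply: contra yZ; exact: thicken_sub.
Qed.

Lemma laplacian_anyE (g : V -> C) x : x \in X -> (m x)%:C%C * L g x =
  \sum_(y <- Z) (w x y)%:C%C * (g x - ex x y * g y).
Proof.
move=> xX; rewrite (@formal_laplacianE _ _ Z) => [|y yZ].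
  by rewrite mulrA -rmorphM /= mulfV ?gt_eqF // mul1r.
rewrite w_nadj ?mul0r //; apply: contra yZ; exact: thicken_nb.
Qed.

Lemma dot_laplacian_supp (F H : E) (g : V -> C) : F = f :> (V -> C) -> H = L g :> (V -> C) ->
  dot F H = \sum_(x <- Z) \sum_(y <- Z) conjc (f x) * ((w x y)%:C%C * (g x - ex x y * g y)).
Proof.
move=> eF eH; rewrite (@dot_finsupp _ _ _ _ _ _ Z); last first.
  move=> x xZ; rewrite eF fX ?conjc0 ?mul0r //.
  by apply: contra xZ; exact: thicken_sub.
apply: eq_bigr => x _; rewrite eF eH -mulr_sumr mulrCA.
have [xX|xX] := boolP (x \in X); first by rewrite laplacian_anyE.
by rewrite fX // conjc0 !mul0r.
Qed.

(** Green's formula, in which only one of the two functions has finite support: both sides are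
    double sums over Z, matched by exchanging x and y and using hermitian symmetry. *)
Lemma laplacian_symmetric (F H Gf K : E) : F = f :> (V -> C) -> H = L Gf :> (V -> C) ->
  K = L f :> (V -> C) -> dot F H = dot K Gf.
Proof.
move=> eF eH eK; rewrite (dot_laplacian_supp eF eH).
rewrite (@dot_finsupp _ _ _ _ _ _ Z); last first.
  by move=> x xZ; rewrite eK laplacian_supp // conjc0 mul0r.
have -> : \sum_(x <- Z) (m x)%:C%C * (conjc (K x) * Gf x) =
   \sum_(x <- Z) \sum_(y <- Z) conjc ((w x y)%:C%C * (f x - ex x y * f y)) * Gf x.
  apply: eq_bigr => x _; rewrite -mulr_suml -rmorph_sum -laplacian_fsE eK mulrA.
  by rewrite -[RHS]/(conjc ((m x)%:C%C * L f x) * Gf x) conjcM conjcR.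
have e1 : \sum_(x <- Z) \sum_(y <- Z) conjc (f x) * ((w x y)%:C%C * (Gf x - ex x y * Gf y)) =
  \sum_(x <- Z) \sum_(y <- Z) (w x y)%:C%C * (conjc (f x) * Gf x) -
  \sum_(x <- Z) \sum_(y <- Z) (w x y)%:C%C * (ex x y * conjc (f x) * Gf y).
  rewrite -sumrB; apply: eq_bigr => x _; rewrite -sumrB; apply: eq_bigr => y _; ring.
have e2 : \sum_(x <- Z) \sum_(y <- Z) conjc ((w x y)%:C%C * (f x - ex x y * f y)) * Gf x =
  \sum_(x <- Z) \sum_(y <- Z) (w x y)%:C%C * (conjc (f x) * Gf x) -
  \sum_(x <- Z) \sum_(y <- Z) (w x y)%:C%C * (ex y x * conjc (f y) * Gf x).
  rewrite -sumrB; apply: eq_bigr => x _; rewrite -sumrB; apply: eq_bigr => y _.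
  rewrite conjcM conjcR (conjcD (f x)) (_ : conjc (- (ex x y * f y)) =
    - (conjc (ex x y) * conjc (f y))); last by rewrite -conjcM; exact: rmorphN.
  have hc := w_ex_sym x y.
  have -> : (w x y)%:C%C * (ex y x * conjc (f y) * Gf x) =
     ((w x y)%:C%C * ex y x) * (conjc (f y) * Gf x) by ring.
  rewrite -hc; ring.
rewrite e1 e2; congr (_ - _); rewrite exchange_big /=.
by apply: eq_bigr => x _; apply: eq_bigr => y _; rewrite (lfm_sym hG).
Qed.

Lemma laplacian_form (F K : E) : F = f :> (V -> C) -> K = L f :> (V -> C) ->
  rd F K = 2^-1 * \sum_(x <- Z) \sum_(y <- Z) w x y * sqnc (f x - ex x y * f y).
Proof.
move=> eF eK; rewrite /rd (dot_laplacian_supp eF eK).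
set S := \sum_(x <- Z) _.
(* The same sum with the roles of x and y exchanged; adding it to S completes the squared modulus,
   whence the factor 1/2. *)
have hS : S = \sum_(x <- Z) \sum_(y <- Z)
    - ((w x y)%:C%C * (conjc (ex x y * f y) * (f x - ex x y * f y))).
  rewrite /S exchange_big /=; apply: eq_bigr => x _; apply: eq_bigr => y _.
  rewrite (lfm_sym hG y x).
  have h1 := w_ex_sym x y.
  have h2 : (w x y)%:C%C * (conjc (ex x y) * ex x y) = (w x y)%:C%C.
    by rewrite mul_conjc sqnc_expi mulr1.
  have -> : conjc (f y) * ((w x y)%:C%C * (f y - ex y x * f x)) =
    (w x y)%:C%C * (conjc (f y) * f y) - ((w x y)%:C%C * ex y x) * (conjc (f y) * f x) by ring.
  rewrite -h1 -{1}h2 conjcM; ring.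
have : S + S = (\sum_(x <- Z) \sum_(y <- Z) w x y * sqnc (f x - ex x y * f y))%:C%C.
  rewrite {2}hS /S -big_split rmorph_sum; apply: eq_bigr => x _ /=.
  rewrite -big_split rmorph_sum; apply: eq_bigr => y _ /=.
  set z := ex x y * f y.
  have -> : (w x y * sqnc (f x - z))%:C%C = (w x y)%:C%C * (conjc (f x - z) * (f x - z)).
    by rewrite mul_conjc -rmorphM.
  by rewrite (conjcD (f x)) (_ : conjc (- z) = - conjc z); [ring|exact: rmorphN].
move=> /(congr1 (@complex.Re R)); rewrite ReD /= => <-; by field.
Qed.

Lemma laplacian_form_ge0 (F K : E) : F = f :> (V -> C) -> K = L f :> (V -> C) -> 0 <= rd F K.
Proof.
move=> eF eK; rewrite (laplacian_form eF eK) mulr_ge0 ?invr_ge0 //.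
by apply: sumr_ge0 => x _; apply: sumr_ge0 => y _; rewrite mulr_ge0 ?sqnc_ge0 ?(lfm_ge0 hG).
Qed.

(** By |a - b|^2 <= 2|a|^2 + 2|b|^2, and since both halves agree by symmetry of the weights, the
    form is at most (1/2) 4 M |F|^2. *)
Lemma laplacian_form_le (F K : E) (M : R) : F = f :> (V -> C) -> K = L f :> (V -> C) ->
  (forall x Y, \sum_(y <- Y) w x y <= M * m x) -> rd F K <= 2 * M * nsq F.
Proof.
move=> eF eK hM; rewrite (laplacian_form eF eK).
have hle : \sum_(x <- Z) \sum_(y <- Z) w x y * sqnc (f x - ex x y * f y) <=
    \sum_(x <- Z) \sum_(y <- Z) (2 * (w x y * sqnc (f x)) + 2 * (w x y * sqnc (f y))).
  apply: ler_sum => x _; apply: ler_sum => y _.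
  have := sqncD_le (f x) (- (ex x y * f y)); rewrite sqncN sqncM sqnc_expi mul1r.
  by move=> /(ler_wpM2l (lfm_ge0 hG x y)); lra.
have e : \sum_(x <- Z) \sum_(y <- Z) (2 * (w x y * sqnc (f x)) + 2 * (w x y * sqnc (f y))) =
    4 * \sum_(x <- Z) sqnc (f x) * \sum_(y <- Z) w x y.
  under eq_bigr do rewrite big_split /=.
  rewrite big_split /= [X in _ + X]exchange_big /= -big_split mulr_sumr.
  apply: eq_bigr => x _; rewrite /= -!mulr_sumr.
  have -> : \sum_(i <- Z) w i x * sqnc (f x) = \sum_(i <- Z) w x i * sqnc (f x).
    by apply: eq_bigr => y _; rewrite (lfm_sym hG).
  rewrite -mulr_suml; ring.
have hF : \sum_(x <- Z) sqnc (f x) * \sum_(y <- Z) w x y <= M * nsq F.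
  rewrite (@nsq_finsupp _ _ _ _ F Z); last first.
    move=> x xZ; rewrite eF; apply: fX; apply: contra xZ; exact: thicken_sub.
  rewrite mulr_sumr; apply: ler_sum => x _; rewrite /en eF.
  by have := ler_wpM2l (sqnc_ge0 (f x)) (hM x Z); lra.
by move: hle hF; rewrite e; lra.
Qed.

End FiniteSupport.
End WeightedGraph.

(** * Operators on functions as relations on the Hilbert space *)

Section LiftedRelations.
Context {R : realType} {V : countType}.
Local Notation C := R[i].
Variable m : V -> R.
Variable m_gt0 : forall x, 0 < m x.
Local Notation E := (l2h m_gt0).
Implicit Types (S H : E -> E -> Prop).

(** The bridge between operators, which are sets of pairs of plain functions, and relations between
    vectors of the Hilbert space, where inner products can be manipulated. *)
Definition lift_rel S : operator R V :=
  [set p | exists f g : E, [/\ S f g, p.1 = f :> (V -> C) & p.2 = g :> (V -> C)]].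

Lemma lift_relE S (f g : E) : lift_rel S (f : V -> C, g : V -> C) <-> S f g.
Proof.
split=> [[f' [g' [h /= e e']]]|h]; last by exists f, g.
suff [-> ->] : f = f' /\ g = g' by [].
by split; apply: l2_eqP => x; [rewrite e|rewrite e'].
Qed.

Lemma lift_rel_dom S (f : E) : dom (lift_rel S) f <-> exists g, S f g.
Proof.
split=> [[g [f' [g' [h /= e e']]]]|[g h]]; last by exists g, f, g.
by exists g'; suff -> : f = f' by []; apply: l2_eqP => x; rewrite e.
Qed.

Lemma lift_rel_l2 S p : lift_rel S p -> l2 m p.1 /\ l2 m p.2.
Proof. by move=> [f [g [_ -> ->]]]; split; exact: l2vP. Qed.

Lemma eq_lift_rel (B : operator R V) S : (forall p, B p -> l2 m p.1 /\ l2 m p.2) ->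
  (forall f g : E, B (f : V -> C, g : V -> C) <-> S f g) -> B = lift_rel S.
Proof.
move=> hl h; apply/seteqP; split=> [[f g] Bp|[f g] [f' [g' [Sfg /= -> ->]]]]; last exact/h.
have [/= /(mk_l2 m_gt0) [f' e] /(mk_l2 m_gt0) [g' e']] := hl _ Bp.
exists f', g'; split=> //; apply/h; rewrite e e'; exact: Bp.
Qed.

Lemma lift_rel_self_adjoint S :
  (forall f : E, exists u : nat -> E, (forall n, exists g, S (u n) g) /\ hcvg u f) ->
  (forall f g, S f g <-> (forall h k, S h k -> dot f k = dot g h)) ->
  self_adjoint m (lift_rel S).
Proof.
move=> hd hs; split.
  move=> f /(mk_l2 m_gt0) [f' <-]; have [u [hu uf]] := hd f'.
  exists (fun n => u n : V -> C); split.
    by move=> n; apply/lift_rel_dom; exact: hu.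
  exact/l2_cvgE.
apply: eq_lift_rel => [p [] //|f g]; rewrite hs; split.
  move=> [_ _ h] h' k Sh; have := h (h' : V -> C) (k : V -> C).
  rewrite !dotpE; apply; exact/lift_relE.
move=> h; split; try exact: l2vP.
move=> _ _ [h' [k [Shk /= -> ->]]]; exact: h.
Qed.

(** Applies to operators known only through their specification, such as the chosen square root and
    the spectral projections: equality with the adjoint is all that remains to be used of them. *)
Lemma self_adjoint_relP (B : operator R V) : self_adjoint m B ->
  exists S, B = lift_rel S /\ forall f g, S f g <-> (forall h k, S h k -> dot f k = dot g h).
Proof.
move=> [_ hB].
have Bl2 p : B p -> l2 m p.1 /\ l2 m p.2 by rewrite -hB => -[].
have e : B = lift_rel (fun f g : E => B (f : V -> C, g : V -> C)) by exact: eq_lift_rel.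
exists (fun f g : E => B (f : V -> C, g : V -> C)); split=> // f g; split=> h.
  move=> h' k Bhk; move: h; rewrite -hB => -[_ _ h]; exact: h Bhk.
rewrite -hB; split; try exact: l2vP.
move=> h' k Bhk; have [/= /(mk_l2 m_gt0) [h2 e1] /(mk_l2 m_gt0) [k2 e2]] := Bl2 _ Bhk.
by move: Bhk; rewrite -e1 -e2 => /h.
Qed.

Lemma nonneg_liftP S : nonneg_op m (lift_rel S) <-> forall f g, S f g -> 0 <= dot f g.
Proof.
split=> [h f g Sfg|h _ _ [f [g [Sfg /= -> ->]]]]; last exact: h.
by have := h (f : V -> C) (g : V -> C); rewrite dotpE; apply; exact/lift_relE.
Qed.

Lemma complex_ge0 (z : C) : 0 <= complex.Re z -> complex.Im z = 0 -> 0 <= z.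
Proof. by case: z => a b /= a0 ->; rewrite lecR. Qed.

Lemma op_comp_lift S : op_comp (lift_rel S) (lift_rel S) =
  lift_rel (fun f g => exists h, S f h /\ S h g).
Proof.
apply/seteqP; split=> [[f g] /= [h [[f1 [h1 [S1 /= -> eh]]] [h2 [g2 [S2 /= eh2 ->]]]]]|].
  exists f1, g2; split=> //; exists h1; split=> //.
  by have -> : h1 = h2 by apply: l2_eqP => x; rewrite -eh -eh2.
move=> [f g] [f' [g' [[h [h1 h2]] /= -> ->]]]; exists h; split; exact/lift_relE.
Qed.

(** An exhaustion of V by finite sets, read off from the encoding of a countable type into the
    integers. *)
Definition below (n : nat) : pred V := fun x => (choice.pickle x < n)%N.

Lemma below_exhausting : exhausting below.
Proof. by move=> x; exists (choice.pickle x).+1 => n. Qed.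

Lemma below_supp n : exists X : {fset V}, forall x, x \notin X -> below n x = false.
Proof.
exists (seq_fset tt (pmap (@choice.unpickle V) (iota 0 n))) => x.
rewrite seq_fsetE mem_pmap; apply: contraNF => xn.
by apply/mapP; exists (choice.pickle x); rewrite ?mem_iota // choice.pickleK.
Qed.

Lemma finsupp_dense (f : E) : exists u : nat -> E,
  (forall n, finsupp (u n)) /\ hcvg u f.
Proof.
exists (fun n => trunc (below n) f); split; last exact: trunc_cvg below_exhausting.
by move=> n; have [X hX] := below_supp n; exists X => x /hX; rewrite truncE => ->.
Qed.

End LiftedRelations.

Section SymmetricRelations.
Context {R : realType} {E : hilbert R}.
Local Notation C := R[i].
Implicit Types (f g h k : E).
Variable H : E -> E -> Prop.
Hypothesis HD : forall f g f' g', H f g -> H f' g' -> H (f + f') (g + g').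
Hypothesis HZ : forall a f g, H f g -> H (a *: f) (a *: g).
Hypothesis Hsym : forall f g f' g', H f g -> H f' g' -> dot f g' = dot g f'.
Hypothesis Hge0 : forall f g, H f g -> 0 <= rd f g.

Lemma rel_rd_sqr_le f g f' g' : H f g -> H f' g' -> rd f g' ^+ 2 <= rd f g * rd f' g'.
Proof.
move=> h h'; apply: sqr_le_of_quadratic_ge0 => t.
have := Hge0 (HD h (HZ t%:C%C h')).
rewrite rdDl !rdDr !rdZl !rdZr.
have -> : rd f' g = rd f g' by rewrite rdC /rd (Hsym h h').
by rewrite expr2; lra.
Qed.

Lemma rel_dot_sqr_le f g f' g' : H f g -> H f' g' ->
  sqnc (dot f g') <= rd f g * rd f' g'.
Proof.
move=> h h'; have [z0|z0] := eqVneq (sqnc (dot f g')) 0.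
  by rewrite z0 mulr_ge0 // Hge0.
have zp : 0 < sqnc (dot f g') by rewrite lt_neqAle eq_sym z0 sqnc_ge0.
have := rel_rd_sqr_le (HZ (dot f g') h) h'.
rewrite [rd (_ *: f) g']/rd dotZl mul_conjc /=.
have -> : rd (dot f g' *: f) (dot f g' *: g) = sqnc (dot f g') * rd f g.
  by rewrite /rd dotZl dotZr mulrA mul_conjc Re_mulr.
by rewrite expr2 -mulrA ler_pM2l.
Qed.

(** Positivity of the form at f - f' bounds the cross terms. *)
Lemma rel_form_add_le f g f' g' : H f g -> H f' g' ->
  rd (f + f') (g + g') <= 2 * rd f g + 2 * rd f' g'.
Proof.
move=> h h'; have := Hge0 (HD h (HZ (-1) h')).
rewrite !scaleN1r !rdDl !rdDr !rdNl !rdNr; lra.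
Qed.

End SymmetricRelations.

(** * The maximal Laplacian and its resolvent *)

Section MaximalLaplacian.
Context {R : realType} {V : countType}.
Local Notation C := R[i].
Variables (G : wgraph R V) (theta : V -> V -> R).
Hypothesis hG : locally_finite_magnetic G theta.
Local Notation m := (meas G).
Variable m_gt0 : forall x, 0 < meas G x.
Local Notation E := (l2h m_gt0).
Local Notation L := (formal_laplacian G theta).
Implicit Types (f g h k : E).

(* The maximal operator {(f, L f) | f, L f in l^2}. It is determined by testing
   against the L delta_x (Hmax_of_delta), hence closed. *)
Definition Hmax f g : Prop := g = L f :> (V -> C).

Lemma laplacian_finsupp_ex f : finsupp f ->
  exists g, Hmax f g.
Proof.
move=> [X fX]; have [g hg] := mk_l2 m_gt0 (l2_finite m_gt0 (laplacian_supp hG fX)).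
by exists g.
Qed.

Lemma delta_finsupp x : finsupp (delta m_gt0 x).
Proof. by exists [fset x]%fset => y; exact: delta_supp. Qed.

Lemma Ldelta_ex x : exists g, Hmax (delta m_gt0 x) g.
Proof. by apply: laplacian_finsupp_ex; exact: delta_finsupp. Qed.

Lemma Hmax_symmetric_fs f g f' g' : finsupp f ->
  Hmax f g -> Hmax f' g' -> dot f g' = dot g f'.
Proof. by move=> [X fX] h h'; exact: (laplacian_symmetric hG fX erefl h' h). Qed.

(** By local finiteness both sides only see f near x, so f may be truncated to a finite
    neighbourhood, where Green's formula applies. Pointwise statements on L f thus become inner
    products, which are continuous in f. *)
Lemma dot_Ldelta x (d f : E) : Hmax (delta m_gt0 x) d -> dot d f = (m x)%:C%C * L f x.
Proof.
move=> hd; have [X dX] := delta_finsupp x.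
pose Z := thicken G [fset x]%fset.
pose f' := trunc (mem Z) f.
have xZ : x \in Z by apply: thicken_sub; rewrite inE.
have -> : L f x = L f' x.
  apply: (eq_laplacian_near hG); first by rewrite truncE /= xZ.
  move=> y a; rewrite truncE /= (thicken_nb hG (x := x)) //.
  by rewrite inE.
have -> : dot d f = dot d f'.
  suff e : trunc (mem Z) d = d by rewrite /f' -(trunc_symmetric (mem Z) d f) e.
  apply: l2_eqP => y; rewrite truncE /=; case: ifPn => // yZ.
  rewrite hd (@laplacian_supp _ _ _ _ hG _ [fset x]%fset _ y yZ) // => z.
  exact: delta_supp.
have f'Z y : y \notin Z -> f' y = 0 by rewrite truncE => /negPf /= ->.
have [g hg] := laplacian_finsupp_ex (ex_intro _ Z f'Z).
rewrite -(Hmax_symmetric_fs (delta_finsupp x) hd hg) dot_delta.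
by rewrite [g x](congr1 (fun h : V -> C => h x) hg).
Qed.

Lemma Hmax_of_delta f g : (forall x d, Hmax (delta m_gt0 x) d -> dot d f = dot (delta m_gt0 x) g) ->
  Hmax f g.
Proof.
move=> h; apply/funext => x; have [d hd] := Ldelta_ex x.
have := h x d hd; rewrite (dot_Ldelta _ hd) dot_delta => /(mulfI _) -> //.
by rewrite eq_complex /= gt_eqF.
Qed.

Lemma Hmax0 : Hmax 0 0.
Proof.
apply: Hmax_of_delta => x d _; by rewrite !dot0r.
Qed.

Lemma HmaxD f g f' g' : Hmax f g -> Hmax f' g' -> Hmax (f + f') (g + g').
Proof.
move=> h h'; apply: Hmax_of_delta => x d hd; rewrite !dotDr !(dot_Ldelta _ hd) !dot_delta.
by rewrite h h'.
Qed.

Lemma HmaxZ a f g : Hmax f g -> Hmax (a *: f) (a *: g).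
Proof.
move=> h; apply: Hmax_of_delta => x d hd; rewrite !dotZr !(dot_Ldelta _ hd) !dot_delta.
by rewrite h.
Qed.

Lemma HmaxB f g f' g' : Hmax f g -> Hmax f' g' -> Hmax (f - f') (g - g').
Proof. by move=> h h'; rewrite -(scaleN1r f') -(scaleN1r g'); exact: (HmaxD h (HmaxZ _ h')). Qed.

Lemma Hmax_closed u v f g : (forall n, Hmax (u n) (v n)) ->
  hcvg u f -> hcvg v g -> Hmax f g.
Proof.
move=> h hu hv; apply: Hmax_of_delta => x d hd.
apply: (hcvg_dot_eq (hcvg_cst d) hu (hcvg_cst (delta m_gt0 x)) hv) => n.
by rewrite (dot_Ldelta _ hd) dot_delta (h n).
Qed.

(** Approximation in graph norm by finitely supported functions. Green's formula and positivity,
    known for these, then extend to the whole maximal operator. *)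
Definition has_core := forall f g, Hmax f g -> exists u v : nat -> E,
  [/\ forall n, finsupp (u n),
      forall n, Hmax (u n) (v n), hcvg u f & hcvg v g].

Hypothesis core : has_core.

Lemma Hmax_symmetric f g f' g' : Hmax f g -> Hmax f' g' -> dot f g' = dot g f'.
Proof.
move=> h h'; have [u [v [ufs uv hu hv]]] := core h.
apply: (hcvg_dot_eq hu (hcvg_cst g') hv (hcvg_cst f')) => n.
exact: Hmax_symmetric_fs.
Qed.

Lemma Hmax_ge0 f g : Hmax f g -> 0 <= rd f g.
Proof.
move=> h; have [u [v [ufs uv hu hv]]] := core h.
apply: (ler_cvg_to (cvg_cst 0) (hcvg_rd hu hv)); apply: nearW => n.
have [X fX] := ufs n.
exact: (laplacian_form_ge0 hG fX erefl (uv n)).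
Qed.

(** A vector k orthogonal to the range of 1 + H satisfies L k = -k, as the functions delta_x show;
    it is then in the maximal domain and positivity gives k = 0. So 1 + H is onto, and T is its
    inverse. *)
Lemma Hmax_resolvent : exists T : E -> E,
  [/\ symmetric_op T, forall f, nsq (T f) <= rd f (T f), forall f, T f = 0 -> f = 0 &
      forall f g, Hmax f g <-> f = T (f + g)].
Proof.
have orth k : (forall f g, Hmax f g -> dot k (f + g) = 0) -> k = 0.
  move=> h; have hk : Hmax k (- k).
    apply: Hmax_of_delta => x d hd.
    have := h _ _ hd; rewrite dotDr => /eqP; rewrite addrC addr_eq0 => /eqP e.
    by rewrite dotC e -dotNr -dotC dotNl dotNr.
  have := Hmax_ge0 hk; rewrite rdNr oppr_ge0 => hle.
  by apply: nsq_eq0; apply/eqP; rewrite eq_le hle nsq_ge0.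
have /choice [T hT] : forall k, exists f, Hmax f (k - f).
  move=> k; have [f [g [h e]]] := resolvent_onto Hmax0 HmaxD HmaxZ Hmax_closed Hmax_ge0 orth k.
  by exists f; rewrite -e addrAC subrr add0r.
have Tuniq f g : Hmax f g -> f = T (f + g).
  move=> h; apply/subr0_eq/nsq_eq0/eqP; rewrite eq_le nsq_ge0 andbT.
  have := Hmax_ge0 (HmaxB h (hT (f + g))).
  have -> : g - (f + g - T (f + g)) = - (f - T (f + g)).
    by rewrite opprB addrA [g + _]addrC opprD addrACA subrr addr0 opprB.
  by rewrite rdNr oppr_ge0.
exists T; split.
- move=> f g.
  have e k : k = T k + (k - T k) by rewrite addrC subrK.
  rewrite [in LHS](e g) [in RHS](e f) dotDr dotDl; congr (_ + _).
  exact: Hmax_symmetric.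
- move=> f; have := Hmax_ge0 (hT f); rewrite rdBr -/(nsq _) (rdC f).
  by rewrite subr_ge0.
- move=> f h; have := hT f; rewrite h subr0 => h'.
  by apply: l2_eqP => x; exact: (congr1 (fun k : V -> C => k x) (etrans h' (esym Hmax0))).
- move=> f g; split; first exact: Tuniq.
  by move=> e; have := hT (f + g); rewrite -e [f + g]addrC addrK.
Qed.

End MaximalLaplacian.

Arguments Hmax {R V} G theta {m_gt0} f g.
Arguments has_core {R V} G theta m_gt0.

Section ComplexModulus.
Context {R : realType}.
Local Notation normc := (@Normc.normc R).

Lemma normc_ge0 z : 0 <= normc z.
Proof. by rewrite normcE sqrtr_ge0. Qed.

Lemma Re_le_normc z : complex.Re z <= normc z.
Proof.
rewrite normcE (le_trans (ler_norm _)) // -sqrtr_sqr ler_wsqrtr //.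
by rewrite /sqnc lerDl sqr_ge0.
Qed.

Lemma normc_le_sqr z (r : R) : 0 <= r -> sqnc z <= r ^+ 2 -> normc z <= r.
Proof.
by move=> r0 h; rewrite normcE -(ger0_norm r0) -sqrtr_sqr ler_wsqrtr.
Qed.

Lemma normcD_le z w : normc (z + w) <= normc z + normc w.
Proof.
apply: normc_le_sqr; first by rewrite addr_ge0 // normc_ge0.
have h : complex.Re z * complex.Re w + complex.Im z * complex.Im w <= normc z * normc w.
  have [h0|h0] := leP (complex.Re z * complex.Re w + complex.Im z * complex.Im w) 0.
    by apply: le_trans h0 _; rewrite mulr_ge0 // normc_ge0.
  rewrite -ler_sqr ?nnegrE; [|exact: ltW|by rewrite mulr_ge0 // normc_ge0].
  rewrite exprMn !normc_sqr; case: z w {h0} => a b [c d]; rewrite /sqnc /=.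
  by have := sqr_ge0 (a * d - b * c); nra.
rewrite sqrrD !normc_sqr; move: h; case: z w => a b [c d]; rewrite /sqnc /=; lra.
Qed.

Lemma normc_dist_le z w : `|normc z - normc w| <= normc (z - w).
Proof.
rewrite ler_norml; apply/andP; split.
  have := normcD_le z (w - z); rewrite addrC subrK -(opprB z w).
  by rewrite [normc (- _)]normcE sqncN -normcE; lra.
by have := normcD_le (z - w) w; rewrite subrK; lra.
Qed.

End ComplexModulus.

(** * Convergence of forms along form-Cauchy sequences *)

Section FormConvergence.
Context {R : realType} {E : hilbert R}.
Local Notation C := R[i].
Implicit Types (f g h k : E) (U A W B : nat -> E).
Variable H : E -> E -> Prop.
Hypothesis HD : forall f g f' g', H f g -> H f' g' -> H (f + f') (g + g').
Hypothesis HZ : forall a f g, H f g -> H (a *: f) (a *: g).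
Hypothesis Hsym : forall f g f' g', H f g -> H f' g' -> dot f g' = dot g f'.
Hypothesis Hge0 : forall f g, H f g -> 0 <= rd f g.

Definition form_cauchy U A := forall e : R, 0 < e -> exists N : nat, forall i j,
  (N <= i)%N -> (N <= j)%N -> Normc.normc (dot (U i - U j) (A i - A j)) < e.

Lemma form_cauchy_of_cvg U A f g : hcvg U f -> hcvg A g -> form_cauchy U A.
Proof.
move=> /hcvgP hU /hcvgP hA e e0.
have s0 : 0 < Num.sqrt e / 2 by rewrite divr_gt0 // sqrtr_gt0.
have [N hN] := hU _ s0; have [N' hN'] := hA _ s0.
exists (maxn N N') => i j; rewrite !geq_max => /andP[Ni N'i] /andP[Nj N'j].
apply: le_lt_trans (normc_dot_le _ _) _.
have h1 : nrm (U i - U j) < Num.sqrt e.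
  apply: le_lt_trans (nrm_dist _ f _) _; rewrite (nrmBC f).
  by have := hN _ Ni; have := hN _ Nj; lra.
have h2 : nrm (A i - A j) < Num.sqrt e.
  apply: le_lt_trans (nrm_dist _ g _) _; rewrite (nrmBC g).
  by have := hN' _ N'i; have := hN' _ N'j; lra.
by rewrite -(sqr_sqrtr (ltW e0)) expr2 ltr_pM ?nrm_ge0.
Qed.

Lemma form_cauchy_bounded U A : (forall n, H (U n) (A n)) -> form_cauchy U A ->
  exists (N : nat) (M : R), 0 < M /\ forall n, (N <= n)%N -> rd (U n) (A n) <= M.
Proof.
move=> hH hc; have [N hN] := hc 1 ltr01.
have HBn i j : H (U i - U j) (A i - A j).
  by rewrite -(scaleN1r (U j)) -(scaleN1r (A j)); exact: (HD (hH i) (HZ _ (hH j))).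
exists N, (2 + 2 * rd (U N) (A N)); split.
  by have := Hge0 (hH N); lra.
move=> n Nn.
have := rel_form_add_le HD HZ Hge0 (HBn n N) (hH N); rewrite !subrK.
have := hN n N Nn (leqnn N); have := Re_le_normc (dot (U n - U N) (A n - A N)).
rewrite -/(rd (U n - U N) (A n - A N)); lra.
Qed.

(** The images A_n need not converge. Split the difference as <W_n - W_K, A_n> + <W_K, A_n - g> +
    <W_K - h, g>. The first term is small by Cauchy-Schwarz for the form, the second equals <B_K,
    U_n - f> by symmetry, the third is norm convergence. *)
Lemma form_cvg U A W B f g h : (forall n, H (U n) (A n)) -> (forall n, H (W n) (B n)) ->
  form_cauchy U A -> form_cauchy W B -> hcvg U f -> hcvg W h -> H f g ->
  Normc.normc (dot (W n) (A n) - dot h g) @[n --> \oo] --> (0 : R).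
Proof.
move=> hU hW cU cW /hcvgP lU /hcvgP lW hf; apply/cvgrPdist_lt => e e0.
have [N0 [M [M0 hM]]] := form_cauchy_bounded hU cU.
have e3 : 0 < e / 3 by rewrite divr_gt0.
pose d := (e / 3) ^+ 2 / M; have d0 : 0 < d by rewrite divr_gt0 // exprn_gt0.
have [N1 hN1] := cW _ d0.
have g0 : 0 < nrm g + 1 by rewrite ltr_wpDl ?nrm_ge0.
have [N2 hN2] := lW _ (divr_gt0 e3 g0).
(* K is fixed before n, because the closeness required of U_n to f depends on the norm of B_K. *)
pose K := maxn N1 N2.
have b0 : 0 < nrm (B K) + 1 by rewrite ltr_wpDl ?nrm_ge0.
have [N3 hN3] := lU _ (divr_gt0 e3 b0).
exists (maxn (maxn N0 N1) N3) => // n.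
rewrite /= !geq_max => /andP[/andP[n0 n1] n3].
rewrite sub0r normrN (ger0_norm (normc_ge0 _)).
have HBn : H (W n - W K) (B n - B K).
  by rewrite -(scaleN1r (W K)) -(scaleN1r (B K)); exact: (HD (hW n) (HZ _ (hW K))).
have t1 : Normc.normc (dot (W n - W K) (A n)) <= e / 3.
  apply: normc_le_sqr; first exact: ltW.
  apply: le_trans (rel_dot_sqr_le HD HZ Hsym Hge0 HBn (hU n)) _.
  have -> : (e / 3) ^+ 2 = d * M by rewrite /d; field; rewrite gt_eqF.
  apply: ler_pM; [exact: Hge0 HBn|exact: Hge0 (hU n)| |exact: hM].
  apply: le_trans (Re_le_normc _) _; apply: ltW; apply: hN1 => //.
  exact: leq_maxl.
have t2 : Normc.normc (dot (W K) (A n - g)) < e / 3.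
  have -> : dot (W K) (A n - g) = dot (B K) (U n - f).
    by rewrite dotBr (Hsym (hW K) (hU n)) (Hsym (hW K) hf) -dotBr.
  apply: le_lt_trans (normc_dot_le _ _) _.
  have := hN3 n n3; rewrite ltr_pdivlMr // => h3; apply: le_lt_trans h3.
  by rewrite mulrC ler_wpM2l ?nrm_ge0 // lerDl.
have t3 : Normc.normc (dot (W K - h) g) < e / 3.
  apply: le_lt_trans (normc_dot_le _ _) _.
  have := hN2 K (leq_maxr _ _); rewrite ltr_pdivlMr // => h3; apply: le_lt_trans h3.
  by rewrite ler_wpM2l ?nrm_ge0 // lerDl.
have -> : dot (W n) (A n) - dot h g =
    dot (W n - W K) (A n) + (dot (W K) (A n - g) + dot (W K - h) g).
  by rewrite !dotBl !dotBr; ring.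
apply: le_lt_trans (normcD_le _ _) _.
have := normcD_le (dot (W K) (A n - g)) (dot (W K - h) g).
by move: t1 t2 t3; lra.
Qed.

End FormConvergence.

(** * The Friedrichs extension and its square root *)

Section Friedrichs.
Context {R : realType} {V : countType}.
Local Notation C := R[i].
Variables (G : wgraph R V) (theta : V -> V -> R).
Hypothesis hG : locally_finite_magnetic G theta.
Local Notation m := (meas G).
Variable m_gt0 : forall x, 0 < meas G x.
Local Notation E := (l2h m_gt0).
Local Notation L := (formal_laplacian G theta).
Local Notation H := (@Hmax _ _ G theta m_gt0).
Hypothesis core : has_core G theta m_gt0.
Implicit Types (f g h k : E).

Lemma finitely_supportedP (f : V -> C) : finitely_supported f <-> finsupp f.
Proof.
split=> [h|[X hX]].
  exists (fset_set [set x | f x != 0]) => x; rewrite in_fset_set //.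
  by rewrite notin_setE /= => /negP; rewrite negbK => /eqP.
apply: (@sub_finite_set _ _ [set` X]); last exact: finite_fset.
by move=> x /= fx; apply: contraNT fx => /hX ->.
Qed.

Lemma laplacian_ccP (p : (V -> C) * (V -> C)) : laplacian_cc G theta p ->
  exists F K : E, [/\ p.1 = F :> (V -> C), p.2 = K :> (V -> C), finsupp F & H F K].
Proof.
case: p => f g [/= /finitely_supportedP hf ->].
have [X fX] := hf.
have [F eF] := mk_l2 m_gt0 (l2_finite m_gt0 fX).
have [K eK] := mk_l2 m_gt0 (l2_finite m_gt0 (laplacian_supp hG fX)).
exists F, K; split=> //; first by rewrite eF.
by rewrite /Hmax eK eF.
Qed.

Lemma form_approxP u a (f : E) : form_approx m (laplacian_cc G theta) u a f ->
  exists U A : nat -> E, [/\ u = (fun n => U n : V -> C), a = (fun n => A n : V -> C),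
    forall n, finsupp (U n) /\ H (U n) (A n), hcvg U f & form_cauchy U A].
Proof.
move=> [hA hu hc].
have /choice [U /choice [A hUA]] : forall n, exists F K : E,
    [/\ u n = F :> (V -> C), a n = K :> (V -> C), finsupp F & H F K].
  by move=> n; have := laplacian_ccP (hA n).
have eu : u = (fun n => U n : V -> C) by apply/funext => n; have [] := hUA n.
have ea : a = (fun n => A n : V -> C) by apply/funext => n; have [] := hUA n.
exists U, A; split=> //.
- by move=> n; have [] := hUA n.
- by apply/l2_cvgE; rewrite eu in hu.
- move=> e e0; have [N hN] := hc e e0; exists N => i j Ni Nj.
  by have := hN i j Ni Nj; rewrite eu ea.
Qed.

Lemma form_approx_mk (U A : nat -> E) f : (forall n, finsupp (U n)) ->
  (forall n, H (U n) (A n)) -> hcvg U f -> form_cauchy U A ->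
  form_approx m (laplacian_cc G theta) (fun n => U n : V -> C) (fun n => A n : V -> C) f.
Proof.
move=> fsU hU lU cU; split.
- by move=> n; split; [apply/finitely_supportedP; exact: fsU|exact: hU].
- exact/l2_cvgE.
- move=> e e0; have [N hN] := cU e e0; exists N => i j Ni Nj.
  exact: hN.
Qed.

(** An element of the Friedrichs extension, tested against the constant sequence delta_x, satisfies
    the pointwise equation. Conversely the core gives approximations converging in graph norm, which
    are form-Cauchy, and [form_cvg] identifies the limit for every other choice of sequences. *)
Lemma magnetic_laplacian_max : magnetic_laplacian G theta = lift_rel (H : E -> E -> Prop).
Proof.
apply: eq_lift_rel => [p [] //|f g]; split.
- move=> [_ _ /= [u [a ua]] hq].
  have [U [A [eu ea hU lU cU]]] := form_approxP ua.
  apply: (Hmax_of_delta hG) => x d hd.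
  have := hq (delta m_gt0 x) (fun _ => delta m_gt0 x : V -> C) (fun _ => d : V -> C) u a.
  move=> /(_ (l2vP _) _ ua) hlim.
  have {}hlim : Normc.normc (dot (delta m_gt0 x) (A n) - dot (delta m_gt0 x) g)
      @[n --> \oo] --> (0 : R).
    rewrite ea in hlim; apply: hlim.
    apply: (@form_approx_mk (fun=> delta m_gt0 x) (fun=> d)) => [_|_||].
    - exact: delta_finsupp.
    - exact: hd.
    - exact: hcvg_cst.
    - exact: (form_cauchy_of_cvg (hcvg_cst _) (hcvg_cst _)).
  have hlim2 : Normc.normc (dot (delta m_gt0 x) (A n) - dot (delta m_gt0 x) g)
      @[n --> \oo] --> Normc.normc (dot d f - dot (delta m_gt0 x) g).
    have -> : (fun n => Normc.normc (dot (delta m_gt0 x) (A n) - dot (delta m_gt0 x) g)) =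
       (fun n => Normc.normc (dot d (U n) - dot (delta m_gt0 x) g)).
      apply/funext => n; rewrite (dot_Ldelta hG (U n) hd) dot_delta.
      by rewrite [A n x](congr1 (fun h : V -> C => h x) (hU n).2).
    apply/cvgrPdist_lt => e e0.
    have d1 : 0 < nrm d + 1 by rewrite ltr_wpDl ?nrm_ge0.
    have /hcvgP /(_ _ (divr_gt0 e0 d1)) [N hN] := lU.
    exists N => // n Nn; apply: le_lt_trans (normc_dist_le _ _) _.
    have -> : dot d f - dot (delta m_gt0 x) g - (dot d (U n) - dot (delta m_gt0 x) g) =
        dot d (f - U n) by rewrite dotBr; ring.
    apply: le_lt_trans (normc_dot_le _ _) _; rewrite nrmBC.
    have := hN n Nn; rewrite ltr_pdivlMr // => hlt; apply: le_lt_trans hlt.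
    by rewrite mulrC ler_wpM2l ?nrm_ge0 // lerDl.
  have e0 : 0 = Normc.normc (dot d f - dot (delta m_gt0 x) g).
    by apply: cvg_unique hlim hlim2.
  have /sqnc_eq0 : sqnc (dot d f - dot (delta m_gt0 x) g) = 0.
    by rewrite -normc_sqr -e0 expr0n.
  exact: subr0_eq.
- move=> hfg; have [u [v [fsu huv lu lv]]] := core hfg; split; try exact: l2vP.
    exists (fun n => u n : V -> C), (fun n => v n : V -> C).
    exact: (form_approx_mk fsu huv lu (form_cauchy_of_cvg lu lv)).
  move=> h0 W0 B0 u0 a0 /(mk_l2 m_gt0) [h <-] /form_approxP [W [B [-> _ hW lW cW]]].
  move=> /form_approxP [U [A [_ -> hU lU cU]]].
  exact: (form_cvg (@HmaxD _ _ _ _ hG m_gt0) (@HmaxZ _ _ _ _ hG m_gt0)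
    (Hmax_symmetric hG core) (Hmax_ge0 hG core) (fun n => (hU n).2) (fun n => (hW n).2) cU cW lU lW hfg).
Qed.

Lemma laplacian_sqrt_ex : exists S, is_sqrt_op m (magnetic_laplacian G theta) S.
Proof.
have [T [Tsym Tpos Tinj hT]] := Hmax_resolvent hG core.
have [S [Sadj Sge0 SS]] := sqrt_resolvent_ex Tsym Tpos.
exists (lift_rel S); split.
- apply: lift_rel_self_adjoint => // f; have [u [fsu lu]] := finsupp_dense f.
  exists u; split=> // n; have [g hg] := laplacian_finsupp_ex hG (fsu n).
  by have [k [Sk _]] := (SS (u n) g).2 ((hT _ _).1 hg); exists k.
- apply/nonneg_liftP => f g Sfg; apply: complex_ge0; first exact: Sge0.
  have := (Sadj f g).1 Sfg f g Sfg => /(congr1 (@complex.Im R)).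
  by rewrite (dotC f g) Im_conjc; lra.
- rewrite op_comp_lift magnetic_laplacian_max; congr lift_rel.
  apply/funext => f; apply/funext => g; apply/propext.
  by rewrite SS; symmetry; exact: hT.
Qed.

Lemma laplacian_sqrtP : is_sqrt_op m (magnetic_laplacian G theta)
  (sqrt_op m (magnetic_laplacian G theta)).
Proof. exact: (getPex laplacian_sqrt_ex). Qed.

End Friedrichs.

(** * Spectral measures and eigenvalue counting *)

Section Diagonalization.
Context {R : realType} {E : hilbert R}.
Local Notation C := R[i].
Implicit Types (f g h k : E).

(** The last clause makes H the diagonal operator on its full maximal domain; divergence of the
    eigenvalues makes all multiplicities finite. *)
Definition eigenbasis (e : nat -> E) (lam : nat -> R) (H : E -> E -> Prop) : Prop :=
  [/\ forall i j, dot (e i) (e j) = (i == j)%:R,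
      forall f, (forall n, dot (e n) f = 0) -> f = 0,
      (forall n, 0 <= lam n) /\ {homo lam : i j / (i <= j)%N >-> i <= j},
      forall M : R, exists N : nat, forall n, (N <= n)%N -> M < lam n &
      forall f g, H f g <-> diag_op e lam f g].

Lemma compact_resolvent_eigenbasis (T : E -> E) (H : E -> E -> Prop) :
  symmetric_op T -> (forall f, nsq (T f) <= rd f (T f)) -> (forall f, T f = 0 -> f = 0) ->
  (forall u : nat -> E, (exists c, forall n, nrm (u n) <= c) ->
    exists (s : nat -> nat) f, {homo s : i j / (i < j)%N} /\ hcvg (T \o (u \o s)) f) ->
  (forall l : seq E, exists2 f, f <> 0 & forall x, x \in l -> dot x f = 0) ->
  (forall f g, H f g <-> f = T (f + g)) ->
  exists e lam, eigenbasis e lam H.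
Proof.
move=> Tsym Tpos Tinj Tcomp Einf hT.
have [e [s [eon eT sdec slim ecomp]]] := compact_eigenbasis Tsym Tpos Tinj Tcomp Einf.
have s0 n : 0 < s n by have [_ /andP[]] := eT n.
have s1 n : s n <= 1 by have [_ /andP[]] := eT n.
(* Since T = (1 + H)^-1, an eigenvalue s of T is the eigenvalue 1/s - 1 of H. *)
exists e, (fun n => (s n)^-1 - 1); split=> //.
- split=> [n|]; first by rewrite subr_ge0 invf_ge1.
  by apply/nondecreasing_seqP => n; rewrite lerD2r lef_pV2 ?posrE.
- move=> M; have M0 : 0 < `|M| + 1 by rewrite ltr_wpDl.
  have M1 : 0 < (`|M| + 1)^-1 by rewrite invr_gt0.
  have /cvgrPdist_lt /(_ _ M1) [N _ hN] := slim; exists N => n Nn.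
  have := hN n Nn; rewrite /= sub0r normrN gtr0_norm // => hn.
  rewrite ltrBrDr; apply: le_lt_trans (_ : `|M| + 1 < _); first by rewrite lerD2r ler_norm.
  by rewrite -[ltLHS]invrK ltf_pV2 ?posrE.
- move=> f g; rewrite hT /diag_op.
  have coefT k n : dot (e n) (T k) = (s n)%:C%C * dot (e n) k.
    by rewrite -Tsym (eT n).1 dotZl conjcR.
  have key n : (dot (e n) f = (s n)%:C%C * (dot (e n) f + dot (e n) g)) <->
      dot (e n) g = ((s n)^-1 - 1)%:C%C * dot (e n) f.
    have sn : (s n)%:C%C != 0 :> C by rewrite eq_complex /= gt_eqF.
    have -> : ((s n)^-1 - 1)%:C%C = ((s n)%:C%C)^-1 - 1 :> C.
      by rewrite rmorphB rmorph1 /= fmorphV.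
    move: (dot (e n) f) (dot (e n) g) ((s n)%:C%C) sn => a b t tn; split=> h.
      have h2 : t * b = a - t * a by rewrite {1}h; ring.
      by apply: (mulfI tn); rewrite h2; field.
    by rewrite h; field.
  split=> [h n|h].
    by apply/key; rewrite -dotDr -coefT -h.
  by apply: (eq_coef ecomp) => n; rewrite coefT dotDr; apply/key.
Qed.

End Diagonalization.

(** The dimension count behind the bounds below: more vectors than linear conditions leave a
    nontrivial combination satisfying all the conditions. *)
Lemma exists_left_kernel (F : fieldType) (n k : nat) (M : 'M[F]_(n, k)) : (k < n)%N ->
  exists2 c : 'I_n -> F, (exists i, c i != 0) & forall j, \sum_i c i * M i j = 0.
Proof.
move=> kn.
have : kermx M != 0.
  by rewrite -mxrank_eq0 mxrank_ker subn_eq0 -ltnNge (leq_ltn_trans (rank_leq_col M)).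
move=> /rowV0Pn [v /sub_kermxP vM v0].
have /rV0Pn [i vi] := v0.
exists (v 0); first by exists i.
by move=> j; have := congr1 (fun A : 'rV[F]_k => A 0 j) vM; rewrite !mxE.
Qed.

Section DiagSymmetric.
Context {R : realType} {E : hilbert R}.
Variables (e : nat -> E) (lam : nat -> R).
Hypothesis eon : forall i j, dot (e i) (e j) = (i == j)%:R.
Hypothesis ecomp : forall f, (forall n, dot (e n) f = 0) -> f = 0.

Lemma diag_symmetric (f g f' g' : E) : diag_op e lam f g -> diag_op e lam f' g' ->
  dot f g' = dot g f'.
Proof.
move=> h h'; apply: (hcvg_dot_eq (expansion eon ecomp f) (hcvg_cst g')
  (expansion eon ecomp g) (hcvg_cst f')) => N.
rewrite !dot_ps; apply: eq_bigr => i _.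
by rewrite h h' conjcM conjcR mulrCA mulrA.
Qed.

End DiagSymmetric.

Section SpectralExistence.
Context {R : realType} {V : countType}.
Local Notation C := R[i].
Variable m : V -> R.
Variable m_gt0 : forall x, 0 < m x.
Local Notation E := (l2h m_gt0).
Variables (e : nat -> E) (lam : nat -> R) (H : E -> E -> Prop).
Hypothesis he : eigenbasis e lam H.
Implicit Types (f g h k : E).

(** The projection for A keeps the coefficients whose eigenvalue lies in A. Existence is what makes
    the choice in [spectral_proj] satisfy its specification. *)
Lemma spectral_measure_ex : exists Es, is_spectral_measure m (lift_rel H) Es.
Proof.
have [eon ecomp [lam0 lamh] _ hH] := he.
have [P hP] := spectral_projections_ex eon lam.
have Psym := P_symmetric eon ecomp hP.
exists (fun A => lift_rel (fun f g => g = P A f)); split.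
- move=> A _; split.
  + apply: lift_rel_self_adjoint => [f|f g].
      by exists (fun=> f); split; [move=> n; exists (P A f)|exact: hcvg_cst].
    split=> [-> h _ ->|h]; first by rewrite (Psym A).
    by apply: dot_inj => k; rewrite -Psym [LHS]dotC -(h _ _ erefl) -dotC.
  + apply/seteqP; split=> f /=.
      by move=> [g] /lift_rel_l2 [].
    by move=> /(mk_l2 m_gt0) [f' <-]; apply/lift_rel_dom; exists (P A f').
  + rewrite op_comp_lift; congr lift_rel; apply/funext => f; apply/funext => g.
    apply/propext; split=> [[_ [-> ->]]|->]; first by rewrite (P_idem ecomp hP).
    by exists (P A f); rewrite (P_idem ecomp hP).
- apply/seteqP; split=> [[f g] [f' [g' [-> /= -> ->]]]|[f g] [/= hf ->]].
    by rewrite (P_setT ecomp hP); split=> //; exact: l2vP.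
  have [f' e'] := mk_l2 m_gt0 hf.
  by exists f', f'; rewrite (P_setT ecomp hP) /= e'.
- move=> f /(mk_l2 m_gt0) [f' <-].
  exists (spectral_mu e lam f'); split.
  + move=> A g mA [f2 [g2 [-> /= ef ->]]].
    have <- : f' = f2 by apply: l2_eqP => x; rewrite ef.
    by rewrite (spectral_muE eon ecomp hP).
  + apply: (iff_trans (lift_rel_dom _ _)); apply: iff_trans (dom_diag_op eon ecomp _ _).
    by split=> -[g /hH hg]; exists g.
  + move=> g [f2 [g2 [/hH hd /= ef ->]]].
    have e2 : f' = f2 by apply: l2_eqP => x; rewrite ef.
    rewrite -e2 in hd *; rewrite (integral_id_diag eon ecomp lam0 hd) /=.
    apply: complexP => //; rewrite dotpE.
    have := diag_symmetric eon ecomp hd hd => /(congr1 (@complex.Im R)).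
    by rewrite (dotC f' g2) Im_conjc /=; lra.
Qed.

Lemma lin_free_ell2 n (b : 'I_n -> E) : lin_free (fun i => b i : V -> C) <->
  forall c : 'I_n -> C, \sum_(i < n) c i *: b i = 0 -> forall i, c i = 0.
Proof.
split=> h c hc; apply: h.
  by move=> x; rewrite -[RHS](congr1 (fun f : E => f x) hc) l2h_sum.
by apply: l2_eqP => x; rewrite l2h_sum -[RHS](hc x).
Qed.

Lemma dim_ge_free (W : set (V -> C)) n (b : 'I_n -> V -> C) : (forall i, W (b i)) ->
  lin_free b -> (n%:R%:E <= dim W :> \bar R)%E.
Proof. by move=> hW hb; apply: ereal_sup_ubound; exists n => //; exists b. Qed.

(** The hypothesis says that N coefficients separate the combinations of vectors of W. More than N
    free vectors would have a nontrivial combination on which all these coefficients vanish. *)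
Lemma dim_le_coef (W : set (V -> C)) (N : nat) (J : 'I_N -> nat) :
  (forall f : V -> C, W f -> exists F : E, F = f :> (V -> C)) ->
  (forall n (b : 'I_n -> E) (c : 'I_n -> C), (forall i, W (b i : V -> C)) ->
    (forall j, dot (e (J j)) (\sum_(i < n) c i *: b i) = 0) -> \sum_(i < n) c i *: b i = 0) ->
  (dim W <= N%:R%:E :> \bar R)%E.
Proof.
move=> hW hker; apply: ub_ereal_sup => _ [n [b [hb bfree]] <-].
rewrite lee_fin ler_nat leqNgt; apply/negP => Nn.
have /choice [B hB] : forall i, exists F : E, F = b i :> (V -> C).
  by move=> i; apply: hW; exact: hb.
have eb : b = (fun i => B i : V -> C) by apply/funext.
have [c [i ci] hc] := exists_left_kernel (\matrix_(i < n, j < N) dot (e (J j)) (B i)) Nn.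
move: bfree; rewrite eb => /lin_free_ell2 /(_ c) h.
move: ci; rewrite h ?eqxx //; apply: hker => [k|j].
  by rewrite hB.
rewrite dot_sumr -[RHS](hc j); apply: eq_bigr => k _.
by rewrite dotZr mxE.
Qed.

Lemma basis_free n (J : 'I_n -> nat) : injective J -> lin_free (fun i => e (J i) : V -> C).
Proof.
move=> Jinj; apply/lin_free_ell2 => c hc i.
have [eon _ _ _ _] := he.
have := congr1 (dot (e (J i))) hc; rewrite dot0r dot_sumr (bigD1 i) //= big1 ?addr0.
  by rewrite dotZr eon eqxx mulr1.
by move=> j ji; rewrite dotZr eon (inj_eq Jinj) eq_sym (negPf ji) mulr0.
Qed.

(** An eigenvector for mu has zero coefficients wherever [lam n != mu]. The remaining indices form
    the finite list [s], as the eigenvalues diverge, and its length is the multiplicity. *)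
Lemma eigenvalue_seq_eigenbasis : eigenvalue_seq (lift_rel H) lam.
Proof.
have [eon ecomp [lam0 lamh] laminf hH] := he.
split=> // mu.
have [N hN] := laminf mu.
pose s := [seq n <- iota 0 N | lam n == mu].
have ins n : (n \in s) = (lam n == mu).
  rewrite mem_filter mem_iota add0n /=; case: eqP => //= en.
  by rewrite ltnNge; apply/negP => /hN; rewrite en ltxx.
have us : uniq s by rewrite filter_uniq // iota_uniq.
pose J (i : 'I_(size s)) := nth 0%N s i.
have Jinj : injective J.
  by move=> i j /eqP; rewrite nth_uniq // => /eqP h; apply: val_inj.
have Jmu i : lam (J i) = mu by apply/eqP; rewrite -ins mem_nth.
have -> : counting [set n | lam n = mu] = (size s)%:R%:E :> \bar R.
  rewrite /counting asboolT; last first.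
    by apply: (@sub_finite_set _ _ [set` s]) => // n /= /eqP; rewrite ins.
  suff -> : fset_set [set n | lam n = mu] = seq_fset tt s by rewrite size_seq_fset undup_id.
  apply/fsetP => n; rewrite seq_fsetE in_fset_set.
    by rewrite ins; apply/idP/eqP; rewrite inE.
  by apply: (@sub_finite_set _ _ [set` s]) => // k /= /eqP; rewrite ins.
have eigP f : eigenspace (lift_rel H) mu (f : V -> C) <->
    forall n, lam n != mu -> dot (e n) f = 0.
  split=> [hf n nmu|hf].
    have hfmu : H f (mu%:C%C *: f).
      by apply/(lift_relE H _ _); exact: hf.
    have := (hH _ _).1 hfmu n; rewrite dotZr => /eqP.
    rewrite -subr_eq0 -mulrBl mulf_eq0 -rmorphB /= => /orP[|/eqP //].
    by rewrite eq_complex /= eqxx andbT subr_eq0 eq_sym (negPf nmu).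
  suff : H f (mu%:C%C *: f) by move/(lift_relE H _ _).
  apply/hH => n; rewrite dotZr; have [->//|/hf ->] := eqVneq (lam n) mu.
  by rewrite !mulr0.
apply/eqP; rewrite eq_le; apply/andP; split.
  apply: (@dim_le_coef _ _ J).
    by move=> f /lift_rel_l2 [/= /(mk_l2 m_gt0)].
  move=> n b c hb h0; apply: ecomp => k.
  have [kmu|kmu] := eqVneq (lam k) mu.
    have ks : k \in s by rewrite ins kmu.
    have ki : (index k s < size s)%N by rewrite index_mem.
    by have := h0 (Ordinal ki); rewrite /J /= nth_index.
  by rewrite dot_sumr big1 // => i _; rewrite dotZr ((eigP _).1 (hb i)) // mulr0.
apply: dim_ge_free (basis_free Jinj) => i; apply/eigP => n nmu.
by rewrite eon; case: eqP => // en; rewrite en Jmu eqxx in nmu.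
Qed.

End SpectralExistence.

(** * First and second moments of finite measures *)

Section MomentsOfFiniteMeasure.
Context {R : realType}.
Local Notation T := (measurableTypeR R).
Variable mu : {measure set T -> \bar R}.
Variable s : R.
Hypothesis mu_s : mu setT = s%:E.

Lemma measurable_EFin_pow n : measurable_fun setT (fun x : T => (x ^+ n)%:E).
Proof. by apply/measurable_EFinP; exact: exprn_measurable. Qed.

Lemma integrable_cst_fin (b : R) : mu.-integrable setT (fun _ : T => b%:E).
Proof.
apply/integrableP; split; first exact: measurable_cst.
rewrite [X in (X < _)%E](_ : _ = (`|b|%:E * mu setT)%E); last exact: integral_cst.
by rewrite mu_s -EFinM ltry.
Qed.

Lemma integrable_id_of_sqr : (\int[mu]_x (x ^+ 2)%:E < +oo)%E ->
  mu.-integrable setT (EFin : T -> \bar R).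
Proof.
move=> h.
have isq : mu.-integrable setT (fun x : T => (x ^+ 2)%:E).
  apply/integrableP; split; first exact: measurable_EFin_pow.
  by under eq_integral do rewrite gee0_abs ?lee_fin ?sqr_ge0 //.
have iadd := integrableD measurableT isq (integrable_cst_fin 1).
apply: le_integrable iadd => // x _ /=; rewrite lee_fin [leRHS]ger0_norm; last by rewrite addr_ge0 ?sqr_ge0.
by rewrite ler_norml; have := sqr_ge0 (x - 1); have := sqr_ge0 (x + 1);
  rewrite !expr2 => *; apply/andP; split; lra.
Qed.

Section Concentrated.
Variable D : set T.
Hypothesis mD : measurable D.
Hypothesis muD : mu (~` D) = 0%E.

Lemma mu_concentrated : mu D = s%:E.
Proof.
have h : mu setT = (mu D + mu (~` D))%E.
  rewrite -measureU //; first by rewrite setUv.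
  - exact: measurableC.
  - by rewrite setICr.
by rewrite -mu_s h muD adde0.
Qed.

Lemma sqr_integral_fin (a : R) : (forall x, D x -> x ^+ 2 <= a) ->
  (\int[mu]_x (x ^+ 2)%:E < +oo)%E.
Proof.
move=> hD; apply: (@le_lt_trans _ _ (\int[mu]_(x in setT) (cst (`|a|%:E) x))%E).
  apply: ae_ge0_le_integral => //.
  - by move=> x _; rewrite lee_fin sqr_ge0.
  - exact: measurable_EFin_pow.
  - by move=> x _; rewrite lee_fin normr_ge0.
  - exists (~` D); split; [exact: measurableC|exact: muD|].
    move=> x /= nh Dx; apply: nh => _; rewrite lee_fin.
    by apply: le_trans (hD x Dx) _; exact: ler_norm.
by rewrite integral_cst // mu_s -EFinM ltry.
Qed.

Hypothesis iid : mu.-integrable setT (EFin : T -> \bar R).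

Lemma affine_integral (a b : R) :
  (\int[mu]_(x in D) (a * x + b)%:E = (a * fine (\int[mu]_x x%:E) + b * s)%:E)%E.
Proof.
have ia : mu.-integrable setT (fun x : T => a%:E * (EFin x))%E by exact: integrableZl.
have ib := integrable_cst_fin b.
have -> : (\int[mu]_(x in D) (a * x + b)%:E)%E = (\int[mu]_x (a * x + b)%:E)%E.
  have -> : D = setT `\` ~` D by rewrite setDE setCK setTI.
  rewrite -negligible_integral //; first exact: measurableC.
  by have := integrableD measurableT ia ib.
under eq_integral do rewrite EFinD EFinM.
rewrite (integralD measurableT ia ib) integralZl //.
rewrite [X in (_ + X)%E](_ : _ = (b%:E * mu setT)%E); last exact: integral_cst.
by rewrite mu_s EFinD !EFinM fineK // integrable_fin_num.
Qed.

Lemma affine_integral_ge0 (a b : R) : (forall x, D x -> 0 <= a * x + b) ->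
  0 <= a * fine (\int[mu]_x x%:E) + b * s.
Proof.
move=> h; rewrite -lee_fin -affine_integral; apply: integral_ge0 => x Dx.
by rewrite lee_fin h.
Qed.

(** A vanishing integral would make a x + b zero almost everywhere on D, so D would be a null set
    although it carries the whole mass s > 0. *)
Lemma affine_integral_gt0 (a b : R) : (forall x, D x -> 0 < a * x + b) -> 0 < s ->
  0 < a * fine (\int[mu]_x x%:E) + b * s.
Proof.
move=> h s0; rewrite lt_neqAle affine_integral_ge0 ?andbT; last by move=> x /h /ltW.
apply/eqP => e0.
have : (\int[mu]_(x in D) `|(a * x + b)%:E| = 0)%E.
  rewrite -[RHS](_ : \int[mu]_(x in D) (a * x + b)%:E = 0)%E; last first.
    by rewrite affine_integral -e0.
  apply: eq_integral => x; rewrite inE => Dx.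
  by rewrite gee0_abs // lee_fin ltW // h.
have mphi : measurable_fun D (fun x : T => (a * x + b)%:E).
  apply/measurable_EFinP; apply: measurable_funD; last exact: measurable_cst.
  by apply: measurable_funM; [exact: measurable_cst|exact: measurable_id].
move=> /(ae_eq_integral_abs mu mD mphi) [N [mN muN hN]].
have : (mu D <= 0)%E.
  rewrite -muN; apply: le_measure; rewrite ?inE //.
  move=> x Dx; apply: hN => /(_ Dx) /eqP.
  by rewrite eqe gt_eqF // h.
by rewrite mu_concentrated lee_fin leNgt s0.
Qed.

End Concentrated.
End MomentsOfFiniteMeasure.

(** * Variational properties of an arbitrary spectral measure *)

Section VariationalCount.
Context {R : realType} {V : countType}.
Local Notation C := R[i].
Local Notation T := (measurableTypeR R).
Variable m : V -> R.
Variable m_gt0 : forall x, 0 < m x.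
Local Notation E := (l2h m_gt0).
Implicit Types (f g h k : E).

Lemma orth_projP (B : operator R V) : orth_proj m B -> exists P : E -> E,
  [/\ symmetric_op P, forall f, P (P f) = P f & B = lift_rel (fun f g => g = P f)].
Proof.
move=> [sB domB BB].
have [S [eB hS]] := self_adjoint_relP m_gt0 sB.
have /choice [P hP] : forall f, exists g, S f g.
  move=> f; apply/(lift_rel_dom S f); rewrite -eB domB; exact: l2vP.
have Suniq f g g' : S f g -> S f g' -> g = g'.
  move=> /hS h /hS h'; apply: dot_inj => k; rewrite dotC (dotC g'); congr conjc.
  by rewrite -(h _ _ (hP k)) -(h' _ _ (hP k)).
have eS : S = (fun f g => g = P f).
  apply/funext => f; apply/funext => g; apply/propext.
  by split=> [h|->]; [exact: Suniq h (hP f)|exact: hP].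
exists P; split; last by rewrite eB eS.
- by move=> f g; rewrite ((hS f (P f)).1 (hP f) g (P g) (hP g)).
- move=> f; rewrite eB op_comp_lift in BB.
  have : lift_rel S (f : V -> C, P f : V -> C) by apply/lift_relE.
  rewrite -BB => /lift_relE [h [h1 h2]].
  by rewrite (Suniq _ _ _ h1 (hP f)) in h2; exact: Suniq (hP _) h2.
Qed.

Variable H : E -> E -> Prop.
Hypothesis Hge0 : forall f g, H f g -> 0 <= rd f g.
Variable Es : set R -> operator R V.
Hypothesis hEs : is_spectral_measure m (lift_rel H) Es.

Lemma spectral_measure_data : exists (P : set T -> E -> E)
    (mu : E -> {measure set T -> \bar R}),
  [/\ forall A, measurable A -> symmetric_op (P A) /\ (forall f, P A (P A f) = P A f),
      forall A, measurable A -> Es A = lift_rel (fun f g => g = P A f),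
      forall A f, measurable A -> mu f A = (nsq (P A f))%:E,
      forall f, mu f setT = (nsq f)%:E &
      forall f, ((exists g, H f g) <-> (\int[mu f]_x (x ^+ 2)%:E < +oo)%E) /\
        forall g, H f g -> rd f g = fine (\int[mu f]_x x%:E)%E].
Proof.
have [hP hT hmu] := hEs.
have /choice [P hPA] : forall A : set T, exists P : E -> E, measurable A ->
    [/\ symmetric_op P, forall f, P (P f) = P f & Es A = lift_rel (fun f g => g = P f)].
  move=> A; have [mA|nA] := pselect (measurable A); last by exists id.
  by have [P hP'] := orth_projP (hP A mA); exists P.
have /choice [mu hm] := fun f : E => hmu f (l2vP f).
have muE A f : measurable A -> mu f A = (nsq (P A f))%:E.
  move=> mA; have [Psym Pidem eA] := hPA A mA; have [h1 _ _] := hm f.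
  rewrite (h1 A (P A f : V -> C)) //; last by rewrite eA; exact/lift_relE.
  by rewrite dotpE /nsq /rd Psym Pidem.
exists P, mu; split=> //.
- by move=> A /hPA [].
- by move=> A /hPA [].
- move=> f; have [h1 _ _] := hm f.
  rewrite (h1 setT (f : V -> C)) //; last by rewrite hT; split=> //; exact: l2vP.
- move=> f; have [_ h2 h3] := hm f; split.
    by apply: iff_trans h2; symmetry; exact: lift_rel_dom.
  move=> g hg; have := h3 (g : V -> C) ((lift_relE H f g).2 hg).
  by rewrite dotpE => /(congr1 (@complex.Re R)).
Qed.

(** The two facts that variational counting requires of any spectral measure: on the range of the
    projection for ]-oo, l] the form is defined and at most l, and on the part of the domain that it
    annihilates the form exceeds l strictly. Both integrate an affine function against the scalar
    measure. *)
Lemma spectral_moments : exists P : set R -> E -> E,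
  [/\ forall l, is_linear (P `]-oo, l]%classic),
      forall l, ran (Es `]-oo, l]%classic) = [set f | exists g : E, f = P `]-oo, l]%classic g :> (V -> C)],
      forall l f, P `]-oo, l]%classic (P `]-oo, l]%classic f) = P `]-oo, l]%classic f,
      forall l f, P `]-oo, l]%classic f = f -> exists g, H f g /\ rd f g <= l * nsq f &
      forall l f g, P `]-oo, l]%classic f = 0 -> H f g -> f <> 0 -> l * nsq f < rd f g].
Proof.
have [P [mu [hP hE hmu hmuT hH]]] := spectral_measure_data.
have mi (i : interval R) : measurable ([set` i] : set T) by exact: measurable_itv.
have muC A f : measurable A -> P A f = f -> mu f (~` A) = 0%E.
  move=> mA e; have : mu f setT = (mu f A + mu f (~` A))%E.
    rewrite -measureU //; first by rewrite setUv.
    - exact: measurableC.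
    - by rewrite setICr.
  rewrite hmuT hmu // e => /esym /eqP; rewrite hmu; last exact: measurableC.
  by rewrite -EFinD eqe -subr_eq0 addrC addKr => /eqP ->.
(* Bounded intervals give a finite second moment, so g lies in the domain; its form would be at most
   -b |g|^2, while H is nonnegative. *)
have neg (a b : R) : 0 < b -> forall f, P `[(- a), (- b)]%classic f = 0.
  move=> b0 f; set J := `[_, _]%classic; pose g := P J f.
  have eg : P J g = g by exact: (hP J (mi _)).2.
  have mC := muC J g (mi _) eg.
  have [k hk] : exists k, H g k.
    apply/(hH g).1; apply: (sqr_integral_fin (hmuT g) (mi _) mC (a := a ^+ 2)) => x.
    rewrite /J /= in_itv /= => /andP[ax xb].
    by have : (- x) ^+ 2 <= a ^+ 2; [rewrite lerXn2r ?nnegrE|rewrite sqrrN]; lra.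
  have iid := integrable_id_of_sqr (hmuT g) ((hH g).1.1 (ex_intro _ k hk)).
  have := affine_integral_ge0 (hmuT g) (mi _) mC iid (a := -1) (b := - b).
  rewrite -((hH g).2 k hk) => h.
  have {}h : 0 <= -1 * rd g k + - b * nsq g.
    by apply: h => x; rewrite /J /= in_itv /= => /andP[_ xb]; lra.
  have hk0 := Hge0 hk; apply: nsq_eq0; apply/eqP; rewrite eq_le nsq_ge0 andbT.
  by rewrite -(ler_pM2l b0) mulr0; lra.
(* The negative axis is covered by the intervals [-(n+1), -1/(n+1)]. *)
have mu_neg f : mu f `]-oo, 0[%classic = 0%E.
  apply/eqP; rewrite eq_le measure_ge0 andbT.
  pose F (n : nat) : set T := `[(- n.+1%:R), (- n.+1%:R^-1)]%classic.
  apply: (@le_trans _ _ (\big[+%E/0%E]_(0 <= n <oo) mu f (F n))); last first.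
    rewrite eseries0 // => n _ _.
    by rewrite /F hmu ?neg ?invr_gt0 // nsq0.
  apply: measure_sigma_subadditive => [n||x]; [exact: mi|exact: mi|].
  rewrite /= in_itv /= => x0.
  have [n hn] : exists n : nat, - x < n.+1%:R.
    by exists (Num.truncn (- x)); exact: truncnS_gt.
  have x0' : 0 < (- x)^-1 by rewrite invr_gt0 oppr_gt0.
  have [k hk] : exists n : nat, (- x)^-1 < n.+1%:R.
    by exists (Num.truncn (- x)^-1); exact: truncnS_gt.
  exists (maxn n k) => //=; rewrite /F /= in_itv /=; apply/andP; split.
    rewrite lerNl; apply: le_trans (ltW hn) _.
    by rewrite ler_nat ltnS leq_maxl.
  rewrite lerNr -[leRHS]invrK lef_pV2 ?posrE //.
  by apply: le_trans (ltW hk) _; rewrite ler_nat ltnS leq_maxr.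
exists P; split.
- by move=> l; apply: symmetric_linear; exact: (hP _ (mi _)).1.
- move=> l; rewrite hE //; apply/seteqP; split=> f.
    by move=> [h [f' [g' [-> /= _ ->]]]]; exists f'.
  by move=> [g ->]; exists (g : V -> C); exact/lift_relE.
- by move=> l f; exact: (hP _ (mi _)).2.
(* Without mass on the negative axis the measure lives on [0, l], where x^2 <= l^2; hence the second
   moment is finite and f is in the domain. *)
- move=> l f ef; pose D := (`[0, l]%classic : set T).
  have mC : mu f (~` D) = 0%E.
    apply/eqP; rewrite eq_le measure_ge0 andbT.
    pose A0 : set T := `]-oo, 0[%classic; pose A1 : set T := `]-oo, l]%classic.
    have mA0 : measurable A0 by exact: mi.
    have mA1 : measurable (~` A1) by apply: measurableC; exact: mi.
    have mD : measurable (~` D) by apply: measurableC; exact: mi.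
    apply: (@le_trans _ _ (mu f (~` A1) + mu f A0)%E).
      apply: le_trans (measureU2 _ mA1 mA0).
      - apply: le_measure; rewrite ?inE //.
        + by apply: measurableU.
        + move=> x; rewrite /D /A0 /A1 /= !in_itv /= => /negP; rewrite negb_and -!ltNge => /orP[].
            by right.
          by move=> lx; left; apply/negP; rewrite -ltNge.
    by rewrite /A0 mu_neg (muC _ _ (mi _) ef) adde0.
  have [g hg] : exists g, H f g.
    apply/(hH f).1; apply: (sqr_integral_fin (hmuT f) (mi _) mC (a := l ^+ 2)) => x.
    have sqm (y : R) : 0 <= y -> y <= l -> y ^+ 2 <= l ^+ 2.
      by move=> y0 yl; rewrite lerXn2r ?nnegrE // (le_trans y0 yl).
    by rewrite /D /= in_itv /= => /andP[x0 xl]; exact: sqm.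
  exists g; split=> //.
  have iid := integrable_id_of_sqr (hmuT f) ((hH f).1.1 (ex_intro _ g hg)).
  have := affine_integral_ge0 (hmuT f) (mi _) mC iid (a := -1) (b := l).
  rewrite -((hH f).2 g hg) => h.
  have {}h : 0 <= -1 * rd f g + l * nsq f.
    by apply: h => x; rewrite /D /= in_itv /= => /andP[_ xb]; lra.
  lra.
- move=> l f g ef hg f0; pose D := (`]l, +oo[%classic : set T).
  have DC : ~` D = `]-oo, l]%classic.
    by apply/seteqP; split=> x; rewrite /D /= !in_itv /= andbT (leNgt x l) => /negP.
  have mC : mu f (~` D) = 0%E by rewrite DC hmu // ef nsq0.
  have iid := integrable_id_of_sqr (hmuT f) ((hH f).1.1 (ex_intro _ g hg)).
  have := affine_integral_gt0 (hmuT f) (mi _) mC iid (a := 1) (b := - l).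
  rewrite -((hH f).2 g hg) => h.
  have {}h : 0 < 1 * rd f g + - l * nsq f.
    apply: h; last exact: nsq_gt0.
    by move=> x; rewrite /D /= in_itv /= andbT; lra.
  lra.
Qed.

End VariationalCount.

Section CountComparison.
Context {R : realType} {V : countType}.
Local Notation C := R[i].
Variable m : V -> R.
Variable m_gt0 : forall x, 0 < m x.
Local Notation E := (l2h m_gt0).
Implicit Types (f g h k : E).

(** The projection P' is injective on the range of P: a nonzero F there with P' F = 0 would have
    H'-form both at most and strictly above l' |F|^2. So P' carries free families to free
    families. *)
Lemma eig_count_le (H H' : E -> E -> Prop) (l l' : R) :
  (forall f g, H f g -> 0 <= rd f g) -> (forall f g, H' f g -> 0 <= rd f g) ->
  (exists Es, is_spectral_measure m (lift_rel H) Es) ->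
  (exists Es, is_spectral_measure m (lift_rel H') Es) ->
  (forall f g, H f g -> rd f g <= l * nsq f -> exists g', H' f g' /\ rd f g' <= l' * nsq f) ->
  (eig_count m (lift_rel H) l <= eig_count m (lift_rel H') l')%E.
Proof.
move=> H0 H0' /getPex hE /getPex hE' hle; rewrite /eig_count.
have [P [Plin Pran Pidem Ple _]] := spectral_moments H0 hE.
have [P' [Plin' Pran' _ _ Pgt']] := spectral_moments H0' hE'.
rewrite /spectral_proj Pran Pran'.
apply: ub_ereal_sup => _ [n [b [hb bfree]] <-].
have [B hB] := choice hb.
pose B1 i := P `]-oo, l]%classic (B i).
have eb : b = (fun i => B1 i : V -> C) by apply/funext => i; exact: hB.
rewrite eb in bfree; move/lin_free_ell2 in bfree.
apply: (@dim_ge_free _ _ _ _ (fun i => P' `]-oo, l']%classic (B1 i) : V -> C)).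
  by move=> i; exists (B1 i).
apply/lin_free_ell2 => c; set F := \sum_(i < n) c i *: B1 i => hc; apply: bfree.
have PF : P `]-oo, l]%classic F = F.
  rewrite (lin_sum _ _ _ (Plin l)); apply: eq_bigr => i _.
  by rewrite (linZ (Plin l)) Pidem.
have P'F : P' `]-oo, l']%classic F = 0.
  rewrite -hc (lin_sum _ _ _ (Plin' l')); apply: eq_bigr => i _.
  by rewrite (linZ (Plin' l')).
have [g [hg le1]] := Ple l F PF.
have [g' [hg' le2]] := hle F g hg le1.
apply: contrapT => F0; have := Pgt' l' F g' P'F hg' F0.
by rewrite ltNge le2.
Qed.

(** Among the combinations of e_0, ..., e_n some nonzero F is orthogonal to e'_0, ..., e'_{n-1}.
    Then lam'_n |F|^2 <= <F, H' F> <= <F, H F> + c |F|^2 <= (lam_n + c) |F|^2. *)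
Lemma eigenvalue_minmax (H H' : E -> E -> Prop) (e e' : nat -> E) (lam lam' : nat -> R) (c : R) :
  eigenbasis e lam H -> eigenbasis e' lam' H' ->
  (forall f g, H f g -> exists g', H' f g' /\ rd f g' <= rd f g + c * nsq f) ->
  forall n, lam' n <= lam n + c.
Proof.
move=> [eon ecomp [lam0 lamh] _ hH] [eon' ecomp' [lam0' lamh'] _ hH'] hle n.
have [a [i0 ai0] ha] := exists_left_kernel (\matrix_(i < n.+1, j < n) dot (e' j) (e i)) (ltnSn n).
pose F := \sum_(i < n.+1) a i *: e i.
pose K := \sum_(i < n.+1) ((lam i)%:C%C * a i) *: e i.
have coefF (k : nat) : dot (e k) F = if (k < n.+1)%N then a (inord k) : C else 0.
  rewrite /F dot_sumr; case: ltnP => kn.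
    rewrite (bigD1 (inord k)) //= big1 ?addr0; last first.
      move=> j jk; rewrite dotZr eon; case: eqP => [kj|]; last by rewrite mulr0.
      by move: jk; rewrite kj inord_val eqxx.
    by rewrite dotZr inordK // eon eqxx mulr1.
  rewrite big1 // => j _; rewrite dotZr eon; case: eqP => [kj|]; last by rewrite mulr0.
  by move: (ltn_ord j); rewrite -kj ltnNge kn.
have hFK : diag_op e lam F K.
  move=> k; rewrite coefF /K dot_sumr; case: ltnP => kn.
    rewrite (bigD1 (inord k)) //= big1 ?addr0; last first.
      move=> j jk; rewrite dotZr eon; case: eqP => [kj|]; last by rewrite mulr0.
      by move: jk; rewrite kj inord_val eqxx.
    by rewrite dotZr inordK // eon eqxx mulr1.
  rewrite mulr0 big1 // => j _; rewrite dotZr eon; case: eqP => [kj|]; last by rewrite mulr0.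
  by move: (ltn_ord j); rewrite -kj ltnNge kn.
have F0 : F <> 0.
  move=> F0; have := coefF i0; rewrite F0 dot0r ltn_ord inord_val => /esym /eqP.
  by rewrite (negPf ai0).
have Fle : rd F K <= lam n * nsq F.
  have hp : lam n * (\sum_(0 <= i < N) sqnc (dot (e i) F)) @[N --> \oo] --> lam n * nsq F.
    by apply: cvgMr; exact: parseval.
  apply: (ler_cvg_to (diag_rd eon ecomp hFK) hp); apply: nearW => N; rewrite mulr_sumr; apply: ler_sum => k _; rewrite mulrC coefF.
  case: ltnP => kn; last by rewrite sqnc0 !mulr0.
  by rewrite ler_wpM2r ?sqnc_ge0 // lamh.
have [g' [hg' le2]] := hle _ _ ((hH _ _).2 hFK).
have le3 := diag_rayleigh eon' ecomp' (n := n) lamh' ((hH' _ _).1 hg').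
have {}le3 : lam' n * nsq F <= rd F g'.
  apply: le3 => j jn; rewrite /F dot_sumr -[RHS](ha (Ordinal jn)).
  by apply: eq_bigr => i _; rewrite dotZr mxE.
by rewrite -(ler_pM2r (nsq_gt0 F0)) mulrDl; lra.
Qed.

End CountComparison.

(** * Holonomy and parallel sections *)

Lemma graph_meas_gt0 (R : realType) (V : countType) (G : wgraph R V) :
  is_graph G -> forall x, 0 < meas G x.
Proof. by case. Qed.

Lemma graph_loopless (R : realType) (V : countType) (G : wgraph R V) :
  is_graph G -> forall x, weight G x x = 0.
Proof. by case. Qed.

Section Holonomy.
Context {R : realType} {V : countType}.
Local Notation C := R[i].
Variables (G : wgraph R V) (theta : V -> V -> R).
Hypothesis graphG : is_graph G.
Hypothesis magG : magnetic_potential G theta.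
Local Notation ex := (fun x y => expi (theta x y)).

Lemma graph_lfm : locally_finite_magnetic G theta.
Proof.
have [[sym ge0] _ _ fin _] := graphG; have [th _] := magG.
by split=> // x y _; exact: th.
Qed.

Lemma graph_path x y : exists p, path (adj G) x p /\ last x p = y.
Proof. by have [_ _ _ _ h] := graphG. Qed.

Lemma holonomy_cons x y p : holonomy theta x (y :: p) = theta x y + holonomy theta y p.
Proof. by rewrite /holonomy /= big_cons. Qed.

Lemma holonomy_cat x p q :
  holonomy theta x (p ++ q) = holonomy theta x p + holonomy theta (last x p) q.
Proof.
elim: p x => [|y p IH] x /=; first by rewrite {2}/holonomy big_nil add0r.
by rewrite !holonomy_cons IH addrA.
Qed.

Definition parallel (f : V -> C) := forall x y, adj G x y -> f x = ex x y * f y.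

Lemma parallel_path (f : V -> C) x p : parallel f -> path (adj G) x p ->
  f x = expi (holonomy theta x p) * f (last x p).
Proof.
move=> hf; elim: p x => [|y p IH] x /=.
  by rewrite /holonomy big_nil expi0 mul1r.
by move=> /andP[xy /IH e]; rewrite holonomy_cons expiD -mulrA -e (hf _ _ xy).
Qed.

(** Around a closed walk with nontrivial holonomy f is multiplied by a phase other than 1, so it
    vanishes at the base point, and then everywhere by transport along paths. *)
Lemma parallel_eq0 (f : V -> C) : ~ trivial_holonomy G theta -> parallel f -> forall x, f x = 0.
Proof.
move=> hol hf; have [x0 [p [pp pl pn]]] : exists x p,
    [/\ path (adj G) x p, last x p = x & ~ eq_mod2pi (holonomy theta x p) 0].
  apply: contrapT => h; apply: hol => x p pp pl; apply: contrapT => hn; apply: h.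
  by exists x, p.
have f0 : f x0 = 0.
  have := parallel_path hf pp; rewrite pl => e.
  have /eqP : (1 - expi (holonomy theta x0 p)) * f x0 = 0.
    by rewrite mulrBl mul1r -e subrr.
  rewrite mulf_eq0 => /orP[|/eqP //]; rewrite subr_eq0 eq_sym => /eqP /expi_eq1.
  by move=> /pn.
move=> x; have [q [qp ql]] := graph_path x x0.
by rewrite (parallel_path hf qp) ql f0 mulr0.
Qed.

(** The section at x is the phase of a chosen walk from x to x0. On an edge xy, compare two closed
    walks based at x0 with a common first part leading to x: one returns by the walk of x, the other
    through y. *)
Lemma parallel_ex (x0 : V) : trivial_holonomy G theta ->
  exists f : V -> C, parallel f /\ forall x, f x != 0.
Proof.
move=> hol; have /choice [p hp] := fun x => graph_path x x0.
have nz (a : R) : expi a != 0 :> C.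
  by apply/eqP => e; have := sqnc_expi a; rewrite e sqnc0 => /eqP; rewrite eq_sym oner_eq0.
exists (fun x => expi (holonomy theta x (p x))); split=> // x y xy.
have [q [qp ql]] := graph_path x0 x.
have closed z s : path (adj G) z s -> last z s = z -> expi (holonomy theta z s) = 1 :> C.
  by move=> h1 h2; rewrite (eq_mod2pi_expi (hol z s h1 h2)) expi0.
have c1 : expi (holonomy theta x0 q) * expi (holonomy theta x (p x)) = 1 :> C.
  have hc := holonomy_cat x0 q (p x); rewrite ql in hc.
  rewrite -expiD -hc; apply: closed.
    by rewrite cat_path qp ql (hp x).1.
  by rewrite last_cat ql (hp x).2.
have c2 : expi (holonomy theta x0 q) * (ex x y * expi (holonomy theta y (p y))) = 1 :> C.
  have hc := holonomy_cat x0 q (y :: p y); rewrite ql holonomy_cons in hc.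
  rewrite -!expiD -hc; apply: closed.
    by rewrite cat_path qp ql /= xy (hp y).1.
  by rewrite last_cat ql /= (hp y).2.
by apply: (mulfI (nz (holonomy theta x0 q))); rewrite c1 c2.
Qed.

Lemma parallel_harmonic (f : V -> C) : parallel f -> forall x, formal_laplacian G theta f x = 0.
Proof.
move=> hf x; rewrite (formal_laplacian_nb graph_lfm) big_seq big1 ?mulr0 // => y.
by rewrite (in_nb graph_lfm) => /hf <-; rewrite subrr mulr0.
Qed.

Variable m_gt0 : forall x, 0 < meas G x.
Local Notation E := (l2h m_gt0).

Lemma form_eq0_parallel (f g : E) : finsupp f -> Hmax G theta f g -> rd f g = 0 -> parallel f.
Proof.
move=> [X fX] hfg e x y xy.
(* The support is enlarged so that the given edge occurs in the double sum, all of whose terms must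
   vanish. *)
have fX' z : z \notin (x |` (y |` X))%fset -> f z = 0.
  by rewrite !inE !negb_or => /andP[_ /andP[_ /fX]].
have := laplacian_form graph_lfm fX' erefl hfg; rewrite e => /esym /eqP.
rewrite mulf_eq0 invr_eq0 pnatr_eq0 /=.
have ge0 a b : 0 <= weight G a b * sqnc (f a - ex a b * f b).
  by rewrite mulr_ge0 ?sqnc_ge0 // (lfm_ge0 graph_lfm).
set Z := thicken _ _.
have xZ : x \in Z by apply: thicken_sub; rewrite !inE eqxx.
have yZ : y \in Z by apply: thicken_sub; rewrite !inE eqxx orbT.
rewrite psumr_eq0; last by move=> a _; apply: sumr_ge0.
move=> /allP /(_ x xZ) /=; rewrite psumr_eq0 // => /allP /(_ y yZ) /=.
rewrite mulf_eq0 => /orP[|/eqP /sqnc_eq0 /subr0_eq //].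
by rewrite gt_eqF.
Qed.

End Holonomy.

Section GraphBalls.
Context {R : realType} {V : countType}.
Variable G : wgraph R V.
Hypothesis graphG : is_graph G.

Fixpoint ball_fset (o : V) (n : nat) : {fset V} :=
  if n is n'.+1 then thicken G (ball_fset o n') else [fset o]%fset.

Lemma path_ball o n x p : path (adj G) x p -> last x p = o -> (size p <= n)%N ->
  x \in ball_fset o n.
Proof.
have hsym a b : adj G a b = adj G b a by have [[sym _] _ _ _ _] := graphG; rewrite /adj sym.
have lfm : locally_finite_magnetic G (fun _ _ => 0).
  have [[sym ge0] _ _ fin _] := graphG; split=> // a b _.
  by exists 0; rewrite oppr0 mul0r addr0.
elim: n x p => [|n IH] x [|y p] //=.
- by move=> _ -> _; rewrite inE.
- move=> _ -> _; elim: n {IH} => [|n IH]; first by apply: thicken_sub; rewrite inE.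
  by apply: thicken_sub; exact: IH.
- move=> /andP[xy yp] yl; rewrite ltnS => /(IH y p yp yl) yb.
  by apply: (thicken_nb lfm yb); rewrite hsym.
Qed.

Lemma gdist_lt_path o x (r : R) : gdist G x o < r ->
  exists p, [/\ path (adj G) x p, last x p = o & (size p)%:R < r].
Proof.
have [_ _ _ _ conn] := graphG; have [p0 [pp pl]] := conn x o.
move=> h; have hS : has_inf ([set (size p)%:R | p in [set p | path (adj G) x p /\ last x p = o]] : set R).
  by split; [exists (size p0)%:R, p0|exists 0 => _ [p _ <-]].
have d0 : 0 < r - gdist G x o by rewrite subr_gt0.
have [_ [p [hp1 hp2] <-] hlt] := inf_adherent d0 hS.
exists p; split=> //; move: hlt; rewrite -/(gdist G x o).
by rewrite addrC subrK.
Qed.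

(** Balls for the graph distance are finite by local finiteness, so decay in the distance becomes
    smallness outside finite sets, the form in which compactness uses it. *)
Lemma vanishing_meas_finite o : (forall e : R, 0 < e ->
    exists r : R, forall x, r <= gdist G x o -> meas G x < e) ->
  forall e : R, 0 < e -> exists X : {fset V}, forall x, x \notin X -> meas G x < e.
Proof.
move=> h e /h [r hr]; exists (ball_fset o (Num.truncn `|r|)) => x xX; apply: hr.
rewrite leNgt; apply: contra xX => /gdist_lt_path [p [pp pl ps]].
apply: (path_ball pp pl); rewrite -ltnS -(ltr_nat R).
apply: lt_trans ps _; apply: le_lt_trans (ler_norm r) _; exact: truncnS_gt.
Qed.

End GraphBalls.

(** * The Laplacian of a product graph *)

Section WeightSplitting.
Context {R : realType} {V : countType}.
Local Notation C := R[i].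
Variable theta : V -> V -> R.

Lemma lfm_sub (G : wgraph R V) (w m : V -> _) : locally_finite_magnetic G theta ->
  (forall x y, w x y = w y x) -> (forall x y, 0 <= w x y) ->
  (forall x y, w x y <= weight G x y) -> locally_finite_magnetic (WGraph w m) theta.
Proof.
move=> hG ws w0 wle.
have sub x y : adj (WGraph w m) x y -> adj G x y by move=> h; exact: lt_le_trans h (wle x y).
split=> //= [x|x y /sub]; last exact: lfm_theta.
by apply: sub_finite_set (lfm_fin hG x) => y; exact: sub.
Qed.

Lemma laplacian_split (w w' : V -> V -> R) m (f : V -> C) x :
  let G := WGraph (fun x y => w x y + w' x y) m in
  locally_finite_magnetic G theta -> (forall x y, 0 <= w x y) -> (forall x y, 0 <= w' x y) ->
  (forall x y, w x y = w y x) -> (forall x y, w' x y = w' y x) ->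
  formal_laplacian G theta f x =
    formal_laplacian (WGraph w m) theta f x + formal_laplacian (WGraph w' m) theta f x.
Proof.
move=> G hG w0 w0' ws ws'.
have hw : locally_finite_magnetic (WGraph w m) theta.
  by apply: (lfm_sub _ hG) => // a b; rewrite /= lerDl.
have hw' : locally_finite_magnetic (WGraph w' m) theta.
  by apply: (lfm_sub _ hG) => // a b; rewrite /= lerDr.
rewrite (formal_laplacian_nb hG) (@formal_laplacianE _ _ (WGraph w m) _ _ _ (nb G x)).
  rewrite (@formal_laplacianE _ _ (WGraph w' m) _ _ _ (nb G x)) => [|y yn].
    rewrite -mulrDr -big_split; congr (_ * _); apply: eq_bigr => y _ /=.
    by rewrite rmorphD mulrDl.
  rewrite (_ : weight _ x y = 0) ?mul0r //=; apply/eqP; rewrite eq_le w0' andbT leNgt.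
  by apply: contra yn => h; rewrite (in_nb hG) /adj /= ltr_wpDl.
move=> y yn; rewrite (_ : weight _ x y = 0) ?mul0r //=; apply/eqP; rewrite eq_le w0 andbT leNgt.
by apply: contra yn => h; rewrite (in_nb hG) /adj /= ltr_wpDr.
Qed.

End WeightSplitting.

Section ProductGraph.
Context {R : realType} {V1 V2 : countType}.
Local Notation C := R[i].
Variables (G1 : wgraph R V1) (G2 : wgraph R V2) (I : set V2).
Variables (theta1 : V1 -> V1 -> R) (theta2 : V2 -> V2 -> R).
Hypothesis graphG1 : is_graph G1.
Hypothesis graphG2 : is_graph G2.
Hypothesis mag1 : magnetic_potential G1 theta1.
Hypothesis mag2 : magnetic_potential G2 theta2.
Local Notation m1 := (meas G1).
Local Notation m2 := (meas G2).
Local Notation G := (prod_graph G1 G2 I).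
Local Notation theta := (prod_potential G1 G2 I theta1 theta2).
Local Notation mp := (fun z : V1 * V2 => m1 z.1 * m2 z.2).
Let lfm1 := graph_lfm graphG1 mag1.
Let lfm2 := graph_lfm graphG2 mag2.

Definition horiz_weight (z w : V1 * V2) : R :=
  weight G1 z.1 w.1 * (z.2 == w.2)%:R * \1_I z.2.
Definition vert_weight (z w : V1 * V2) : R := (z.1 == w.1)%:R * weight G2 z.2 w.2.
Definition horiz_graph := WGraph horiz_weight mp.
Definition vert_graph := WGraph vert_weight mp.

Lemma prod_meas_gt0 z : 0 < mp z.
Proof. by rewrite mulr_gt0 ?graph_meas_gt0. Qed.

Lemma indic_ge0 (y : V2) : 0 <= \1_I y :> R.
Proof. by rewrite indicE ler0n. Qed.

Lemma horiz_weight_ge0 z w : 0 <= horiz_weight z w.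
Proof. by rewrite !mulr_ge0 ?indic_ge0 ?ler0n // (lfm_ge0 lfm1). Qed.

Lemma vert_weight_ge0 z w : 0 <= vert_weight z w.
Proof. by rewrite mulr_ge0 ?ler0n // (lfm_ge0 lfm2). Qed.

Lemma horiz_weight_sym z w : horiz_weight z w = horiz_weight w z.
Proof.
rewrite /horiz_weight (lfm_sym lfm1) [_.2 == _]eq_sym.
by case: eqVneq => [->|] //; rewrite !mulr0 !mul0r.
Qed.

Lemma vert_weight_sym z w : vert_weight z w = vert_weight w z.
Proof. by rewrite /vert_weight (lfm_sym lfm2) [_.1 == _]eq_sym. Qed.

(** Absence of loops makes an edge change exactly one coordinate, so the two summands of the product
    potential never mix. *)
Lemma prod_adj z w : adj G z w ->
  (z.2 = w.2 /\ z.1 != w.1 /\ adj G1 z.1 w.1) \/ (z.1 = w.1 /\ z.2 != w.2 /\ adj G2 z.2 w.2).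
Proof.
rewrite /adj /=; case: (eqVneq z.2 w.2) => [e2|n2]; case: (eqVneq z.1 w.1) => [e1|n1].
- by rewrite e1 e2 !graph_loopless // !mul0r mulr0 addr0 ltxx.
- rewrite mul0r addr0 mulr1 => h; left; split=> //; split=> //.
  rewrite lt_neqAle eq_sym (lfm_ge0 lfm1) andbT; apply: contraTneq h => ->.
  by rewrite mul0r ltxx.
- by rewrite mulr0 mul0r add0r mul1r => h; right.
- by rewrite mulr0 !mul0r addr0 ltxx.
Qed.

Lemma prod_lfm : locally_finite_magnetic G theta.
Proof.
have sym z w : weight G z w = weight G w z.
  rewrite -[LHS]/(horiz_weight z w + vert_weight z w) horiz_weight_sym vert_weight_sym.
  by [].
split=> //.
- by move=> z w; rewrite addr_ge0 ?horiz_weight_ge0 ?vert_weight_ge0.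
- move=> z.
  pose S1 := [set (x, z.2) | x in [set x | adj G1 z.1 x]].
  pose S2 := [set (z.1, y) | y in [set y | adj G2 z.2 y]].
  apply: (@sub_finite_set _ _ (S1 `|` S2)).
    move=> [x y] /= /prod_adj /= [[<- [_ h]]|[<- [_ h]]]; [left|right].
      by exists x.
    by exists y.
  rewrite finite_setU; split; apply: finite_image; [exact: (lfm_fin lfm1)|exact: (lfm_fin lfm2)].
- move=> z w zw; have wz : adj G w z by rewrite /adj sym.
  rewrite /prod_potential zw wz.
  case: (prod_adj zw) => [[e [/negPf n h]]|[e [/negPf n h]]].
    by rewrite e (eq_sym w.1) n eqxx !mulr1 !mul0r !addr0; exact: (lfm_theta lfm1).
  by rewrite e (eq_sym w.2) n eqxx !mul1r !mulr0 !add0r; exact: (lfm_theta lfm2).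
Qed.

Lemma horiz_lfm : locally_finite_magnetic horiz_graph theta.
Proof.
apply: (lfm_sub _ prod_lfm); [exact: horiz_weight_sym|exact: horiz_weight_ge0|].
by move=> z w; rewrite lerDl vert_weight_ge0.
Qed.

Lemma vert_lfm : locally_finite_magnetic vert_graph theta.
Proof.
apply: (lfm_sub _ prod_lfm); [exact: vert_weight_sym|exact: vert_weight_ge0|].
by move=> z w; rewrite lerDr horiz_weight_ge0.
Qed.

Lemma prod_laplacian_split f z : formal_laplacian G theta f z =
  formal_laplacian horiz_graph theta f z + formal_laplacian vert_graph theta f z.
Proof.
exact: (laplacian_split f z prod_lfm horiz_weight_ge0 vert_weight_ge0
  horiz_weight_sym vert_weight_sym).
Qed.

Lemma vert_laplacian (f : V1 * V2 -> C) x y : formal_laplacian vert_graph theta f (x, y) =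
  ((m1 x)^-1)%:C%C * formal_laplacian G2 theta2 (fun y' => f (x, y')) y.
Proof.
rewrite (@formal_laplacianE _ _ vert_graph _ _ _ [fset (x, y') | y' in nb G2 y]%fset).
  rewrite big_imfset /=; last by move=> a b _ _ [].
  rewrite (formal_laplacian_nb lfm2) mulrA -rmorphM /= -invfM; congr (_ * _).
  rewrite big_seq [RHS]big_seq; apply: eq_bigr => y'; rewrite (in_nb lfm2) => a.
  rewrite /vert_weight /= eqxx mul1r; congr (_ * (_ - expi _ * _)).
  have yy' : y != y' by apply: contraTneq a => <-; rewrite /adj graph_loopless // ltxx.
  rewrite /prod_potential /= eqxx (negPf yy') mulr0 add0r mul1r ifT //.
  by rewrite /adj /= eqxx (negPf yy') mulr0 mul0r add0r mul1r.
move=> [x' y'] h; rewrite /= /vert_weight /=; case: eqVneq => [e|]; last by rewrite !mul0r.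
subst x'; rewrite mul1r (w_nadj lfm2) ?mul0r //; apply: contra h => a.
by apply/imfsetP; exists y' => //=; rewrite (in_nb lfm2).
Qed.

End ProductGraph.

(** * Laplacians of bounded degree *)

Section BoundedLaplacian.
Context {R : realType} {V : countType}.
Local Notation C := R[i].
Variables (G : wgraph R V) (theta : V -> V -> R) (M : R).
Hypothesis hG : locally_finite_magnetic G theta.
Local Notation m := (meas G).
Variable m_gt0 : forall x, 0 < meas G x.
Hypothesis M0 : 0 <= M.
Hypothesis hM : forall x (Y : {fset V}), \sum_(y <- Y) weight G x y <= M * m x.
Local Notation E := (l2h m_gt0).
Local Notation H := (@Hmax _ _ G theta m_gt0).
Implicit Types (f g h k : E).

Lemma Hmax_finsupp f g : finsupp f -> H f g -> finsupp g.
Proof.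
move=> [X fX] h; exists (thicken G X) => x xX.
by rewrite [g x](congr1 (fun h : V -> C => h x) h) (laplacian_supp hG fX).
Qed.

Lemma bounded_form_fs f g : finsupp f -> H f g -> 0 <= rd f g <= 2 * M * nsq f.
Proof.
move=> [X fX] h; rewrite (laplacian_form_ge0 hG fX erefl h) /=.
exact: (laplacian_form_le hG fX erefl h hM).
Qed.

(** Passage from a form bound to an operator bound. For g = L f, Cauchy-Schwarz for the form q gives
    |g|^4 = <g, L f>^2 <= q(g) q(f) <= (2M)^2 |g|^2 |f|^2; it applies as g is again finitely
    supported. *)
Lemma bounded_norm_fs f g : finsupp f -> H f g -> nsq g <= (2 * M) ^+ 2 * nsq f.
Proof.
move=> fs hfg; have gs := Hmax_finsupp fs hfg.
have [k hgk] := laplacian_finsupp_ex hG gs.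
pose H' (f g : E) := finsupp f /\ H f g.
have HD f1 g1 f2 g2 : H' f1 g1 -> H' f2 g2 -> H' (f1 + f2) (g1 + g2).
  move=> [[X1 s1] h1] [[X2 s2] h2]; split; last exact: (HmaxD hG h1 h2).
  exists (X1 `|` X2)%fset => x; rewrite inE negb_or => /andP[x1 x2].
  by rewrite l2hD s1 // s2 // addr0.
have HZ a f1 g1 : H' f1 g1 -> H' (a *: f1) (a *: g1).
  move=> [[X1 s1] h1]; split; last exact: (HmaxZ hG a h1).
  by exists X1 => x /s1 e; rewrite l2hZ e mulr0.
have Hsym f1 g1 f2 g2 : H' f1 g1 -> H' f2 g2 -> dot f1 g2 = dot g1 f2.
  by move=> [s1 h1] [s2 h2]; exact: (Hmax_symmetric_fs hG s1 h1 h2).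
have Hge0 f1 g1 : H' f1 g1 -> 0 <= rd f1 g1.
  by move=> [s1 h1]; have /andP[] := bounded_form_fs s1 h1.
have := rel_rd_sqr_le HD HZ Hsym Hge0 (conj gs hgk) (conj fs hfg).
have /andP[_ b1] := bounded_form_fs gs hgk; have /andP[a0 b2] := bounded_form_fs fs hfg.
rewrite -/(nsq g) => hle.
have [g0|gn] := eqVneq (nsq g) 0; first by rewrite g0 mulr_ge0 ?sqr_ge0 ?nsq_ge0.
have gp : 0 < nsq g by rewrite lt_neqAle eq_sym gn nsq_ge0.
rewrite -(ler_pM2l gp) -expr2; apply: le_trans hle _.
have -> : nsq g * ((2 * M) ^+ 2 * nsq f) = (2 * M * nsq g) * (2 * M * nsq f) by ring.
by apply: ler_pM => //; have /andP[] := bounded_form_fs gs hgk.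
Qed.

Lemma bounded_lip_fs f g f' g' : finsupp f -> finsupp f' -> H f g -> H f' g' ->
  nrm (g - g') <= 2 * M * nrm (f - f').
Proof.
move=> [X s] [X' s'] h h'.
have fs : finsupp (f - f').
  exists (X `|` X')%fset => x; rewrite inE negb_or => /andP[x1 x2].
  by rewrite l2hD l2hN s // s' // subr0.
apply: le_nrm_sqr; first by rewrite !mulr_ge0 ?nrm_ge0.
by rewrite exprMn nrm_sqr; exact: (bounded_norm_fs fs (HmaxB hG h h')).
Qed.

Lemma bounded_limit (u v : nat -> E) f : (forall n, finsupp (u n)) ->
  (forall n, H (u n) (v n)) -> hcvg u f -> exists g, hcvg v g.
Proof.
move=> us huv /hcvgP lu; apply: cauchy_hcvg => e e0.
have b0 : 0 < 2 * M + 1 by rewrite ltr_wpDl // mulr_ge0.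
have [|N hN] := lu (e / 2 / (2 * M + 1)); first by rewrite !divr_gt0.
exists N => i j Ni Nj; apply: le_lt_trans (bounded_lip_fs (us i) (us j) (huv i) (huv j)) _.
have hd : nrm (u i - u j) < e / (2 * M + 1).
  apply: le_lt_trans (nrm_dist _ f _) _; rewrite (nrmBC f).
  rewrite [ltRHS]splitr mulrAC; apply: ltrD; [exact: hN i Ni|exact: hN j Nj].
move: hd; rewrite ltr_pdivlMr // => hd; apply: le_lt_trans hd.
by rewrite mulrC ler_wpM2l ?nrm_ge0 // lerDl.
Qed.

Lemma bounded_total f : exists (g : E) (u v : nat -> E), [/\ H f g, forall n, finsupp (u n),
    forall n, H (u n) (v n), hcvg u f & hcvg v g].
Proof.
have [u [us lu]] := finsupp_dense f.
have /choice [v hv] := fun n => laplacian_finsupp_ex hG (us n).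
have [g lv] := bounded_limit us hv lu.
by exists g, u, v; split=> //; exact: (Hmax_closed hG hv lu lv).
Qed.

Lemma Hmax_uniq f g g' : H f g -> H f g' -> g = g'.
Proof. by move=> h h'; apply: l2_eqP => x; rewrite h h'. Qed.

Lemma bounded_core : has_core G theta m_gt0.
Proof.
move=> f g h; have [g' [u [v [h' us uv lu lv]]]] := bounded_total f.
by exists u, v; split=> //; rewrite (Hmax_uniq h h').
Qed.

Lemma bounded_form f g : H f g -> 0 <= rd f g <= 2 * M * nsq f.
Proof.
move=> /bounded_core [u [v [us uv lu lv]]]; apply/andP; split.
  apply: (ler_cvg_to (cvg_cst 0) (hcvg_rd lu lv)); apply: nearW => n.
  by have /andP[] := bounded_form_fs (us n) (uv n).
have hc : 2 * M * nsq (u n) @[n --> \oo] --> 2 * M * nsq f.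
  by apply: cvgMr; exact: hcvg_nsq.
apply: (ler_cvg_to (hcvg_rd lu lv) hc); apply: nearW => n.
by have /andP[] := bounded_form_fs (us n) (uv n).
Qed.

Lemma bounded_norm f g : H f g -> nsq g <= (2 * M) ^+ 2 * nsq f.
Proof.
move=> /bounded_core [u [v [us uv lu lv]]].
have hc : (2 * M) ^+ 2 * nsq (u n) @[n --> \oo] --> (2 * M) ^+ 2 * nsq f.
  by apply: cvgMr; exact: hcvg_nsq.
apply: (ler_cvg_to (hcvg_nsq lv) hc); apply: nearW => n.
exact: (bounded_norm_fs (us n) (uv n)).
Qed.

Lemma bounded_op : exists K : E -> E, forall f g, H f g <-> g = K f.
Proof.
have /choice [K hK] : forall f, exists g, H f g.
  by move=> f; have [g [u [v [h _ _ _ _]]]] := bounded_total f; exists g.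
by exists K => f g; split=> [h|-> //]; exact: Hmax_uniq h (hK f).
Qed.

End BoundedLaplacian.

Section FiniteVertexSet.
Context {R : realType} {V : countType}.
Local Notation C := R[i].
Variables (G : wgraph R V) (theta : V -> V -> R).
Variable m_gt0 : forall x, 0 < meas G x.
Hypothesis finV : finite_set [set: V].

Lemma finite_finsupp (f : V -> C) : finsupp f.
Proof. by exists (fset_set [set: V]) => x; rewrite in_fset_set // in_setT. Qed.

Lemma finite_core : has_core G theta m_gt0.
Proof.
move=> f g h; exists (fun=> f), (fun=> g); split=> //; try exact: hcvg_cst.
by move=> _; exact: finite_finsupp.
Qed.

End FiniteVertexSet.

(** * Fibrewise operators and tensor products *)

Section FibreOperators.
Context {R : realType} {V1 V2 : countType}.
Local Notation C := R[i].
Variables (m1 : V1 -> R) (m2 : V2 -> R).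
Hypothesis m1_gt0 : forall x, 0 < m1 x.
Hypothesis m2_gt0 : forall y, 0 < m2 y.
Local Notation mp := (fun z : V1 * V2 => m1 z.1 * m2 z.2).
Hypothesis mp_gt0 : forall z, 0 < mp z.
Hypothesis finV2 : finite_set [set: V2].
Local Notation E := (@l2h R (V1 * V2)%type mp mp_gt0).
Local Notation E2 := (l2h m2_gt0).
Local Notation Y2 := (fset_set [set: V2]).
Implicit Types (f g : E) (F : V1 * V2 -> C) (X : {fset V1}).

Lemma finite_l2 (h : V2 -> C) : l2 m2 h.
Proof.
by apply: (@l2_finite _ _ _ m2_gt0 h Y2) => y; rewrite in_fset_set // in_setT.
Qed.

Definition fib F (x : V1) : E2 := mkell2 m2_gt0 (finite_l2 (fun y => F (x, y))).

Lemma fibE F x y : fib F x y = F (x, y). Proof. by []. Qed.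

Lemma nsq2E (h : E2) : nsq h = \sum_(y <- Y2) en m2 h y.
Proof. by apply: nsq_finsupp => y; rewrite in_fset_set // in_setT. Qed.

Lemma sum_fib X (a : V1 * V2 -> C) :
  \sum_(z <- (X `*` Y2)%fset) a z = \sum_(x <- X) \sum_(y <- Y2) a (x, y).
Proof. by rewrite big_imfset2 //= => -[x y] [x' y'] _ _ /= [-> ->]. Qed.

Lemma sumr_fib X (a : V1 * V2 -> R) :
  \sum_(z <- (X `*` Y2)%fset) a z = \sum_(x <- X) \sum_(y <- Y2) a (x, y).
Proof. by rewrite big_imfset2 //= => -[x y] [x' y'] _ _ /= [-> ->]. Qed.

Lemma en_fib X F :
  \sum_(z <- (X `*` Y2)%fset) en mp F z = \sum_(x <- X) m1 x * nsq (fib F x).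
Proof.
rewrite sumr_fib; apply: eq_bigr => x _; rewrite nsq2E mulr_sumr.
by apply: eq_bigr => y _; rewrite /en /= mulrA.
Qed.

Lemma in_Y2 y : y \in Y2. Proof. by rewrite in_fset_set // in_setT. Qed.

Lemma dot_fib f g X : (forall z, z.1 \notin X -> f z = 0) ->
  dot f g = \sum_(x <- X) (m1 x)%:C%C * dot (fib f x) (fib g x).
Proof.
move=> fX; rewrite (@dot_finsupp _ _ _ _ f g (X `*` Y2)%fset); last first.
  by move=> z; rewrite in_fsetM in_Y2 andbT => /fX ->; rewrite conjc0 mul0r.
rewrite sum_fib; apply: eq_bigr => x _.
rewrite (@dot_finsupp _ _ _ _ (fib f x) (fib g x) Y2); last by move=> y; rewrite in_Y2.
by rewrite mulr_sumr; apply: eq_bigr => y _; rewrite rmorphM -mulrA.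
Qed.

Lemma en_fib_le F g (c : R) : 0 <= c -> (forall x, nsq (fib F x) <= c * nsq (fib g x)) ->
  forall Z : {fset V1 * V2}, \sum_(z <- Z) en mp F z <= c * nsq g.
Proof.
move=> c0 h Z; pose X := [fset z.1 | z in Z]%fset.
apply: (@le_trans _ _ (\sum_(z <- (X `*` Y2)%fset) en mp F z)).
  apply: big_fset_subset_le; first exact: en_ge0.
  apply/fsubsetP => z zZ; rewrite in_fsetM in_Y2 andbT.
  by apply/imfsetP; exists z.
rewrite en_fib; apply: (@le_trans _ _ (c * \sum_(z <- (X `*` Y2)%fset) en mp g z)).
  rewrite en_fib mulr_sumr; apply: ler_sum => x _; rewrite mulrCA.
  by rewrite ler_wpM2l // ltW.
by rewrite ler_wpM2l // en_le_nsq.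
Qed.

Lemma fib_l2 F g (c : R) : 0 <= c -> (forall x, nsq (fib F x) <= c * nsq (fib g x)) ->
  l2 mp F.
Proof. by move=> c0 h; exact: (@l2_bound _ _ mp F (c * nsq g) (en_fib_le c0 h)). Qed.

Lemma fib_nsq_le f g (c : R) : 0 <= c -> (forall x, nsq (fib f x) <= c * nsq (fib g x)) ->
  nsq f <= c * nsq g.
Proof. by move=> c0 h; apply: nsq_le_en; exact: en_fib_le. Qed.

Lemma tensor_fun_l2 (h : V1 -> C) (k : V2 -> C) : l2 m1 h -> l2 mp (tensor_fun h k).
Proof.
move=> /(mk_l2 m1_gt0) [h' <-].
pose k' : E2 := mkell2 m2_gt0 (finite_l2 k).
apply: (@l2_bound _ _ mp _ (nsq h' * nsq k')) => Z; pose X := [fset z.1 | z in Z]%fset.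
apply: (@le_trans _ _ (\sum_(z <- (X `*` Y2)%fset) en mp (tensor_fun h' k) z)).
  apply: big_fset_subset_le; first exact: en_ge0.
  apply/fsubsetP => z zZ; rewrite in_fsetM in_Y2 andbT.
  by apply/imfsetP; exists z.
rewrite en_fib; apply: (@le_trans _ _ (\sum_(x <- X) en m1 h' x * nsq k')).
  apply: ler_sum => x _; have -> : fib (tensor_fun h' k) x = h' x *: k' by apply: l2_eqP.
  by rewrite nsqZ mulrA.
by rewrite -mulr_suml ler_wpM2r ?nsq_ge0 // en_le_nsq.
Qed.

(** Truncation in the first variable only, so that it commutes with every operator acting on fibres;
    the result has finite support because V2 is finite. *)
Definition trunc1 n : E -> E := trunc (fun z => below n z.1).

Lemma trunc1_exhausting : exhausting (fun n (z : V1 * V2) => below n z.1).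
Proof. by move=> z; have [N hN] := below_exhausting z.1; exists N. Qed.

Lemma trunc1_cvg f : hcvg (fun n => trunc1 n f) f.
Proof. exact: trunc_cvg trunc1_exhausting. Qed.

Lemma trunc1_supp n : exists X : {fset V1}, forall f z, z.1 \notin X -> trunc1 n f z = 0.
Proof. by have [X hX] := @below_supp V1 n; exists X => f z /hX; rewrite /trunc1 truncE => ->. Qed.

Lemma supp_fib F X : (forall z, z.1 \notin X -> F z = 0) -> finsupp F.
Proof. by move=> h; exists (X `*` Y2)%fset => z; rewrite in_fsetM in_Y2 andbT => /h. Qed.

Lemma trunc1_finsupp n f : finsupp (trunc1 n f).
Proof. by have [X hX] := trunc1_supp n; exact: (supp_fib (hX f)). Qed.

Section FibreRelation.
Variables (phi : V1 -> R) (B : E2 -> E2).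
Hypothesis Bsym : symmetric_op B.

(** The tensor product of multiplication by phi and B, written pointwise; [fibre_rel] below is its
    realization on the maximal domain. *)
Definition fibre_op F (z : V1 * V2) : C := (phi z.1)%:C%C * B (fib F z.1) z.2.

Definition fibre_rel f g : Prop := g = fibre_op f :> (V1 * V2 -> C).

Let Blin := symmetric_linear Bsym.

Lemma fibre_rel_fib f g x : fibre_rel f g -> fib g x = (phi x)%:C%C *: B (fib f x).
Proof. by move=> h; apply: l2_eqP => y; rewrite fibE h. Qed.

Lemma fibre_relP f g : fibre_rel f g <-> forall x, fib g x = (phi x)%:C%C *: B (fib f x).
Proof.
split=> [h x|h]; first exact: fibre_rel_fib.
apply/funext => -[x y]; have := congr1 (fun k : E2 => k y) (h x).
by rewrite fibE.
Qed.

Lemma fibre_op_supp F X : (forall z, z.1 \notin X -> F z = 0) ->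
  forall z, z.1 \notin X -> fibre_op F z = 0.
Proof.
move=> FX [x y] xX; rewrite /fibre_op /=.
have -> : fib F x = 0 by apply: l2_eqP => y'; rewrite fibE FX.
by rewrite (lin0 Blin) mulr0.
Qed.

Lemma fibre_rel_ex f X : (forall z, z.1 \notin X -> f z = 0) -> exists g, fibre_rel f g.
Proof.
move=> fX; have [Z hZ] := supp_fib (fibre_op_supp fX).
have [g hg] := mk_l2 mp_gt0 (l2_finite mp_gt0 hZ).
by exists g.
Qed.

Lemma fib_trunc1 n f x : fib (trunc1 n f) x = if below n x then fib f x else 0.
Proof. by apply: l2_eqP => y; rewrite fibE /trunc1 truncE /=; case: ifP. Qed.

Lemma fibre_rel_trunc n f g : fibre_rel f g -> fibre_rel (trunc1 n f) (trunc1 n g).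
Proof.
move=> h; apply/fibre_relP => x; rewrite !fib_trunc1 (fibre_rel_fib _ h).
by case: ifP => // _; rewrite (lin0 Blin) scaler0.
Qed.

Lemma fibre_rel_trunc_ex n f : exists g, fibre_rel (trunc1 n f) g.
Proof. by have [X hX] := trunc1_supp n; exact: (fibre_rel_ex (hX f)). Qed.

Lemma fibD f g x : fib (f + g) x = fib f x + fib g x. Proof. by apply: l2_eqP. Qed.
Lemma fibZ a f x : fib (a *: f) x = a *: fib f x. Proof. by apply: l2_eqP. Qed.

Lemma fibre_relD f g f' g' : fibre_rel f g -> fibre_rel f' g' -> fibre_rel (f + f') (g + g').
Proof.
move=> h h'; apply/fibre_relP => x.
by rewrite !fibD (fibre_rel_fib _ h) (fibre_rel_fib _ h') (linD Blin) scalerDr.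
Qed.

Lemma fibre_relZ a f g : fibre_rel f g -> fibre_rel (a *: f) (a *: g).
Proof.
move=> h; apply/fibre_relP => x.
by rewrite !fibZ (fibre_rel_fib _ h) (linZ Blin) !scalerA mulrC.
Qed.

Lemma fibre_relB f g f' g' : fibre_rel f g -> fibre_rel f' g' -> fibre_rel (f - f') (g - g').
Proof.
by move=> h h'; rewrite -(scaleN1r f') -(scaleN1r g'); exact: (fibre_relD h (fibre_relZ _ h')).
Qed.

Lemma fibre_rel_sym f g f' g' : fibre_rel f g -> fibre_rel f' g' -> dot f g' = dot g f'.
Proof.
move=> h h'; apply: (hcvg_dot_eq (trunc1_cvg f) (hcvg_cst g') (trunc1_cvg g) (hcvg_cst f')) => n.
have [X hX] := trunc1_supp n; rewrite (dot_fib _ (hX f)) (dot_fib _ (hX g)).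
apply: eq_bigr => x _; rewrite !fib_trunc1 (fibre_rel_fib _ h) (fibre_rel_fib _ h').
case: ifP => _; last by rewrite !dot0l.
by rewrite dotZr dotZl Bsym conjcR.
Qed.

Lemma dot_fibre_delta x y d f : fibre_rel (delta mp_gt0 (x, y)) d ->
  dot d f = (m1 x * m2 y)%:C%C * fibre_op f (x, y).
Proof.
move=> h; have dX z : z.1 \notin [fset x]%fset -> delta mp_gt0 (x, y) z = 0.
  by case: z => x' y'; rewrite inE deltaE xpair_eqE => /negPf /= ->.
have dX' z : z.1 \notin [fset x]%fset -> d z = 0.
  by move=> zX; rewrite h; exact: fibre_op_supp dX z zX.
rewrite (dot_fib f dX') big_seq_fset1 (fibre_rel_fib _ h).
have -> : fib (delta mp_gt0 (x, y)) x = delta m2_gt0 y.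
  by apply: l2_eqP => y'; rewrite fibE !deltaE xpair_eqE eqxx.
rewrite dotZl Bsym dot_delta conjcR /fibre_op /= rmorphM /=; ring.
Qed.

Lemma fibre_rel_closed (u v : nat -> E) f g : (forall n, fibre_rel (u n) (v n)) ->
  hcvg u f -> hcvg v g -> fibre_rel f g.
Proof.
move=> h lu lv; apply/funext => -[x y].
have dX z : z.1 \notin [fset x]%fset -> delta mp_gt0 (x, y) z = 0.
  by case: z => x' y'; rewrite inE deltaE xpair_eqE => /negPf /= ->.
have [d hd] := fibre_rel_ex dX.
have : dot d f = dot (delta mp_gt0 (x, y)) g.
  apply: (hcvg_dot_eq (hcvg_cst d) lu (hcvg_cst (delta mp_gt0 (x, y))) lv) => n.
  by rewrite (fibre_rel_sym hd (h n)).
rewrite (dot_fibre_delta _ hd) dot_delta => /(mulfI _) -> //.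
by rewrite eq_complex /= gt_eqF ?mulr_gt0.
Qed.

Lemma tensor_sum_delta (X : {fset V1}) (h : V1 -> C) x :
  \sum_(x' <- X) (x == x')%:R * h x' = if x \in X then h x else 0.
Proof.
case: ifP => xX.
  rewrite (big_fsetD1 _ xX) /= eqxx mul1r big_seq big1 ?addr0 // => x'.
  by rewrite !inE eq_sym => /andP[/negPf -> _]; rewrite mul0r.
rewrite big_seq big1 // => x' x'X; case: eqVneq => [e|]; last by rewrite mul0r.
by rewrite e x'X in xX.
Qed.

(** Simple tensors satisfy the fibrewise relation, which is linear and closed, so the closure is
    contained in it. Conversely a truncation of f is a finite sum of delta_x tensored with the fibre
    of f over x, and truncations converge together with their images. *)
Lemma tensor_op_fibre : tensor_op m1 m2 (mul_op m1 phi) (lift_rel (fun h k : E2 => k = B h)) =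
  lift_rel fibre_rel.
Proof.
apply: eq_lift_rel => [p [] //|f g]; split.
- move=> [_ _ /= [u [a [hua lu la]]]].
  have /choice [U /choice [A hUA]] : forall n, exists U A : E,
      [/\ u n = U :> (V1 * V2 -> C), a n = A :> (V1 * V2 -> C) & fibre_rel U A].
    move=> n; have [k [F [A [G' [B' [/= hA hB eu ea]]]]]] := hua n.
    have hF i : l2 mp (tensor_fun (F i) (G' i)) by have [] := hA i; move=> h _ _; exact: tensor_fun_l2.
    have hA' i : l2 mp (tensor_fun (A i) (B' i)) by have [] := hA i; move=> _ h _; exact: tensor_fun_l2.
    have /choice [FF eFF] := fun i => mk_l2 mp_gt0 (hF i).
    have /choice [AA eAA] := fun i => mk_l2 mp_gt0 (hA' i).
    exists (\sum_i FF i), (\sum_i AA i); split.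
    + by apply/funext => z; rewrite eu l2h_sum; apply: eq_bigr => i _; rewrite eFF.
    + by apply/funext => z; rewrite ea l2h_sum; apply: eq_bigr => i _; rewrite eAA.
    + elim/big_ind2: _ => [|f1 g1 f2 g2|i _]; last 1 first.
      * apply/funext => -[x y]; rewrite eAA /fibre_op /tensor_fun /=.
        have [_ _ /= ->] := hA i; have [h [k' [ek /= eG eB]]] := hB i.
        have -> : fib (FF i) x = F i x *: h.
          by apply: l2_eqP => y'; rewrite fibE eFF /tensor_fun /= eG.
        by rewrite eB ek (linZ Blin) l2hZ mulrA.
      * apply/fibre_relP => x; have -> : fib (0 : E) x = 0 by apply: l2_eqP.
        by rewrite (lin0 Blin) scaler0.
      * by move=> h h'; exact: fibre_relD.
  have eu : u = (fun n => U n : V1 * V2 -> C) by apply/funext => n; have [] := hUA n.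
  have ea : a = (fun n => A n : V1 * V2 -> C) by apply/funext => n; have [] := hUA n.
  apply: (@fibre_rel_closed U A) => [n||]; first by have [] := hUA n.
    by apply/l2_cvgE; rewrite eu in lu.
  by apply/l2_cvgE; rewrite ea in la.
- move=> h; split; try exact: l2vP.
  exists (fun n => trunc1 n f : V1 * V2 -> C), (fun n => trunc1 n g : V1 * V2 -> C).
  split; try (apply/l2_cvgE; exact: trunc1_cvg).
  move=> n; have [X hX] := trunc1_supp n.
  pose pt (i : 'I_(size X)) := tnth (in_tuple X) i.
  exists (size X), (fun i x => (x == pt i)%:R), (fun i x => (phi x)%:C%C * (x == pt i)%:R).
  exists (fun i => fib (trunc1 n f) (pt i) : V2 -> C).
  exists (fun i => B (fib (trunc1 n f) (pt i)) : V2 -> C).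
  have dl2 i : l2 m1 (fun x => (x == pt i)%:R : C) by exact: l2vP (delta m1_gt0 (pt i)).
  split.
  + move=> i; split=> //=.
    by apply: (@l2_finite _ _ _ m1_gt0 _ [fset pt i]%fset) => x; rewrite inE => /negPf ->; rewrite mulr0.
  + by move=> i; exists (fib (trunc1 n f) (pt i)), (B (fib (trunc1 n f) (pt i))).
  + move=> -[x y]; rewrite /tensor_fun [_.1]/= [_.2]/=.
    have := tensor_sum_delta X (fun x' => fib (trunc1 n f) x' y) x; rewrite (big_tnth _ _ X) => ->.
    by transitivity (trunc1 n f (x, y)) => //; case: ifPn => // xX; exact: hX.
  + move=> -[x y]; rewrite /tensor_fun [_.1]/= [_.2]/=.
    have := tensor_sum_delta X (fun x' => (phi x)%:C%C * B (fib (trunc1 n f) x') y) x.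
    rewrite (big_tnth _ _ X) => e; transitivity (if x \in X then (phi x)%:C%C * B (fib (trunc1 n f) x) y else 0).
      transitivity (fibre_op (trunc1 n f) (x, y)); first by rewrite -(fibre_rel_trunc n h).
      by case: ifPn => // xX; apply: (fibre_op_supp (hX f)).
    by rewrite -e; apply: eq_bigr => i _; rewrite /pt; ring.
Qed.

End FibreRelation.
End FibreOperators.

(** * Form domains and compactness *)

Section CauchySum.
Context {R : realType} {E : hilbert R}.

Lemma cauchy_of_sum (c : R) (u v s : nat -> E) f g : 0 <= c -> hcvg u f -> hcvg v g ->
  (forall i j, nsq (s i - s j) <= nsq (v i - v j) + c * nsq (u i - u j)) ->
  exists h, hcvg s h.
Proof.
move=> c_ge0 lu lt e.
apply: cauchy_hcvg => r r0.
have c1 : 0 < 2 * c + 2 by lra.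
(* Two distances to the limit add up to r / (1 + c), and (1 + c) (r / (1 + c))^2 = r^2 / (1 + c) <=
   r^2. *)
have q0 : 0 < r / (2 * c + 2) by rewrite divr_gt0.
have /hcvgP /(_ _ q0) [N1 h1] := lu; have /hcvgP /(_ _ q0) [N2 h2] := lt.
exists (maxn N1 N2) => i j; rewrite !geq_max => /andP[i1 i2] /andP[j1 j2].
have close (w : nat -> E) l (N0 : nat) : (forall n, (N0 <= n)%N -> nrm (w n - l) < r / (2 * c + 2)) ->
    (N0 <= i)%N -> (N0 <= j)%N -> nsq (w i - w j) < (r / (1 + c)) ^+ 2.
  move=> hw Ni Nj; rewrite -nrm_sqr ltr_sqr ?nnegrE ?nrm_ge0 //; last first.
    by rewrite ltW // divr_gt0 //; lra.
  have -> : r / (1 + c) = r / (2 * c + 2) + r / (2 * c + 2).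
    by field; apply/andP; split; rewrite gt_eqF //; lra.
  by apply: le_lt_trans (nrm_dist _ l _) _; rewrite (nrmBC l); apply: ltrD; apply: hw.
have b1 := close _ _ _ h1 i1 j1; have b2 := close _ _ _ h2 i2 j2.
rewrite -ltr_sqr ?nnegrE ?nrm_ge0 //; last exact: ltW.
rewrite nrm_sqr; apply: le_lt_trans (e i j) _.
have b3 : c * nsq (u i - u j) <= c * (r / (1 + c)) ^+ 2 by rewrite ler_wpM2l // ltW.
apply: lt_le_trans (ltr_leD b2 b3) _.
have -> : (r / (1 + c)) ^+ 2 + c * (r / (1 + c)) ^+ 2 = r ^+ 2 / (1 + c).
  by field; rewrite gt_eqF //; lra.
by rewrite ler_pdivrMr ?ler_peMr ?sqr_ge0 //; lra.
Qed.

End CauchySum.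

Section FibreForms.
Context {R : realType} {V1 V2 : countType}.
Local Notation C := R[i].
Variables (m1 : V1 -> R) (m2 : V2 -> R).
Hypothesis m1_gt0 : forall x, 0 < m1 x.
Hypothesis m2_gt0 : forall y, 0 < m2 y.
Local Notation mp := (fun z : V1 * V2 => m1 z.1 * m2 z.2).
Hypothesis mp_gt0 : forall z, 0 < mp z.
Hypothesis finV2 : finite_set [set: V2].
Local Notation E := (@l2h R (V1 * V2)%type mp mp_gt0).
Local Notation E2 := (l2h m2_gt0).
Implicit Types (f g : E).
Local Notation rel phi B := (@fibre_rel _ _ _ _ _ m2_gt0 mp_gt0 finV2 phi B).

Lemma fibre_rel_uniq phi B f g g' : rel phi B f g -> rel phi B f g' -> g = g'.
Proof. by move=> h h'; apply: l2_eqP => z; rewrite h h'. Qed.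

(** A domain criterion: fibre operators commute with truncation, so a uniform bound on the images of
    truncations puts the full image in l^2. *)
Lemma fibre_rel_bounded phi B f (M : R) : symmetric_op B ->
  (forall n g, rel phi B (trunc1 n f) g -> nsq g <= M) -> exists g, rel phi B f g.
Proof.
move=> Bsym hM.
have e n : fibre_op finV2 phi B (trunc1 n f) =
    fun z => if below n z.1 then fibre_op finV2 phi B f z else 0.
  apply/funext => z; rewrite /fibre_op fib_trunc1; case: ifP => // _.
  by rewrite (lin0 (symmetric_linear Bsym)) mulr0.
have [|g hg] := mk_l2 mp_gt0 (f := fibre_op finV2 phi B f); last by exists g.
apply: (l2_of_trunc (A := fun n z => below n z.1) (M := M)) => [|n g hg|n].
- exact: trunc1_exhausting.
- by apply: (hM n); rewrite /fibre_rel e; apply/funext => z; exact: hg.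
- have [g hg] := fibre_rel_trunc_ex finV2 phi Bsym n f.
  by have := l2vP g; rewrite hg e.
Qed.

Variables (B0 B : E2 -> E2).
Hypothesis Bsym : symmetric_op B.
Hypothesis BB : forall h, B (B h) = B0 h.
Local Notation N := (rel (fun x => (Num.sqrt (m1 x))^-1) B).
Local Notation D := (rel (fun x => (m1 x)^-1) B0).

Lemma sym_square : symmetric_op B0.
Proof. by move=> f g; rewrite -!BB !Bsym. Qed.

Lemma half_comp f n d : N f n -> D f d -> N n d.
Proof.
move=> hN hD; apply/fibre_relP => x.
rewrite (fibre_rel_fib _ hN) (fibre_rel_fib _ hD) (linZ (symmetric_linear Bsym)) BB.
rewrite scalerA -rmorphM /= -invfM -expr2 sqr_sqrtr //; exact: ltW.
Qed.

Lemma half_form f n d : N f n -> D f d -> dot f d = dot n n.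
Proof. by move=> hN hD; exact: (fibre_rel_sym Bsym hN (half_comp hN hD)). Qed.

Lemma half_form_rd f n d : N f n -> D f d -> rd f d = nsq n.
Proof. by move=> hN hD; rewrite /rd (half_form hN hD). Qed.

Lemma half_dom f d : D f d -> exists n, N f n /\ nsq n = rd f d.
Proof.
move=> hD; have [|n hn] := @fibre_rel_bounded (fun x => (Num.sqrt (m1 x))^-1) _ f (nrm f * nrm d) Bsym.
  move=> n g hg; rewrite -(half_form_rd hg (fibre_rel_trunc sym_square n hD)).
  apply: le_trans (rd_le _ _) _; apply: ler_pM; rewrite ?nrm_ge0 //.
    by rewrite ler_wsqrtr ?nsq_trunc_le.
  by rewrite ler_wsqrtr ?nsq_trunc_le.
by exists n; rewrite (half_form_rd hn hD).
Qed.

Variables (K : E -> E) (c : R).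
Hypothesis Klin : is_linear K.
Hypothesis c_ge0 : 0 <= c.
Hypothesis K_form : forall f, 0 <= rd f (K f) <= c * nsq f.
Hypothesis K_norm : forall f, nrm (K f) <= c * nrm f.
Variable H : E -> E -> Prop.
Hypothesis HE : forall f g, H f g <-> D f (g - K f).

Lemma sum_rel f d : D f d -> H f (d + K f).
Proof. by move=> h; apply/HE; rewrite addrK. Qed.

Variable S : E -> E -> Prop.
Hypothesis Sadj : forall f g, S f g <-> (forall h k, S h k -> dot f k = dot g h).
Hypothesis SS : forall f g, H f g <-> exists s, S f s /\ S s g.

Lemma adj_closed (u v : nat -> E) f g : (forall n, S (u n) (v n)) -> hcvg u f -> hcvg v g ->
  S f g.
Proof.
move=> h lu lv; apply/Sadj => k l hkl.
by apply: (hcvg_dot_eq lu (hcvg_cst l) lv (hcvg_cst k)) => n; have /Sadj := h n; exact.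
Qed.

Lemma adjB f g f' g' : S f g -> S f' g' -> S (f - f') (g - g').
Proof.
move=> h h'; apply/Sadj => k l hkl; rewrite !dotBl; congr (_ - _).
  by have /Sadj := h; exact.
by have /Sadj := h'; exact.
Qed.

Lemma sqrt_form f s g : S f s -> S s g -> dot f g = dot s s.
Proof. by move=> /Sadj h1 /h1. Qed.

(* The form of H on truncations is |N u|^2 + <u, K u>; since K is bounded, f is
   in the form domain exactly when its truncations have bounded |N u|. *)
Lemma sqrt_dom f : (exists s, S f s) <-> (exists n, N f n).
Proof.
have hD n := fibre_rel_trunc_ex finV2 (fun x => (m1 x)^-1) sym_square n f.
have /choice [d hd] := hD; have hH n := sum_rel (hd n).
have /choice [s hs] := fun n => (SS _ _).1 (hH n).
pose u n := trunc1 n f.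
have lu : hcvg u f by exact: trunc1_cvg.
split=> [[s0 hs0]|[n0 hn0]].
(* Write u for the truncation of f and g = N u. Then |s_n|^2 = |g|^2 + <u, K u> and <s0, s_n> =
   |g|^2 + <f, K u>; with 2 <s0, s_n> <= |s0|^2 + |s_n|^2 the term |g|^2 is absorbed. The factor 8
   leaves room. *)
- apply: (@fibre_rel_bounded _ _ f (nsq s0 + 8 * (c * nsq f))) => // n g hg.
  have uf : nsq (u n) <= nsq f by exact: nsq_trunc_le.
  have /andP[k0 k1] := K_form (u n).
  have e1 : nsq (s n) = nsq g + rd (u n) (K (u n)).
    by rewrite /nsq /rd -(sqrt_form (hs n).1 (hs n).2) -!/(rd _ _) rdDr (half_form_rd hg (hd n)).
  have e2 : rd s0 (s n) = nsq g + rd f (K (u n)).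
    have -> : rd s0 (s n) = rd f (d n + K (u n)).
      by have /Sadj /(_ _ _ (hs n).2) := hs0; rewrite /rd => ->.
    rewrite rdDr; congr (_ + _); rewrite -(half_form_rd hg (hd n)).
    rewrite /rd /trunc1 trunc_symmetric; congr (complex.Re (dot f _)).
    by apply: (fibre_rel_uniq (hd n)); have := fibre_rel_trunc sym_square n (hd n);
      rewrite /trunc1 trunc_idem.
  have e3 : - rd f (K (u n)) <= c * nsq f.
    apply: le_trans (ler_norm _) _; rewrite normrN; apply: le_trans (rd_norm_le _ _) _.
    have := K_norm (u n) => hk; rewrite -[nsq f]nrm_sqr expr2 mulrCA.
    rewrite ler_wpM2l ?nrm_ge0 //; apply: le_trans hk _; rewrite ler_wpM2l //.
    exact: ler_wsqrtr.
  have e4 : rd s0 (s n) <= (nsq s0 + nsq (s n)) / 2.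
    by have := nsq_ge0 (s0 - s n); rewrite nsqB; lra.
  have c1 : c * nsq (u n) <= c * nsq f by rewrite ler_wpM2l.
  move: (mulr_ge0 c_ge0 (nsq_ge0 f)) (nsq_ge0 s0) e1 e2 e3 e4 k0 k1 c1.
  move: (nsq g) (nsq (s n)) (rd s0 (s n)) (rd f _) (rd (u n) _) (nsq s0) => a1 a2 a3 a4 a5 a6.
  set a := c * nsq f; set a' := c * nsq (u n); lra.
(* The images s_n are Cauchy, as |s_i - s_j|^2 is the form of H at u_i - u_j, at most |N (u_i -
   u_j)|^2 + c |u_i - u_j|^2; then S is closed. *)
- have nB i j : N (u i - u j) (trunc1 i n0 - trunc1 j n0).
    by apply: (fibre_relB Bsym); exact: (fibre_rel_trunc Bsym).
  have e i j : nsq (s i - s j) <= nsq (trunc1 i n0 - trunc1 j n0) + c * nsq (u i - u j).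
    have dB : D (u i - u j) (d i - d j) by exact: (fibre_relB sym_square (hd i) (hd j)).
    rewrite -(half_form_rd (nB i j) dB) /nsq /rd.
    rewrite -(sqrt_form (adjB (hs i).1 (hs j).1) (adjB (hs i).2 (hs j).2)) -!/(rd _ _).
    have -> : d i + K (trunc1 i f) - (d j + K (trunc1 j f)) =
        (d i - d j) + K (u i - u j) by rewrite (linB Klin) opprD addrACA.
    have /andP[_] := K_form (u i - u j); rewrite -[_ <= c * _](lerD2l (rd (u i - u j) (d i - d j))).
    by rewrite -rdDr.
  have [s0 ls] : exists s0, hcvg s s0.
    have lt : hcvg (fun n => trunc1 n n0) n0 by exact: trunc1_cvg.
    exact: (cauchy_of_sum c_ge0 lu lt e).
  by exists s0; apply: (adj_closed (fun n => (hs n).1) lu ls).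
Qed.

End FibreForms.

(** * The finite factor: square root and spectral gap *)

Section FiniteMagneticGraph.
Context {R : realType} {V : countType}.
Local Notation C := R[i].
Variables (G : wgraph R V) (theta : V -> V -> R).
Hypothesis graphG : is_graph G.
Hypothesis magG : magnetic_potential G theta.
Hypothesis finV : finite_set [set: V].
Local Notation m := (meas G).
Variable m_gt0 : forall x, 0 < meas G x.
Local Notation E := (l2h m_gt0).
Local Notation H := (@Hmax _ _ G theta m_gt0).
Implicit Types (f g h : E).
Let hG := graph_lfm graphG magG.

(** Over finitely many vertices every function is in the domain of the Laplacian, hence of the
    chosen root, which is thus a total relation; being its own adjoint, it is single-valued. *)
Lemma finite_laplacian_sqrt : exists B0 B : E -> E,
  [/\ symmetric_op B, forall h, B (B h) = B0 h, forall f g, H f g <-> g = B0 f &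
      sqrt_op m (magnetic_laplacian G theta) = lift_rel (fun f g : E => g = B f)].
Proof.
have [Ssa Sge0 SS] := laplacian_sqrtP hG (finite_core (m_gt0 := m_gt0) finV).
have [S [eS Sadj]] := self_adjoint_relP m_gt0 Ssa.
have SSH f g : (exists h, S f h /\ S h g) <-> H f g.
  rewrite -(lift_relE (fun f g => exists h, S f h /\ S h g)) -op_comp_lift -eS SS.
  by rewrite (magnetic_laplacian_max hG (finite_core (m_gt0 := m_gt0) finV)) lift_relE.
have /choice [B0 hB0] := fun f => laplacian_finsupp_ex hG (finite_finsupp finV (f : E)).
have /choice [B hB] : forall f, exists g, S f g.
  by move=> f; have [g [h _]] := (SSH f (B0 f)).2 (hB0 f); exists g.
have Suniq f g g' : S f g -> S f g' -> g = g'.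
  move=> /Sadj h /Sadj h'; apply: dot_inj => k; rewrite dotC [in RHS]dotC; congr conjc.
  by rewrite -(h _ _ (hB k)) -(h' _ _ (hB k)).
exists B0, B; split.
- by move=> f g; have /Sadj /(_ _ _ (hB g)) := hB f.
- move=> h; apply: l2_eqP => x; have hh := (SSH h (B (B h))).1 (ex_intro _ _ (conj (hB h) (hB (B h)))).
  by rewrite hh -(hB0 h).
- by move=> f g; split=> [h|->]; [apply: l2_eqP => x; rewrite h -(hB0 f)|exact: hB0].
- rewrite eS; congr lift_rel; apply/funext => f; apply/funext => g; apply/propext.
  by split=> [h|->]; [exact: Suniq h (hB f)|exact: hB].
Qed.

Variables B0 B : E -> E.
Hypothesis Bsym : symmetric_op B.
Hypothesis BB : forall h, B (B h) = B0 h.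
Hypothesis HB0 : forall f g, H f g <-> g = B0 f.

Lemma finite_weight_bound : exists2 M : R, 0 <= M &
  forall x (Y : {fset V}), \sum_(y <- Y) weight G x y <= M * m x.
Proof.
pose a x := (m x)^-1 * \sum_(y <- fset_set [set: V]) weight G x y.
have a0 x : 0 <= a x.
  rewrite /a mulr_ge0 ?invr_ge0 ?(ltW (m_gt0 x)) //.
  by apply: sumr_ge0 => y _; exact: (lfm_ge0 hG).
have inV x : x \in fset_set [set: V] by rewrite in_fset_set // in_setT.
exists (\sum_(x <- fset_set [set: V]) a x); first exact: sumr_ge0.
move=> x Y; apply: (@le_trans _ _ (a x * m x)).
  rewrite /a mulrAC mulVf ?gt_eqF // mul1r; apply: big_fset_subset_le.
    by move=> y; exact: (lfm_ge0 hG).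
  by apply/fsubsetP => y _; exact: inV.
by rewrite ler_wpM2r ?(ltW (m_gt0 x)) // (big_fsetD1 _ (inV x)) /= lerDl sumr_ge0.
Qed.

Lemma sqrt_bounded : exists2 b : R, 0 <= b & forall h, nsq (B h) <= b * nsq h.
Proof.
have [M M0 hM] := finite_weight_bound.
exists (2 * M); first exact: mulr_ge0.
move=> h; have -> : nsq (B h) = rd h (B0 h) by rewrite /nsq /rd Bsym BB.
by have /andP[] := bounded_form hG M0 hM (proj2 (HB0 h (B0 h)) erefl).
Qed.

(** Without a gap there are unit vectors w_n with B w_n tending to 0. By compactness of the unit
    sphere a limit f has norm 1 and B f = 0; its form vanishes, so f is parallel, hence zero. *)
Lemma sqrt_gap : ~ trivial_holonomy G theta ->
  exists2 c : R, 0 <= c & forall h, nsq h <= c * nsq (B h).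
Proof.
move=> hol; apply: contrapT => hn.
have [b b0 hb] := sqrt_bounded.
have Blin := symmetric_linear Bsym.
have /choice [w hw] : forall n : nat, exists w : E, nsq w = 1 /\ n.+1%:R * nsq (B w) < 1.
  move=> n; have [h hh] : exists h, n.+1%:R * nsq (B h) < nsq h.
    apply: contrapT => h0; apply: hn; exists n.+1%:R => // h.
    by rewrite leNgt; apply/negP => h1; apply: h0; exists h.
  have hp : 0 < nsq h by apply: le_lt_trans hh; rewrite mulr_ge0 ?nsq_ge0.
  exists ((Num.sqrt (nsq h))^-1%:C%C *: h).
  rewrite (linZ Blin) !nsqZr exprVn sqr_sqrtr ?nsq_ge0 // mulVf ?gt_eqF //; split=> //.
  by rewrite mulrCA -ltr_pdivlMl ?invr_gt0 // invrK mulr1.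
(* With finitely many vertices decay at infinity is vacuous, and the multiplier 1 yields the
   Bolzano-Weierstrass theorem. *)
have [|||s [f [shomo lf]]] := @decaying_multiplier_compact _ _ _ m_gt0 (fun=> 1) w w 1.
- move=> e e0; exists (fset_set [set: V]) => x.
  by rewrite in_fset_set // in_setT.
- by move=> n; rewrite (hw n).1.
- by move=> n x; rewrite mul1r.
have f1 : nsq f = 1.
  have e : (fun n => nsq ((w \o s) n)) = fun=> 1 by apply/funext => n; exact: (hw _).1.
  have l1 := hcvg_nsq lf; rewrite e in l1.
  have l2 : (fun _ : nat => 1 : R) n @[n --> \oo] --> (1 : R) by exact: cvg_cst.
  by apply: cvg_unique l1 l2.
have lB : hcvg (B \o (w \o s)) (B f).
  apply: (hcvg_lin (c := Num.sqrt b) Blin _ _ lf); first exact: sqrtr_ge0.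
  move=> h; apply: le_nrm_sqr; first by rewrite mulr_ge0 ?sqrtr_ge0 ?nrm_ge0.
  by rewrite exprMn nrm_sqr sqr_sqrtr.
have B0' : B f = 0.
  apply/nsq_eq0; apply: cvg_unique (hcvg_nsq lB) _ => //.
  have hs n : (n <= s n)%N.
    by elim: n => // n IH; apply: leq_ltn_trans IH (shomo _ _ _).
  apply: (squeeze_cvgr _ (cvg_cst 0) (@cvg_harmonic R)); apply: nearW => n /=.
  rewrite nsq_ge0 /= /harmonic -[leRHS]mul1r ler_pdivlMr // mulrC.
  apply: le_trans (ltW (hw (s n)).2); rewrite ler_wpM2r ?nsq_ge0 // ler_nat ltnS.
  exact: hs.
have par : parallel G theta f.
  apply: (form_eq0_parallel graphG magG (finite_finsupp finV f) (proj2 (HB0 f (B0 f)) erefl)).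
  by rewrite -BB B0' (lin0 Blin) rd0r.
have f0 : f = 0 by apply: l2_eqP => x; rewrite (parallel_eq0 graphG hol par).
by move: f1; rewrite f0 nsq0 => /eqP; rewrite eq_sym oner_eq0.
Qed.

End FiniteMagneticGraph.

Section InfiniteVertexSet.
Context {R : realType} {V : countType}.
Local Notation C := R[i].
Hypothesis infV : infinite_set [set: V].

Lemma infinite_pickle n : exists x : V, (n <= choice.pickle x)%N.
Proof.
apply: contrapT => h; apply: infV; have [X hX] := @below_supp V n.
apply: (@sub_finite_set _ _ [set` X]); last exact: finite_fset.
move=> x _ /=; apply: contrapT => /negP /hX; rewrite /below => /negbT; rewrite -leqNgt => hx.
by apply: h; exists x.
Qed.

Variable m : V -> R.
Variable m_gt0 : forall x, 0 < m x.
Local Notation E := (l2h m_gt0).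

Lemma infinite_orthogonal (l : seq E) : exists2 f : E, f <> 0 & forall h, h \in l -> dot h f = 0.
Proof.
have [X _ hX] := @infinite_set_fset _ _ (size l).+1 infV.
have [x0 x0X] : exists x0, x0 \in X.
  by apply/fset0Pn; rewrite -cardfs_gt0; exact: leq_trans hX.
pose z (i : 'I_(size l).+1) := nth x0 X i.
have zinj i j : z i = z j -> i = j.
  move=> /eqP; rewrite nth_uniq ?fset_uniq ?(leq_trans (ltn_ord _) hX) // => /eqP e.
  exact: val_inj.
have [c [i0 ci0] hc] := exists_left_kernel
  (\matrix_(i < (size l).+1, j < size l) dot (tnth (in_tuple l) j) (delta m_gt0 (z i)))
  (ltnSn (size l)).
exists (\sum_i c i *: delta m_gt0 (z i)).
  move=> /(congr1 (fun f : E => f (z i0))); rewrite l2h0 l2h_sum (bigD1 i0) //.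
  rewrite big1 => [|i /andP[_ ni]].
    by rewrite l2hZ deltaE eqxx mulr1 /= addr0 => /eqP; rewrite (negPf ci0).
  by rewrite l2hZ deltaE; case: eqVneq => [/zinj e|_]; [by rewrite e eqxx in ni|exact: mulr0].
move=> h /(tnthP (in_tuple l)) [j ->]; rewrite dot_sumr -[RHS](hc j).
by apply: eq_bigr => i _; rewrite dotZr mxE.
Qed.

End InfiniteVertexSet.

(** * Compact and non-compact resolvents over the fibres *)

Section FibreCompactness.
Context {R : realType} {V1 V2 : countType}.
Local Notation C := R[i].
Variables (m1 : V1 -> R) (m2 : V2 -> R).
Hypothesis m1_gt0 : forall x, 0 < m1 x.
Hypothesis m2_gt0 : forall y, 0 < m2 y.
Local Notation mp := (fun z : V1 * V2 => m1 z.1 * m2 z.2).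
Hypothesis mp_gt0 : forall z, 0 < mp z.
Hypothesis finV2 : finite_set [set: V2].
Local Notation E := (@l2h R (V1 * V2)%type mp mp_gt0).
Local Notation E2 := (l2h m2_gt0).
Implicit Types (f g : E).
Local Notation rel phi B := (@fibre_rel _ _ _ _ _ m2_gt0 mp_gt0 finV2 phi B).
Variables (B0 B : E2 -> E2).
Hypothesis Bsym : symmetric_op B.
Hypothesis BB : forall h, B (B h) = B0 h.
Local Notation isq := (fun x => (Num.sqrt (m1 x))^-1).
Local Notation N := (rel isq B).
Local Notation D := (rel (fun x => (m1 x)^-1) B0).

Lemma isq_sqr x : isq x ^+ 2 = (m1 x)^-1.
Proof. by rewrite exprVn sqr_sqrtr // ltW. Qed.

Lemma isq_gap (c : R) f n : 0 <= c -> (forall h, nsq h <= c * nsq (B h)) -> N f n ->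
  exists w : E, (forall z, w z = (isq z.1)%:C%C * f z) /\ nsq w <= c * nsq n.
Proof.
move=> c0 gap hn; pose W (z : V1 * V2) : C := (isq z.1)%:C%C * f z.
have hle x : nsq (fib m2_gt0 finV2 W x) <= c * nsq (fib m2_gt0 finV2 n x).
  have -> : fib m2_gt0 finV2 W x = (isq x)%:C%C *: fib m2_gt0 finV2 f x by apply: l2_eqP.
  rewrite (fibre_rel_fib _ hn) !nsqZr mulrCA ler_wpM2l ?sqr_ge0 //.
have [w hw] := mk_l2 mp_gt0 (fib_l2 m1_gt0 c0 hle).
exists w; split; first by move=> z; rewrite hw.
by apply: (fib_nsq_le (m2_gt0 := m2_gt0) (finV2 := finV2) m1_gt0 c0) => x; rewrite hw.
Qed.

Lemma isq_dom (b : R) f (w : E) : 0 <= b -> (forall h, nsq (B h) <= b * nsq h) ->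
  (forall z, w z = (isq z.1)%:C%C * f z) -> exists n, N f n.
Proof.
move=> b0 hb hw.
have hle x : nsq (fib m2_gt0 finV2 (fibre_op finV2 isq B f) x) <=
    b * nsq (fib m2_gt0 finV2 w x).
  have -> : fib m2_gt0 finV2 (fibre_op finV2 isq B f) x =
    (isq x)%:C%C *: B (fib m2_gt0 finV2 f x) by apply: l2_eqP.
  have -> : fib m2_gt0 finV2 w x = (isq x)%:C%C *: fib m2_gt0 finV2 f x.
    by apply: l2_eqP => y; rewrite fibE hw.
  by rewrite !nsqZr mulrCA ler_wpM2l ?sqr_ge0.
have [n hn] := mk_l2 mp_gt0 (fib_l2 m1_gt0 b0 hle).
by exists n.
Qed.

Section Resolvent.
Variable c : R.
Hypothesis c_ge0 : 0 <= c.
Hypothesis gap : forall h, nsq h <= c * nsq (B h).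
Hypothesis vanish : forall e : R, 0 < e -> exists X : {fset V1}, forall x, x \notin X -> m1 x < e.
Variables (H : E -> E -> Prop) (T : E -> E).
Hypothesis Hform : forall f g, H f g -> exists d, D f d /\ rd f d <= rd f g.
Hypothesis Tpos : forall f, nsq (T f) <= rd f (T f).
Hypothesis hT : forall f g, H f g <-> f = T (f + g).

(** T u is the decaying multiplier sqrt(m_1) applied to w = m_1^{-1/2} T u. The w are bounded: |w|^2
    <= c <f, D f> <= c <f, H f> <= c |u|^2 with f = T u, where the first step is the gap on each
    fibre. *)
Lemma resolvent_compact (u : nat -> E) : (exists M, forall n, nrm (u n) <= M) ->
  exists (s : nat -> nat) f, {homo s : i j / (i < j)%N} /\ hcvg (T \o (u \o s)) f.
Proof.
move=> [M hM].
have Tle f : nrm (T f) <= nrm f.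
  have := le_trans (Tpos f) (rd_le _ _); rewrite -nrm_sqr expr2.
  have [->|n0] := eqVneq (nrm (T f)) 0; first by rewrite nrm_ge0.
  by rewrite ler_pM2r // lt_neqAle eq_sym n0 nrm_ge0.
have /choice [w hw] : forall n, exists w : E, (forall z, w z = (isq z.1)%:C%C * T (u n) z) /\
    nsq w <= c * M ^+ 2.
  move=> n; have [d [hd dle]] : exists d, D (T (u n)) d /\ rd (T (u n)) d <= rd (T (u n)) (u n - T (u n)).
    by apply/Hform/hT; rewrite addrC subrK.
  have [k [hk ek]] := half_dom m1_gt0 Bsym BB hd.
  have [w [hw wle]] := isq_gap c_ge0 gap hk; exists w; split=> //.
  apply: le_trans wle _; rewrite ler_wpM2l // ek; apply: le_trans dle _.
  rewrite rdBr -/(nsq _); apply: (@le_trans _ _ (rd (T (u n)) (u n))).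
    by rewrite gerBl nsq_ge0.
  apply: le_trans (rd_le _ _) _; rewrite expr2; apply: ler_pM; rewrite ?nrm_ge0 //.
  exact: le_trans (hM n).
have [|||s [f [hs lf]]] := @decaying_multiplier_compact _ _ _ mp_gt0
    (fun z => Num.sqrt (m1 z.1)) w (T \o u) (c * M ^+ 2).
- move=> e e0; have [X hX] := vanish e0; exists (X `*` fset_set [set: V2])%fset => z.
  rewrite in_fsetM in_fset_set // in_setT andbT => /hX h.
  by rewrite sqr_sqrtr ltW // ltW.
- by move=> n; exact: (hw n).2.
- move=> n z; rewrite (hw n).1 mulrA -rmorphM /= divff ?mul1r //.
  by rewrite gt_eqF // sqrtr_gt0.
- by exists s, f.
Qed.

Lemma resolvent_compact_resolvent : compact_resolvent mp (lift_rel H).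
Proof.
have res (f g : E) : resolvent (lift_rel H) (-1) (g : V1 * V2 -> C, f : V1 * V2 -> C) <-> f = T g.
  rewrite /resolvent /= -[X in _ <-> f = T X](subrK f) [_ + f]addrC -hT -lift_relE.
  suff -> : (fun x : V1 * V2 => g x + -1 * f x) = (g - f : E) :> (V1 * V2 -> C) by [].
  by apply/funext => x; rewrite mulN1r.
have res2 p : resolvent (lift_rel H) (-1) p -> exists g : E, p.1 = g :> (V1 * V2 -> C) /\ p.2 = T g :> (V1 * V2 -> C).
  case: p => g f hp; have [f' [k [_ /= ef ek]]] := hp.
  have eg : g = (k + f' : E) :> (V1 * V2 -> C).
    apply/funext => x; rewrite l2hD; have := congr1 (fun h => h x) ek.
    by rewrite /= ef mulN1r => <-; rewrite subrK.
  exists (k + f'); split=> //; move: hp; rewrite eg ef => /res <-.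
  by [].
have Tle f : nsq (T f) <= nsq f.
  have h0 := Tpos f; have := nsq_ge0 (f - T f); rewrite nsqB; lra.
exists (-1); split; first split.
- move=> g /(mk_l2 mp_gt0) [g' <-]; exists (T g' : V1 * V2 -> C); split; first exact/res.
  by move=> f hf; have [g2 [/= eg ->]] := res2 _ hf; have -> : g' = g2 by apply: l2_eqP => x; rewrite eg.
- exists 1 => g f /res2 [g' [/= -> ->]]; rewrite !l2sq_nsq mul1e lee_fin.
  exact: Tle.
- move=> u v [M hM] huv.
  have /choice [U hU] := fun n => res2 _ (huv n).
  have [|s [f [hs lf]]] := @resolvent_compact U.
    exists (Num.sqrt M) => n; apply: ler_wsqrtr; rewrite -lee_fin -l2sq_nsq.
    by have [/= <- _] := hU n.
  exists s, (f : V1 * V2 -> C); split=> //; first exact: l2vP.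
  have -> : v \o s = (fun n => T (U (s n)) : V1 * V2 -> C).
    by apply/funext => n; exact: (hU _).2.
  exact/l2_cvgE.
Qed.

End Resolvent.

Lemma no_compact_resolvent (K : E -> E) (c : R) (H : E -> E -> Prop) (psi : E2) :
  infinite_set [set: V1] -> 
  (forall f, nrm (K f) <= c * nrm f) -> (forall f g, H f g <-> D f (g - K f)) ->
  B0 psi = 0 -> psi <> 0 -> ~ compact_resolvent mp (lift_rel H).
Proof.
move=> inf hK HE psi0 psin [z [_ hcomp]].
have /choice [x hx] := fun n => infinite_pickle inf n.
have F_ex n : exists f : E, (forall w, f w = (w.1 == x n)%:R * ((isq (x n))%:C%C * psi w.2)) .
  have [|f hf] := mk_l2 mp_gt0 (f := tensor_fun (fun x' => (x' == x n)%:R)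
     (fun y => (isq (x n))%:C%C * psi y)); last by exists f => w; rewrite hf.
  by apply: (tensor_fun_l2 m1_gt0 m2_gt0) => //; exact: l2vP (delta m1_gt0 (x n)).
have /choice [F hF] := F_ex.
have fibF n x' : fib m2_gt0 finV2 (F n) x' = (x' == x n)%:R *: ((isq (x n))%:C%C *: psi).
  by apply: l2_eqP => y; rewrite fibE hF.
have nF n : nsq (F n) = nsq psi.
  have FX w : w.1 \notin [fset x n]%fset -> F n w = 0.
    by rewrite inE hF => /negPf ->; rewrite mul0r.
  rewrite /nsq /rd (dot_fib m2_gt0 finV2 _ FX) big_seq_fset1 fibF eqxx scale1r.
  rewrite dotZl dotZr conjcR; congr complex.Re; rewrite !mulrA -!rmorphM -mulrA -expr2 isq_sqr.
  by rewrite divff ?gt_eqF // mul1r.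
have HF n : H (F n) (K (F n)).
  apply/HE; rewrite subrr; apply/fibre_relP => x'; rewrite fibF.
  have Blin := symmetric_linear (sym_square Bsym BB).
  rewrite !(linZ Blin) psi0 !scaler0; exact: l2_eqP.
(* D kills F_n, so (H - z) F_n = K F_n - z F_n stays bounded for every z; a compact resolvent at z
   would make a subsequence of F_n converge. *)
have [||s [f [hs l2f]]] := hcomp (fun n => K (F n) - z *: F n : E) (fun n => F n : V1 * V2 -> C).
- exists ((c * Num.sqrt (nsq psi) + Num.sqrt (sqnc z) * Num.sqrt (nsq psi)) ^+ 2) => n.
  rewrite l2sq_nsq lee_fin -nrm_sqr.
  have hle : nrm (K (F n) - z *: F n) <= c * Num.sqrt (nsq psi) + Num.sqrt (sqnc z) * Num.sqrt (nsq psi).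
    apply: le_trans (nrmB _ _) _; rewrite nrmZ.
    have -> : nrm (F n) = Num.sqrt (nsq psi) by rewrite /nrm nF.
    rewrite lerD2r; apply: le_trans (hK _) _; rewrite /nrm nF //.
  by rewrite ler_sqr // nnegrE ?nrm_ge0 // (le_trans (nrm_ge0 _) hle).
- move=> n; rewrite /resolvent /=; exists (F n), (K (F n)); split=> //=.
  by apply/funext => w; rewrite subrK.
have [f' ef] := mk_l2 mp_gt0 l2f => l0.
have lf : hcvg (F \o s) f' by apply/l2_cvgE; rewrite ef.
(* F_n lives over a single point whose code is at least n, so it tends to 0 pointwise and any norm
   limit is 0, against the constant norm |psi|. *)
have f0 : f' = 0.
  have hge n : (n <= s n)%N by elim: n => // n IH; apply: leq_ltn_trans IH (hs _ _ _).
  apply: l2_eqP => w; rewrite l2h0.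
  suff -> : f' = (fun=> 0) :> (V1 * V2 -> C) by [].
  apply: (hcvg_pt_eq lf) => -[x' y]; exists (choice.pickle x').+1 => n hn.
  rewrite /= hF /=; case: eqVneq => [e|_]; last by rewrite mul0r.
  by have := leq_trans (leq_trans hn (hge n)) (hx (s n)); rewrite -e ltnn.
have e : (fun n => nsq ((F \o s) n)) = fun=> nsq psi by apply/funext => n; exact: nF.
have l1 := hcvg_nsq lf; rewrite e f0 nsq0 in l1.
have l2 : (fun _ : nat => nsq psi) n @[n --> \oo] --> nsq psi by exact: cvg_cst.
have ps0 : nsq psi = 0 by apply: cvg_unique l2 l1.
by apply: psin; exact: nsq_eq0.
Qed.

End FibreCompactness.

(** * Discrete cusps *)

Section VertexDegree.
Context {R : realType} {V : countType}.
Variables (G : wgraph R V) (theta : V -> V -> R).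
Hypothesis hG : locally_finite_magnetic G theta.

Lemma degE x (Z : {fset V}) : (nb G x `<=` Z)%fset ->
  deg G x = (meas G x)^-1 * \sum_(y <- Z) weight G x y.
Proof.
move=> /fsubsetP hZ; rewrite /deg; congr (_ * _).
rewrite -(fsbig_widen [set` Z]) //; last first.
  by move=> y [_ /= /negP yZ]; apply: (w_nadj hG); apply: contra yZ; rewrite -(in_nb hG) => /hZ.
by rewrite fsbig_finite //= set_fsetK.
Qed.

Lemma weight_sum_le x (Y : {fset V}) : 0 < meas G x ->
  \sum_(y <- Y) weight G x y <= deg G x * meas G x.
Proof.
move=> mx; rewrite (degE (fsubsetUl (nb G x) Y)) mulrAC mulVf ?gt_eqF // mul1r.
by apply: big_fset_subset_le; [exact: (lfm_ge0 hG)|exact: fsubsetUr].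
Qed.

Lemma deg_ge0 x : 0 < meas G x -> 0 <= deg G x.
Proof.
move=> mx; rewrite (degE (fsubset_refl _)) mulr_ge0 ?invr_ge0 ?(ltW mx) //.
by apply: sumr_ge0 => y _; exact: (lfm_ge0 hG).
Qed.

End VertexDegree.

(** A vertex of degree zero would be the only one, by connectedness. Every function is then
    vacuously parallel, and the constant 1 contradicts [parallel_eq0]. *)
Lemma deg_gt0 (R : realType) (V : countType) (G : wgraph R V) theta (y : V) :
  is_graph G -> ~ trivial_holonomy G theta -> 0 < deg G y.
Proof.
move=> graphG hol; have [[sym w0] m0 _ _ conn] := graphG.
have lfm : locally_finite_magnetic G (fun _ _ => 0).
  have [_ _ _ fin _] := graphG; split=> // a b _.
  by exists 0; rewrite oppr0 mul0r addr0.
rewrite lt_neqAle (deg_ge0 lfm) // andbT eq_sym; apply/negP => /eqP d0.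
have noadj b : adj G y b = false.
  apply: negbTE; rewrite /adj -leNgt.
  have := weight_sum_le lfm [fset b]%fset (m0 y); rewrite d0 mul0r.
  by rewrite big_seq_fset1.
have only a : a = y.
  have [[|b p] [/= hp hl]] := conn y a; first by [].
  by rewrite noadj in hp.
have par : parallel G theta (fun _ => 1 : R[i]).
  by move=> a b; rewrite (only a) noadj.
by have /eqP := parallel_eq0 graphG hol par y; rewrite oner_eq0.
Qed.

Lemma sup_nonneg (R : realType) (T : Type) (a : T -> R) (t0 : T) : (forall t, 0 <= a t) ->
  (ereal_sup (range (fun t => (a t)%:E)) < +oo)%E ->
  [/\ ereal_sup (range (fun t => (a t)%:E)) = (fine (ereal_sup (range (fun t => (a t)%:E))))%:E,
      0 <= fine (ereal_sup (range (fun t => (a t)%:E))) &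
      forall t, a t <= fine (ereal_sup (range (fun t => (a t)%:E)))].
Proof.
move=> a0; set s := ereal_sup _ => soo.
have ub t : ((a t)%:E <= s)%E by apply: ereal_sup_ubound; exists t.
have sfin : s = (fine s)%:E.
  rewrite fineK // ge0_fin_numE //; apply: le_trans (ub t0); rewrite lee_fin; exact: a0.
have h t : a t <= fine s by rewrite -lee_fin -sfin.
by split=> //; exact: le_trans (a0 t0) (h t0).
Qed.

Lemma sup_finite (R : realType) (T : choiceType) (a : T -> R) : finite_set [set: T] ->
  (ereal_sup (range (fun t => (a t)%:E)) < +oo)%E.
Proof.
move=> fin; apply: (@le_lt_trans _ _ (\sum_(t <- fset_set [set: T]) `|a t|)%:E); last exact: ltry.
apply: ub_ereal_sup => _ [t _ <-]; rewrite lee_fin (big_fsetD1 t) /=; last first.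
  by rewrite in_fset_set // in_setT.
by rewrite (le_trans (ler_norm _)) // lerDl sumr_ge0.
Qed.

Section ProductDegree.
Context {R : realType} {V1 V2 : countType}.
Variables (G1 : wgraph R V1) (G2 : wgraph R V2) (I : set V2).
Variables (theta1 : V1 -> V1 -> R) (theta2 : V2 -> V2 -> R).
Hypothesis graphG1 : is_graph G1.
Hypothesis graphG2 : is_graph G2.
Hypothesis mag1 : magnetic_potential G1 theta1.
Hypothesis mag2 : magnetic_potential G2 theta2.
Local Notation m1 := (meas G1).
Local Notation m2 := (meas G2).
Local Notation mp := (fun z : V1 * V2 => m1 z.1 * m2 z.2).

(** The horizontal weights carry no factor m_2 while the measure does, which costs 1/m_2(y) <= q;
    the indicator of I is at most 1. *)
Lemma horiz_weight_sum (d q : R) : (forall x, deg G1 x <= d) -> (forall y, (m2 y)^-1 <= q) ->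
  forall z (Y : {fset V1 * V2}), \sum_(w <- Y) horiz_weight G1 I z w <= d * q * mp z.
Proof.
move=> hd hq [x y] Y; have lfm1 := graph_lfm graphG1 mag1.
have m1x := graph_meas_gt0 graphG1 x; have m2y := graph_meas_gt0 graphG2 y.
pose Z := [fset (x', y) | x' in nb G1 x]%fset.
apply: (@le_trans _ _ (\sum_(w <- (Z `|` Y)%fset) horiz_weight G1 I (x, y) w)).
  apply: big_fset_subset_le; last exact: fsubsetUr.
  by move=> w; exact: (horiz_weight_ge0 I graphG1 mag1).
rewrite -(big_fset_incl _ (fsubsetUl Z Y)); last first.
  move=> [x' y'] _ h; rewrite /horiz_weight /=; case: eqVneq => [e|_]; last by rewrite mulr0 mul0r.
  subst y'; rewrite (w_nadj lfm1) ?mul0r //; apply: contra h => a.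
  by apply/imfsetP; exists x' => //=; rewrite (in_nb lfm1).
rewrite /Z big_imfset /=; last by move=> a b _ _ [].
apply: (@le_trans _ _ (\sum_(x' <- nb G1 x) weight G1 x x')).
  apply: ler_sum => x' _; rewrite /horiz_weight /= eqxx mulr1 ler_piMr ?(lfm_ge0 lfm1) //.
apply: le_trans (weight_sum_le lfm1 _ m1x) _.
have d0 : 0 <= deg G1 x by exact: (deg_ge0 lfm1).
have q1 : 1 <= q * m2 y by rewrite -ler_pdivrMr ?div1r.
have -> : d * q * (m1 x * m2 y) = d * m1 x * (q * m2 y) by ring.
apply: (@le_trans _ _ (d * m1 x)); first by rewrite ler_wpM2r ?(ltW m1x).
by rewrite ler_peMr // mulr_ge0 ?(ltW m1x) // (le_trans d0).
Qed.

Lemma prod_deg_bounds (M : R) x y :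
  (forall z (Y : {fset V1 * V2}), \sum_(w <- Y) horiz_weight G1 I z w <= M * mp z) ->
  deg G2 y / m1 x <= deg (prod_graph G1 G2 I) (x, y) <= M + deg G2 y / m1 x.
Proof.
move=> hM; have lfm1 := graph_lfm graphG1 mag1; have lfm2 := graph_lfm graphG2 mag2.
have m1x := graph_meas_gt0 graphG1 x; have m2y := graph_meas_gt0 graphG2 y.
have hG := prod_lfm I graphG1 graphG2 mag1 mag2.
pose W := [fset (x, y') | y' in nb G2 y]%fset.
pose Z := (nb (prod_graph G1 G2 I) (x, y) `|` W)%fset.
rewrite (degE hG (fsubsetUl _ W)) -/Z.
have -> : \sum_(w <- Z) weight (prod_graph G1 G2 I) (x, y) w =
    \sum_(w <- Z) horiz_weight G1 I (x, y) w + \sum_(w <- Z) vert_weight G2 (x, y) w.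
  by rewrite -big_split.
have -> : \sum_(w <- Z) vert_weight G2 (x, y) w = deg G2 y * m2 y.
  rewrite -(big_fset_incl _ (fsubsetUr _ W)); last first.
    move=> [x' y'] _ h; rewrite /vert_weight /=; case: eqVneq => [e|_]; last by rewrite mul0r.
    subst x'; rewrite mul1r (w_nadj lfm2) //; apply: contra h => a.
    by apply/imfsetP; exists y' => //=; rewrite (in_nb lfm2).
  rewrite (degE lfm2 (fsubset_refl _)) mulrAC mulVf ?gt_eqF // mul1r.
  rewrite /W big_imfset /=; last by move=> a b _ _ [].
  by apply: eq_bigr => y' _; rewrite /vert_weight /= eqxx mul1r.
have h0 : 0 <= \sum_(w <- Z) horiz_weight G1 I (x, y) w.
  by apply: sumr_ge0 => w _; exact: (horiz_weight_ge0 I graphG1 mag1).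
have h1 := hM (x, y) Z; rewrite /= in h1.
set s := \sum_(w <- Z) _ in h0 h1 *; have mm : 0 < m1 x * m2 y by rewrite mulr_gt0.
have -> : (meas (prod_graph G1 G2 I) (x, y))^-1 * (s + deg G2 y * m2 y) =
    s / (m1 x * m2 y) + deg G2 y / m1 x.
  by rewrite /=; field; rewrite !gt_eqF.
by rewrite lerDr lerD2r divr_ge0 ?(ltW mm) //= ler_pdivrMr.
Qed.

End ProductDegree.

Lemma eq_dom_lift (R : realType) (V : countType) (m : V -> R) (m_gt0 : forall x, 0 < m x)
    (S N : l2h m_gt0 -> l2h m_gt0 -> Prop) :
  (forall f, (exists g, S f g) <-> (exists g, N f g)) -> dom (lift_rel S) = dom (lift_rel N).
Proof.
move=> h; apply/seteqP; split=> [f|f] [g hg]; have [/= /(mk_l2 m_gt0) [f' ef] _] := lift_rel_l2 hg.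
  have {hg}: dom (lift_rel S) (f' : V -> R[i]) by rewrite ef; exists g.
  by rewrite -ef !lift_rel_dom h.
have {hg}: dom (lift_rel N) (f' : V -> R[i]) by rewrite ef; exists g.
by rewrite -ef !lift_rel_dom h.
Qed.

Section CuspOperators.
Context {R : realType} {V1 V2 : countType}.
Local Notation C := R[i].
Variables (G1 : wgraph R V1) (G2 : wgraph R V2) (I : set V2).
Variables (theta1 : V1 -> V1 -> R) (theta2 : V2 -> V2 -> R).
Hypothesis graphG1 : is_graph G1.
Hypothesis graphG2 : is_graph G2.
Hypothesis mag1 : magnetic_potential G1 theta1.
Hypothesis mag2 : magnetic_potential G2 theta2.
Hypothesis finV2 : finite_set [set: V2].
Local Notation m1 := (meas G1).
Local Notation m2 := (meas G2).
Local Notation mp := (fun z : V1 * V2 => m1 z.1 * m2 z.2).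
Variable M : R.
Hypothesis M_ge0 : 0 <= M.
Hypothesis hM : forall z (Y : {fset V1 * V2}), \sum_(w <- Y) horiz_weight G1 I z w <= M * mp z.
Local Notation G := (prod_graph G1 G2 I).
Local Notation theta := (prod_potential G1 G2 I theta1 theta2).
Let m1_gt0 := graph_meas_gt0 graphG1.
Let m2_gt0 := graph_meas_gt0 graphG2.
Let mp_gt0 := prod_meas_gt0 graphG1 graphG2.
Local Notation E := (@l2h R (V1 * V2)%type mp mp_gt0).
Local Notation E2 := (@l2h R V2 m2 m2_gt0).
Local Notation H := (@Hmax R (V1 * V2)%type G theta mp_gt0).
Local Notation L2 := (@Hmax R V2 G2 theta2 m2_gt0).
Local Notation rel phi B := (@fibre_rel _ _ _ _ _ m2_gt0 mp_gt0 finV2 phi B).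
Implicit Types (f g : E).
Let lfmH := horiz_lfm I graphG1 graphG2 mag1 mag2.
Let lfmV := vert_lfm I graphG1 graphG2 mag1 mag2.
Let lfmG := prod_lfm I graphG1 graphG2 mag1 mag2.
Variables B0 B : E2 -> E2.
Hypothesis Bsym : symmetric_op B.
Hypothesis BB : forall h, B (B h) = B0 h.
Hypothesis HB0 : forall h k, L2 h k <-> k = B0 h.
Local Notation D := (rel (fun x => (m1 x)^-1) B0).
Local Notation N := (rel (fun x => (Num.sqrt (m1 x))^-1) B).

Lemma vert_fibre f g : @Hmax _ _ (vert_graph G1 G2) theta mp_gt0 f g <-> D f g.
Proof.
have e : formal_laplacian (vert_graph G1 G2) theta f = fibre_op finV2 (fun x => (m1 x)^-1) B0 f.
  apply/funext => -[x y]; rewrite (vert_laplacian G1 I theta1 graphG2 mag2) /fibre_op.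
  have hB := (HB0 (fib m2_gt0 finV2 f x) _).2 erefl.
  by rewrite [B0 _ _](congr1 (fun h : V2 -> C => h y) hB).
by rewrite /Hmax /fibre_rel e.
Qed.

Lemma cusp_bounded_part : exists K : E -> E, [/\ is_linear K,
  forall f, 0 <= rd f (K f) <= 2 * M * nsq f, forall f, nrm (K f) <= 2 * M * nrm f &
  forall f g, H f g <-> D f (g - K f)].
Proof.
have [K hK] := bounded_op lfmH mp_gt0 M_ge0 hM.
have HK f : @Hmax _ _ (horiz_graph G1 G2 I) theta mp_gt0 f (K f) by exact/hK.
exists K; split.
- by move=> a f g; apply/esym/hK; exact: (HmaxD lfmH (HmaxZ lfmH a (HK f)) (HK g)).
- by move=> f; exact: (bounded_form lfmH M_ge0 hM (HK f)).
- move=> f; apply: le_nrm_sqr; first by rewrite !mulr_ge0 ?nrm_ge0.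
  by rewrite exprMn nrm_sqr; exact: (bounded_norm lfmH M_ge0 hM (HK f)).
- move=> f g; rewrite -vert_fibre; split=> h; apply/funext => z.
    rewrite l2hD l2hN [g z](congr1 (fun h : V1 * V2 -> C => h z) h).
    rewrite (prod_laplacian_split I graphG1 graphG2 mag1 mag2).
    by rewrite [K f z](congr1 (fun h : V1 * V2 -> C => h z) (HK f)) addrAC subrr add0r.
  rewrite (prod_laplacian_split I graphG1 graphG2 mag1 mag2).
  rewrite -[formal_laplacian (horiz_graph _ _ _) _ _ z](congr1 (fun h : V1 * V2 -> C => h z) (HK f)).
  rewrite -[formal_laplacian (vert_graph _ _) _ _ z](congr1 (fun h : V1 * V2 -> C => h z) h).
  by rewrite l2hD l2hN addrC subrK.
Qed.

Let B0sym := sym_square Bsym BB.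

Lemma vert_core : has_core (vert_graph G1 G2) theta mp_gt0.
Proof.
move=> f g /vert_fibre h; exists (fun n => trunc1 n f), (fun n => trunc1 n g); split.
- by move=> n; exact: (trunc1_finsupp finV2).
- by move=> n; apply/vert_fibre; exact: (fibre_rel_trunc B0sym n h).
- exact: trunc1_cvg.
- exact: trunc1_cvg.
Qed.

Variable K : E -> E.
Hypothesis Klin : is_linear K.
Hypothesis K_form : forall f, 0 <= rd f (K f) <= 2 * M * nsq f.
Hypothesis K_norm : forall f, nrm (K f) <= 2 * M * nrm f.
Hypothesis HE : forall f g, H f g <-> D f (g - K f).

(** D commutes with truncation and K is continuous, so truncating D f and adding K of the truncated
    f gives images converging to H f. *)
Lemma prod_core : has_core G theta mp_gt0.
Proof.
move=> f g /HE h; exists (fun n => trunc1 n f), (fun n => trunc1 n (g - K f) + K (trunc1 n f)); split.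
- by move=> n; exact: (trunc1_finsupp finV2).
- by move=> n; apply/HE; rewrite addrK; exact: (fibre_rel_trunc B0sym n h).
- exact: trunc1_cvg.
- rewrite -[g in hcvg _ g](subrK (K f)); apply: hcvgD; first exact: trunc1_cvg.
  by apply: (hcvg_lin Klin _ K_norm); [exact: mulr_ge0|exact: trunc1_cvg].
Qed.

Lemma cusp_sqrt_dom : dom (sqrt_op mp (magnetic_laplacian G theta)) = dom (lift_rel N).
Proof.
have [Ssa _ SS] := laplacian_sqrtP lfmG prod_core.
have [S [eS Sadj]] := self_adjoint_relP mp_gt0 Ssa.
have SSH f g : H f g <-> exists s, S f s /\ S s g.
  rewrite -[X in _ <-> X](lift_relE (fun f g => exists h, S f h /\ S h g)) -op_comp_lift -eS SS.
  by rewrite (magnetic_laplacian_max lfmG prod_core) lift_relE.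
rewrite eS; apply: eq_dom_lift => f.
exact: (sqrt_dom m1_gt0 Bsym BB Klin (mulr_ge0 (ler0n _ 2) M_ge0) K_form K_norm HE Sadj SSH).
Qed.

Lemma cusp_form f g : H f g -> exists d, D f d /\ rd f d <= rd f g.
Proof.
move=> /HE h; exists (g - K f); split=> //; rewrite rdBr gerBl.
by have /andP[] := K_form f.
Qed.

Lemma fibre_form f d : D f d -> exists g, H f g /\ rd f g <= rd f d + 2 * M * nsq f.
Proof.
move=> h; exists (d + K f); split; first by apply/HE; rewrite addrK.
by rewrite rdDr lerD2l; have /andP[] := K_form f.
Qed.

Hypothesis infV1 : infinite_set [set: V1].
Hypothesis vanish : forall e : R, 0 < e -> exists X : {fset V1}, forall x, x \notin X -> m1 x < e.
Variable y0 : V2.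

Lemma trivial_holonomy_not_compact : trivial_holonomy G2 theta2 ->
  ~ compact_resolvent mp (magnetic_laplacian G theta).
Proof.
move=> hol; rewrite (magnetic_laplacian_max lfmG prod_core).
have [psi [hpsi psin]] := parallel_ex graphG2 y0 hol.
have [p ep] := mk_l2 m2_gt0 (finite_l2 m2_gt0 finV2 psi).
apply: (no_compact_resolvent m1_gt0 Bsym BB (psi := p) infV1 K_norm HE).
  have hB := (HB0 p _).2 erefl; apply: l2_eqP => y.
  rewrite [B0 p y](congr1 (fun h : V2 -> C => h y) hB) ep.
  exact: (parallel_harmonic graphG2 mag2 hpsi).
by move=> p0; have := psin y0; rewrite -ep p0 l2h0 eqxx.
Qed.

Hypothesis hol : ~ trivial_holonomy G2 theta2.

Lemma infinite_product : infinite_set [set: V1 * V2].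
Proof.
move=> fin; apply: infV1; have : finite_set (fst @` [set: V1 * V2]) by exact: finite_image.
by apply: sub_finite_set => x _; exists (x, y0).
Qed.

Lemma cusp_compact_resolvent : compact_resolvent mp (magnetic_laplacian G theta).
Proof.
rewrite (magnetic_laplacian_max lfmG prod_core).
have [c c0 gap] := sqrt_gap graphG2 mag2 finV2 Bsym BB HB0 hol.
have [T [_ Tpos _ hT]] := Hmax_resolvent lfmG prod_core.
exact: (resolvent_compact_resolvent m1_gt0 Bsym BB c0 gap vanish cusp_form Tpos hT).
Qed.

Lemma cusp_eigenbasis : exists e lam, @eigenbasis R E e lam H.
Proof.
have [c c0 gap] := sqrt_gap graphG2 mag2 finV2 Bsym BB HB0 hol.
have [T [Tsym Tpos Tinj hT]] := Hmax_resolvent lfmG prod_core.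
have Tc := resolvent_compact m1_gt0 Bsym BB c0 gap vanish cusp_form Tpos hT.
have Einf := @infinite_orthogonal R (V1 * V2)%type infinite_product _ mp_gt0.
exact: (compact_resolvent_eigenbasis Tsym Tpos Tinj Tc Einf hT).
Qed.

Lemma fibre_eigenbasis : exists e lam, @eigenbasis R E e lam D.
Proof.
have [c c0 gap] := sqrt_gap graphG2 mag2 finV2 Bsym BB HB0 hol.
have [T [Tsym Tpos Tinj hT]] := Hmax_resolvent lfmV vert_core.
have hT' f g : D f g <-> f = T (f + g) by rewrite -vert_fibre.
have Dform f g : D f g -> exists d, D f d /\ rd f d <= rd f g by exists g.
have Tc := resolvent_compact m1_gt0 Bsym BB c0 gap vanish Dform Tpos hT'.
have Einf := @infinite_orthogonal R (V1 * V2)%type infinite_product _ mp_gt0.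
exact: (compact_resolvent_eigenbasis Tsym Tpos Tinj Tc Einf hT').
Qed.

(** The degree of G is comparable to 1/m_1 up to a bounded term, since deg_{G_2} is positive on a
    finite set. The gap and the boundedness of B identify the domain of N with that of
    m_1^{-1/2}. *)
Lemma cusp_deg_dom : dom (lift_rel N) = dom (mul_op mp (fun z => Num.sqrt (deg G z))).
Proof.
have [c c0 gap] := sqrt_gap graphG2 mag2 finV2 Bsym BB HB0 hol.
have [b b0 hb] := sqrt_bounded graphG2 mag2 finV2 Bsym BB HB0.
pose Y := fset_set [set: V2]; have inY y : y \in Y by rewrite in_fset_set // in_setT.
have d0 y := deg_gt0 y graphG2 hol.
(* Sums in place of maxima: s bounds every 1/deg_{G_2} and A every deg_{G_2}. *)
pose s := \sum_(y <- Y) (deg G2 y)^-1; pose A := \sum_(y <- Y) deg G2 y.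
have s0 : 0 <= s by apply: sumr_ge0 => y _; rewrite invr_ge0 ltW.
have A0 : 0 <= A by apply: sumr_ge0 => y _; rewrite ltW.
have hs y : 1 <= s * deg G2 y.
  rewrite -ler_pdivrMr // div1r /s (big_fsetD1 _ (inY y)) /= lerDl.
  by apply: sumr_ge0 => y' _; rewrite invr_ge0 ltW.
have hA y : deg G2 y <= A.
  by rewrite /A (big_fsetD1 _ (inY y)) /= lerDl; apply: sumr_ge0 => y' _; rewrite ltW.
have dG z : (m1 z.1)^-1 <= s * deg G z /\ 0 <= deg G z <= M + A / m1 z.1.
  case: z => x y; have mi : 0 <= (m1 x)^-1 by rewrite invr_ge0 ltW // m1_gt0.
  have /andP[h1 h2] := prod_deg_bounds graphG1 graphG2 mag1 mag2 x y hM.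
  split; [|apply/andP; split].
  - rewrite -[leLHS]mul1r; apply: le_trans (ler_wpM2r mi (hs y)) _.
    by rewrite -mulrA ler_wpM2l.
  - by apply: le_trans h1; rewrite mulr_ge0 // ltW.
  - by apply: le_trans h2 _; rewrite lerD2l ler_wpM2r.
have isq z : (Num.sqrt (m1 z.1))^-1 ^+ 2 = (m1 z.1)^-1 :> R.
  by rewrite exprVn sqr_sqrtr // ltW // m1_gt0.
have -> : mul_op mp (fun z => Num.sqrt (deg G z)) =
    lift_rel (fun f g : E => forall z, g z = (Num.sqrt (deg G z))%:C%C * f z).
  apply: eq_lift_rel => [p [] //|f g]; split; first by case.
  by move=> h; split=> //; exact: l2vP.
apply: eq_dom_lift => f; split.
- move=> [n hn]; have [w [hw _]] := isq_gap m1_gt0 c0 gap hn.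
  pose F z : C := (Num.sqrt (deg G z))%:C%C * f z.
  have lF : l2 mp F.
    apply: (@l2_bound _ _ mp F (M * nsq f + A * nsq w)) => X.
    apply: le_trans (lerD (ler_wpM2l M_ge0 (en_le_nsq f X)) (ler_wpM2l A0 (en_le_nsq w X))).
    rewrite !mulr_sumr -big_split; apply: ler_sum => z _ /=.
    have [_ /andP[g0 g1]] := dG z.
    rewrite /en /F hw !sqncM !sqncR isq sqr_sqrtr //.
    have k0 : 0 <= mp z * sqnc (f z) by rewrite mulr_ge0 ?sqnc_ge0 ?(ltW (mp_gt0 z)).
    by have := ler_wpM2l k0 g1; rewrite /=; lra.
  by have [g hg] := mk_l2 mp_gt0 lF; exists g => z; rewrite hg.
- move=> [g hg]; pose W z : C := ((Num.sqrt (m1 z.1))^-1)%:C%C * f z.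
  have lW : l2 mp W.
    apply: (@l2_le _ _ _ mp_gt0 W g s _ (l2vP g)) => z; have [h1 /andP[g0 g1]] := dG z.
    rewrite /W hg !sqncM !sqncR isq sqr_sqrtr // mulrA.
    by rewrite ler_wpM2r ?sqnc_ge0.
  have [w hw] := mk_l2 mp_gt0 lW.
  by apply: (isq_dom m1_gt0 finV2 (w := w) b0 hb) => z; rewrite hw.
Qed.

Lemma cusp_eigenvalues : exists lambda mu : nat -> R,
  [/\ eigenvalue_seq (magnetic_laplacian G theta) lambda, eigenvalue_seq (lift_rel D) mu &
      (lambda n / mu n) @[n --> \oo] --> (1 : R)].
Proof.
have [e [lam he]] := cusp_eigenbasis; have [e' [mu he']] := fibre_eigenbasis.
exists lam, mu; split.
- by rewrite (magnetic_laplacian_max lfmG prod_core); exact: (eigenvalue_seq_eigenbasis he).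
- exact: (eigenvalue_seq_eigenbasis he').
have le1 n : mu n <= lam n.
  rewrite -[lam n]addr0; apply: (eigenvalue_minmax he he') => f g /cusp_form [d [h1 h2]].
  by exists d; rewrite mul0r addr0.
have le2 n : lam n <= mu n + 2 * M := eigenvalue_minmax he' he fibre_form n.
have [_ _ _ muoo _] := he'.
apply/cvgrPdist_lt => r r0.
(* Beyond this threshold 0 <= lam_n / mu_n - 1 <= 2M / mu_n < r. *)
have [N0 hN] := muoo (2 * M / r); exists N0 => // n Nn.
have mun := hN n Nn; have mup : 0 < mu n.
  by apply: le_lt_trans mun; rewrite divr_ge0 ?mulr_ge0 // ltW.
rewrite /= distrC ger0_norm; last by rewrite subr_ge0 ler_pdivlMr // mul1r.
rewrite ltrBlDr ltr_pdivrMr // mulrDl mul1r; apply: le_lt_trans (le2 n) _.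
by rewrite [ltLHS]addrC ltrD2r -ltr_pdivrMl // mulrC.
Qed.

Lemma cusp_counting (l : R) :
  (eig_count mp (lift_rel D) (l - 2 * M) <= eig_count mp (magnetic_laplacian G theta) l)%E /\
  (eig_count mp (magnetic_laplacian G theta) l <= eig_count mp (lift_rel D) l)%E.
Proof.
rewrite (magnetic_laplacian_max lfmG prod_core).
have [e [lam he]] := cusp_eigenbasis; have [e' [mu he']] := fibre_eigenbasis.
have sH := spectral_measure_ex he; have sD := spectral_measure_ex he'.
have H0 f g : H f g -> 0 <= rd f g by exact: (Hmax_ge0 lfmG prod_core).
have D0 f g : D f g -> 0 <= rd f g by move=> /vert_fibre; exact: (Hmax_ge0 lfmV vert_core).
split.
- apply: (eig_count_le D0 H0 sD sH) => f d /fibre_form [g [h1 h2]] h3.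
  by exists g; split=> //; apply: le_trans h2 _; move: h3; rewrite mulrBl; lra.
- apply: (eig_count_le H0 D0 sH sD) => f g /cusp_form [d [h1 h2]] h3.
  by exists d; split=> //; exact: le_trans h2 h3.
Qed.

End CuspOperators.

Theorem theorem2p14 (R : realType) (V1 V2 : countType)
    (G1 : wgraph R V1) (G2 : wgraph R V2)
    (theta1 : V1 -> V1 -> R) (theta2 : V2 -> V2 -> R)
    (I : set V2) (o : V1)
    (hG1 : is_graph G1) (hG2 : is_graph G2)
    (htheta1 : magnetic_potential G1 theta1)
    (htheta2 : magnetic_potential G2 theta2)
    (hV1 : infinite_set [set: V1]) (hI : I !=set0)
    (hcusp : discrete_cusp o G1 G2) :
  let G := prod_graph G1 G2 I in
  let m1 := meas G1 in
  let m2 := meas G2 in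
  let m := meas G in
  let Delta := magnetic_laplacian G (prod_potential G1 G2 I theta1 theta2) in
  let Delta2 := magnetic_laplacian G2 theta2 in
  let T := tensor_op m1 m2 (mul_op m1 (fun x => (m1 x)^-1)) Delta2 in
  let M := (sup_deg G1 * ereal_sup (range (fun y => ((m2 y)^-1)%:E)))%E in
  [/\ dom (sqrt_op m Delta) =
        dom (tensor_op m1 m2 (mul_op m1 (fun x => (Num.sqrt (m1 x))^-1))
               (sqrt_op m2 Delta2)),
      compact_resolvent m Delta <-> ~ trivial_holonomy G2 theta2 &
      ~ trivial_holonomy G2 theta2 ->
      [/\ dom (sqrt_op m Delta) = dom (mul_op m (fun z => Num.sqrt (deg G z))),
          exists lambda mu : nat -> R,
            [/\ eigenvalue_seq Delta lambda, eigenvalue_seq T mu &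
                (lambda n / mu n) @[n --> \oo] --> (1 : R)],
          (M < +oo)%E &
          forall l : R, 0 <= l ->
            (eig_count m T (l - 2 * fine M) <= eig_count m Delta l)%E /\
            (eig_count m Delta l <= eig_count m T l)%E]].
Proof.
move=> G m1 m2 m Delta Delta2 T M.
have [hm finV2 hsup] := hcusp; have [y0 _] := hI.
have deg0 x : 0 <= deg G1 x by apply: (deg_ge0 (graph_lfm hG1 htheta1)); exact: graph_meas_gt0.
have q0 y : 0 <= (m2 y)^-1 by rewrite invr_ge0 ltW // graph_meas_gt0.
(* A vertex of each factor makes the suprema nonnegative, hence real: [o] in the first, and in the
   second a point [y0] of the nonempty set I. *)
have [ed d0 hd] := sup_nonneg o deg0 hsup.
have [eq qge0 hq] := sup_nonneg y0 q0 (sup_finite _ finV2).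
pose M' := fine (sup_deg G1) * fine (ereal_sup (range (fun y => ((m2 y)^-1)%:E))).
have eM : M = M'%:E by rewrite /M /sup_deg ed eq -EFinM.
have M0 : 0 <= M' by exact: mulr_ge0.
have hM := horiz_weight_sum I hG1 hG2 htheta1 hd hq.
have vanish := vanishing_meas_finite hG1 hm.
have [B0 [B [Bsym BB HB0 eS]]] := finite_laplacian_sqrt hG2 htheta2 finV2 (graph_meas_gt0 hG2).
have B0sym := sym_square Bsym BB.
have eD2 : Delta2 = lift_rel (fun f g => g = B0 f).
  rewrite /Delta2 (magnetic_laplacian_max (graph_lfm hG2 htheta2)
    (finite_core (m_gt0 := graph_meas_gt0 hG2) finV2)).
  by congr lift_rel; apply/funext => f; apply/funext => g; apply/propext; exact: HB0.
have eT := tensor_op_fibre (graph_meas_gt0 hG1) (prod_meas_gt0 hG1 hG2) finV2 (fun x => (m1 x)^-1) B0sym.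
have eN := tensor_op_fibre (graph_meas_gt0 hG1) (prod_meas_gt0 hG1 hG2) finV2 (fun x => (Num.sqrt (m1 x))^-1) Bsym.
have [K [Klin Kform Knorm HE]] :=
  cusp_bounded_part hG1 htheta1 htheta2 finV2 M0 hM HB0.
have hdom := cusp_sqrt_dom htheta1 htheta2 M0 Bsym BB Klin Kform Knorm HE.
have dom1 : dom (sqrt_op m Delta) = dom (tensor_op m1 m2 (mul_op m1 (fun x => (Num.sqrt (m1 x))^-1))
    (sqrt_op m2 Delta2)).
  by rewrite /Delta2 eS eN; exact: hdom.
split; first exact: dom1.
  split=> [hc ht|ht].
    exact: (trivial_holonomy_not_compact htheta1 htheta2 M0 Bsym BB HB0 Klin Knorm HE
      hV1 y0 ht hc).
  exact: (cusp_compact_resolvent htheta1 htheta2 M0 Bsym BB HB0 Klin Kform Knorm HE vanish ht).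
move=> ht; split.
- rewrite dom1 /Delta2 eS eN.
  exact: (cusp_deg_dom hG1 htheta1 htheta2 finV2 M0 hM Bsym BB HB0 ht).
- rewrite /T eD2 eT.
  exact: (cusp_eigenvalues htheta1 htheta2 M0 Bsym BB HB0 Klin Kform Knorm HE hV1 vanish y0 ht).
- by rewrite eM ltry.
- move=> l _; rewrite eM /= /T eD2 eT.
  exact: (cusp_counting htheta1 htheta2 M0 Bsym BB HB0 Klin Kform Knorm HE hV1 vanish y0 ht l).
Qed.
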